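(* Let $n\ge 2$ be a fixed integer and let $I\subseteq\mathbb{R}$ be an interval. Let $\Omega_n(Q,I)$ be the number of algebraic integers $\alpha\in I$ of degree $n$ (over $\mathbb{Q}$) and height $H(\alpha)\le Q$. Then, as $Q\to\infty$, \[ \frac{\Omega_n(Q,I)}{(2Q)^n} = 2^{-n}\int_I \widetilde\omega_n(Q^{-1},t)\,dt + r_n(Q,I), \] where the function $\widetilde\omega_n(\xi,t)$ is \[ \widetilde\omega_n(\xi,t)=\begin{cases} \phi_{n-1}(t)+2^{n-2}\xi^2t^2, & |t|\le \xi^{-1/2},\\ 2^{n-1}\xi, & \xi^{-1/2}<|t|<\xi^{-1}+1,\\ 0, & |t|\ge \xi^{-1}+1, \end{cases} \] and the remainder term satisfies \[ r_n(Q,I)=\begin{cases} O(Q^{-1}), & n\ge 3,\\ O\!\left(\frac{\ln Q}{Q}\right), & n=2,\end{cases} \] where the implicit big-O-constants depend only on $n$ (in particular, not on $I$).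
   Context: The height of a polynomial $p(x)=a_nx^n+\dots+a_0$ is $H(p)=\max_{0\le i\le n}|a_i|$. The minimal polynomial of an algebraic number $\alpha\in\mathbb{C}$ is the nonzero polynomial of minimal degree with coprime integer coefficients and positive leading coefficient vanishing at $\alpha$; the degree and height $H(\alpha)$ of $\alpha$ are those of its minimal polynomial. An algebraic integer is an algebraic number whose minimal polynomial is monic. For an integer $m\ge 1$ and $t\in\mathbb{R}$, \[ \phi_m(t)=\int_{G_m(t)}\left|\sum_{k=1}^m k p_k t^{k-1}\right|dp_1\dots dp_m, \] \[ G_m(t)=\left\{(p_1,\dots,p_m)\in\mathbb{R}^m:\ \max_{1\le k\le m}|p_k|\le 1,\ \left|\sum_{k=1}^m p_kt^k\right|\le 1\right\}. \] *)

(* Defs.v *)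
(* MathComp-Analysis *)
From HB Require Import structures.
From mathcomp Require Import all_boot all_order all_algebra.
From mathcomp Require Import finmap zify.
From mathcomp Require Import all_classical all_reals all_analysis.
Import Order.TTheory GRing.Theory Num.Theory.
Import numFieldNormedType.Exports.

Set Implicit Arguments.
Unset Strict Implicit.
Unset Printing Implicit Defensive.

Local Open Scope classical_set_scope.
Local Open Scope ring_scope.

(* The library has product measures of two factors and the product
   sigma-algebra on m.-tuple T, but no product measure on tuples: Lebesgue
   measure on R^m is transported along R * R^m ~ R^(m+1). *)
Section lebesgue_tuple.
Variable R : realType.
Local Notation mR := (measurableTypeR R).

Definition tuple_consp m (x : mR * m.-tuple mR) : m.+1.-tuple mR :=
  [tuple of x.1 :: x.2].

Definition tuple_unconsp m (v : m.+1.-tuple mR) : mR * m.-tuple mR :=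
  (thead v, [tuple of behead v]).

Lemma tuple_conspK m : cancel (@tuple_consp m) (@tuple_unconsp m).
Proof.
by move=> [x v]; congr pair; rewrite ?theadE//; exact/val_inj.
Qed.

Lemma measurable_tuple_consp m : measurable_fun setT (@tuple_consp m).
Proof. exact: measurable_cons. Qed.

HB.instance Definition _ m := isMeasurableFun.Build _ _ _ _ (@tuple_consp m)
  (@measurable_tuple_consp m).

Lemma measurable_tuple_unconsp m : measurable_fun setT (@tuple_unconsp m).
Proof.
apply/measurable_fun_pair; first exact: measurable_tnth.
exact: measurable_behead.
Qed.

Section step.
Variables (m : nat) (mu : {sigma_finite_measure set (m.-tuple mR) -> \bar R}).

Definition lebesgue_tupleS : set (m.+1.-tuple mR) -> \bar R :=
  pushforward (@lebesgue_measure R \x mu)%E (@tuple_consp m).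

Let lebesgue_tupleS0 : lebesgue_tupleS set0 = 0%E.
Proof. exact: measure0. Qed.

Let lebesgue_tupleS_ge0 A : (0 <= lebesgue_tupleS A)%E.
Proof. exact: measure_ge0. Qed.

Let lebesgue_tupleS_sigma_additive : semi_sigma_additive lebesgue_tupleS.
Proof. exact: measure_semi_sigma_additive. Qed.

HB.instance Definition _ := isMeasure.Build _ _ _ lebesgue_tupleS
  lebesgue_tupleS0 lebesgue_tupleS_ge0 lebesgue_tupleS_sigma_additive.

Let lebesgue_tupleS_sigma_finite : sigma_finite setT lebesgue_tupleS.
Proof.
have /sigma_finiteP[F [FT ndF Foo]] := sigma_finiteT (@lebesgue_measure R).
have /sigma_finiteP[H [HT ndH Hoo]] := sigma_finiteT mu.
exists (fun i => @tuple_unconsp m @^-1` (F i `*` H i)).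
  apply/esym; rewrite -subTset => v _.
  have : setT (tuple_unconsp v).1 by [].
  have : setT (tuple_unconsp v).2 by [].
  rewrite HT FT => -[i _ Hi] [j _ Fj].
  exists (maxn i j) => //; split => /=.
    by move: (Fj); exact/subsetPset/ndF/leq_maxr.
  by move: (Hi); exact/subsetPset/ndH/leq_maxl.
move=> i; have [[mF Fi] [mH Hi]] := (Foo i, Hoo i); split.
  rewrite -[X in measurable X]setTI; apply: measurable_tuple_unconsp => //.
  exact: measurableX.
rewrite /lebesgue_tupleS /pushforward (_ : _ @^-1` _ = F i `*` H i).
  by rewrite product_measure1E// lte_mul_pinfty// ge0_fin_numE.
rewrite -[LHS]comp_preimage (_ : _ \o _ = idfun) ?preimage_id//.
exact/funext/tuple_conspK.
Qed.

HB.instance Definition _ := Measure_isSigmaFinite.Build _ _ _ lebesgue_tupleS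
  lebesgue_tupleS_sigma_finite.

End step.

Fixpoint lebesgue_tuple m : {sigma_finite_measure set (m.-tuple mR) -> \bar R} :=
  match m with
  | 0 => \d_([tuple])
  | m'.+1 => lebesgue_tupleS (lebesgue_tuple m')
  end.

Lemma lebesgue_tuple_box m (A : 'I_m -> set mR) :
    (forall k, measurable (A k)) ->
  lebesgue_tuple m [set p | forall k, A k (tnth p k)] =
  (\prod_(k < m) lebesgue_measure (A k))%E.
Proof.
elim: m A => [|m IH] A mA.
  by rewrite big_ord0/= diracE mem_set// => -[].
rewrite big_ord_recl -IH//= /lebesgue_tupleS /pushforward.
rewrite -product_measure1E//; last first.
  rewrite [X in measurable X](_ : _ =
    \bigcap_(k in [set: 'I_m]) (fun p => tnth p k) @^-1` A (lift ord0 k)).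
    apply: fin_bigcap_measurable => // k _.
    by rewrite -[X in measurable X]setTI; exact: measurable_tnth.
  by apply/seteqP; split=> p /= Ap; [move=> k _|move=> k]; exact: Ap.
congr (_ _); apply/seteqP; split=> -[x v] /= Av.
  split; first by have := Av ord0.
  by move=> k; have := Av (lift ord0 k); rewrite tnthS.
case: Av => A0 Av k.
by have [j ->|->] := unliftP ord0 k; rewrite ?tnthS.
Qed.

End lebesgue_tuple.

Section density.
Variable R : realType.

(* The coordinate p_k, 1 <= k <= m, is [tnth p] at the ordinal k - 1. *)
Definition G_dom (m : nat) (t : R) : set (m.-tuple (measurableTypeR R)) :=
  [set p | \big[Num.max/0]_(k < m) `|tnth p k| <= 1 /\
           `|\sum_(k < m) tnth p k * t ^+ k.+1| <= 1].

Definition phi (m : nat) (t : R) : R :=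
  \int[lebesgue_tuple R m]_(p in @G_dom m t)
    `|\sum_(k < m) k.+1%:R * tnth p k * t ^+ k|.

Definition omega (n : nat) (xi t : R) : R :=
  if `|t| <= xi `^ (- 2^-1) then phi (n - 1) t + 2 ^+ (n - 2) * xi ^+ 2 * t ^+ 2
  else if `|t| < xi^-1 + 1 then 2 ^+ (n - 1) * xi
  else 0.

End density.

Section algebraic_integers.
Variable R : realType.

Definition height (p : {poly int}) : nat := \max_(i < size p) `|(p`_i)%R|%N.

(* [zcontents p] is the gcd of the coefficients of p, with the sign of its
   leading coefficient: it is 1 iff the coefficients are coprime and
   0 < lead_coef p. *)
Definition primitive_vanishing (p : {poly int}) (a : R) : Prop :=
  [/\ p != 0, zcontents p = 1 & root (map_poly intr p) a].

Definition is_minpoly (p : {poly int}) (a : R) : Prop :=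
  primitive_vanishing p a /\
  forall q : {poly int}, primitive_vanishing q a -> (size p <= size q)%N.

Definition algebraic_integers (n : nat) (Q : R) : set R :=
  [set a | exists2 p : {poly int}, is_minpoly p a &
    [/\ p \is monic, size p = n.+1 & (height p)%:R <= Q]].

Lemma height_coef (p : {poly int}) i : (`|(p`_i)%R| <= height p)%N.
Proof.
have [lip|lpi] := ltnP i (size p); last by rewrite nth_default.
exact: (@leq_bigmax _ (fun i : 'I_(size p) => `|(p`_i)%R|%N) (Ordinal lip)).
Qed.

Lemma finite_algebraic_integers n Q : finite_set (algebraic_integers n Q).
Proof.
pose B := (Num.truncn Q).+1.
pose P (f : {ffun 'I_n.+1 -> 'I_(B.*2.+1)}) : {poly int} :=
  \poly_(i < n.+1) ((f (inord i))%:Z - B%:Z).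
suff : algebraic_integers n Q `<=` \bigcup_(f in [set f | P f != 0])
    [set a | root (map_poly (intr : int -> R) (P f)) a].
  move/sub_finite_set; apply.
  apply: bigcup_finite => [|f /= Pf0]; first exact: finite_finset.
  have : map_poly (intr : int -> R) (P f) != 0.
    by rewrite map_poly_eq0_id0// intr_eq0 lead_coef_eq0.
  move: (map_poly _ _) => q q0.
  have [s sq] : exists s : seq R, forall x, root q x -> x \in s.
    move: (leqnn (size q)); move: {2}(size q) => k.
    elim: k q q0 => [|k IH] q q0.
      by rewrite leqn0 size_poly_eq0 (negbTE q0).
    move=> qk; have [[x qx]|nx] := pselect (exists x, root q x); last first.
      by exists [::] => x qx; exfalso; apply: nx; exists x.
    move: qx; rewrite root_factor_theorem => /dvdpP[r qE].
    have r0 : r != 0 by apply: contraNneq q0 => r0; rewrite qE r0 mul0r.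
    have [|s sr] := IH r r0.
      by move: qk; rewrite qE size_Mmonic ?monicXsubC// size_XsubC addn2.
    exists (x :: s) => y; rewrite qE rootM root_XsubC inE orbC.
    by case/orP => [->//|/sr ->]; rewrite orbT.
  apply: (@sub_finite_set _ _ [set` s]); last exact: finite_seq.
  by move=> x /= /sq.
move=> a [p [[p0 _ pa] _] [_ sp hp]].
have pB i : (`|(p`_i)%R| <= B)%N.
  rewrite (leq_trans (height_coef _ _))// ltnW// ltnS.
  by rewrite truncn_ge_nat// (le_trans _ hp).
pose f : {ffun 'I_n.+1 -> 'I_(B.*2.+1)} := [ffun i : 'I_n.+1 =>
  inord `|(p`_i + B%:Z)%R|%N].
suff Pf : P f = p by exists f; rewrite /= Pf.
apply/polyP => i; rewrite coef_poly; case: ltnP => [lin|]; last first.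
  by rewrite -sp => ?; rewrite nth_default.
rewrite ffunE inordK ?inordK//.
- rewrite gez0_abs ?addrK//.
  by have := pB i; lia.
- by have := pB i; lia.
Qed.

Definition Omega (n : nat) (Q : R) (I : interval R) : nat :=
  #|` fset_set ([set` I] `&` algebraic_integers n Q) |.

End algebraic_integers.

(* Main.v *)
(* Put m = n - 1 and xi = 1/Q.  A monic integer polynomial of degree n and
   height at most Q, divided by Q, is g(t) = xi t^n + p_m t^m + ... + p_1 t + p_0
   with (p_0, ..., p_m) a point of the lattice (1/Q) Z^n in [-1, 1]^n.  The
   values of one coefficient for which g has a root in an interval A form
   boundedly many intervals with multiplicity, because p_k = - (g - p_k t^k) / t^k
   is monotone on boundedly many pieces of A.  Replacing lattice sums by integrals
   one coordinate at a time thus costs O(Q^(n-1)).  In the coordinate p_0 the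
   area formula turns the number of roots into the integral over A of
   |g'(t)| 1(|g(t) - p_0| <= 1), so the lattice points with multiplicity
   number Q^n int_A psi(xi, t) dt + O(Q^(n-1)), where psi(xi, t) is the
   integral of |g'| 1(|g| <= 1), p_0 = 0, over (p_1, ..., p_m) in [-1, 1]^m.

   For bounded t, psi differs from omega by O(xi).  For large t, integrating
   over p_m along the slab |g(t)| <= 1 makes psi equal to t^-2 times the integral
   of int_(-1)^1 |xi t^2 - r - y| dy over the remaining coefficients, of which
   r = O(1/t) is an odd function; averaging over r and - r makes
   psi equal to omega, except when |t| is within O(1) of Q^(1/2) or of Q,
   where both are O(xi).  Hence psi - omega is O(xi) in L^1.

   Finally a root of g is an algebraic integer of degree n unless g is
   reducible.  If a monic p factors as f * h then |f_0| |h_j| = O(Q) for all j;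
   as one may take deg h >= 2 for n >= 3, summing over f_0 gives
   Q^(n-1) sum |f_0|^-2 = O(Q^(n-1)) such p, and Q sum |f_0|^-1 = O(Q log Q)
   when n = 2. *)

Require Import Defs.
From mathcomp Require Import all_boot all_order all_algebra.
From mathcomp Require Import finmap ring lra zify polyrcf.
From mathcomp Require Import all_classical all_reals all_analysis.
From mathcomp Require Import measurable_realfun.
Import Order.TTheory GRing.Theory Num.Theory.
Import numFieldNormedType.Exports.

Set Implicit Arguments.
Unset Strict Implicit.
Unset Printing Implicit Defensive.

Local Open Scope classical_set_scope.
Local Open Scope ring_scope.

(** * Lattice points and the number of real roots *)

(** Constants do not depend on the interval because the monotone pieces are cut at 0 and at the
    roots of [X p' - k p], whose number the degree bounds. The obstacle is that, once p_0 is
    integrated out, the function left to sum over p_1, ..., p_m is the area [farea], for which no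
    pieces in p_k are at hand. Its discrepancy is found by going back to p_0: Q times the area is
    within O(1) of a sum of O(Q) root counts, each of discrepancy O(1) in p_k, so Q times the
    discrepancy of the area is O(Q). For large t the key identity is g' = alpha + (m/t) g with alpha
    free of p_m. On the slab, g itself is a variable z in [-1, 1]. If m >= 2, alpha contains p_(m-1)
    with factor - t^(m-2); after division by t^(m-2) this coefficient is the y of the inner
    integral, and z, now weighted by m / t^(m-1), joins the perturbation r. If m = 1, z is y up to
    sign and r = 0. *)

Section grid.
Variable R : realType.
Implicit Types (Q x y : R) (K : set R).

Definition grid_size Q : nat := (Num.truncn Q).*2.+1.

Definition grid Q (i : nat) : R := (i%:R - (Num.truncn Q)%:R) / Q.

Definition grid_sum Q (f : R -> R) : R := \sum_(i < grid_size Q) f (grid Q i).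

Lemma grid_le Q i j : 0 < Q -> (grid Q i <= grid Q j) = (i <= j)%N.
Proof.
by move=> Q0; rewrite /grid ler_pM2r ?invr_gt0// lerD2r ler_nat.
Qed.

Lemma gridP Q i : 0 < Q -> (i < grid_size Q)%N -> -1 <= grid Q i <= 1.
Proof.
move=> Q0 iN; rewrite /grid ler_pdivrMr// ler_pdivlMr//.
have /andP[B1 B2] := truncn_itv (ltW Q0).
move: iN; rewrite /grid_size ltnS => iN.
have : i%:R <= (Num.truncn Q).*2%:R :> R by rewrite ler_nat.
have : 0 <= i%:R :> R by [].
rewrite -addnn natrD; lra.
Qed.

Lemma grid_between Q x y : 0 < Q -> -1 <= x -> x + Q^-1 <= y -> y <= 1 ->
  exists2 i, (i < grid_size Q)%N & x < grid Q i <= y.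
Proof.
move=> Q0 x1 xy y1.
set B := Num.truncn Q; have /andP[B1 B2] := truncn_itv (ltW Q0).
(* The index sought is the floor of [Q * x + B + 1], that of the first grid point beyond [x]; it is
   a natural number because [Q < B + 1] and [-1 <= x]. *)
have z0 : 0 <= Q * x + B.+1%:R.
  have : - Q <= Q * x by rewrite -mulrN1 ler_pM2l.
  rewrite -/B in B2; lra.
have /andP[i1 i2] := truncn_itv z0.
set i := Num.truncn _ in i1 i2.
have xi : x < grid Q i.
  rewrite /grid ltr_pdivlMr// -/B mulrC.
  move: i2; rewrite -[i.+1]addn1 -[B.+1]addn1 !natrD; lra.
have iy : grid Q i <= y.
  apply: le_trans xy; rewrite /grid ler_pdivrMr// mulrDl mulVf ?gt_eqF// -/B.
  by move: i1; rewrite -[B.+1]addn1 natrD mulrC; lra.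
exists i; last by rewrite xi.
rewrite /grid_size ltnS -/B.
have : grid Q i <= 1 by exact: le_trans y1.
rewrite /grid ler_pdivrMr// mul1r -/B lerBlDr => iQB.
have : i%:R < (B.+1 + B)%:R :> R.
  by rewrite natrD (le_lt_trans iQB)// ltrD2r.
by rewrite ltr_nat addSn addnn ltnS.
Qed.

Lemma sum_nat_itv (N a b : nat) : (a <= b < N)%N ->
  (\sum_(i < N) (a <= i <= b)%N = (b - a).+1)%N.
Proof.
move=> /andP[ab bN].
rewrite -(big_mkord xpredT (fun i => (a <= i <= b)%N : nat)).
rewrite (@big_cat_nat _ _ _ a) //=; last lia.
rewrite (@big_cat_nat _ _ _ b.+1 a) //=; last lia.
rewrite big_nat big1; last by move=> i; lia.
rewrite [X in (_ + (_ + X))%N]big_nat [X in (_ + (_ + X))%N]big1; last by move=> i; lia.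
rewrite big_nat (eq_bigr (fun=> 1%N)); last by move=> i; lia.
by rewrite -big_nat sum_nat_const_nat; lia.
Qed.

(** If a and b are the first and last indices of grid points in [K], then [K] contains the interval
    between these points and exceeds it by at most one mesh [1/Q] at each end, so the error is at
    most 1. The constant 2 is that of the case without grid points, where [K] lies within [1/Q] of
    any of its points. *)
Lemma grid_count Q K : 0 < Q -> is_interval K -> K `<=` `[-1, 1] ->
  `|Q * fine (lebesgue_measure K) - grid_sum Q \1_K| <= 2.
Proof.
move=> Q0 iK K1.
have mK : measurable K by exact: is_interval_measurable.
have KE x : K x -> -1 <= x <= 1 by move=> /K1/=; rewrite in_itv.
have Q0' : 0 < Q^-1 by rewrite invr_gt0.
have ub a b : a <= b -> K `<=` `[a, b] -> fine (lebesgue_measure K) <= b - a.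
  move=> ab Kab; have -> : b - a = fine (lebesgue_measure `[a, b]%classic).
    by rewrite lebesgue_measure_itv/= lte_fin; case: ltP => //= ?; lra.
  apply: fine_le.
  - rewrite ge0_fin_numE// (@le_lt_trans _ _ (lebesgue_measure `[a, b]%classic))//.
      by apply: le_measure; rewrite ?inE.
    by rewrite lebesgue_measure_itv/=; case: ifP => _; rewrite ltry.
  - by rewrite lebesgue_measure_itv/=; case: ifP.
  - by apply: le_measure; rewrite ?inE.
have lb a b : a <= b -> `[a, b] `<=` K -> b - a <= fine (lebesgue_measure K).
  move=> ab Kab; have -> : b - a = fine (lebesgue_measure `[a, b]%classic).
    by rewrite lebesgue_measure_itv/= lte_fin; case: ltP => //= ?; lra.
  apply: fine_le.
  - by rewrite lebesgue_measure_itv/=; case: ifP.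
  - rewrite ge0_fin_numE// (@le_lt_trans _ _ (lebesgue_measure `[-1 : R, 1]%classic))//.
      by apply: le_measure; rewrite ?inE.
    by rewrite lebesgue_measure_itv/=; case: ifP => _; rewrite ltry.
  - by apply: le_measure; rewrite ?inE.
have [[i0 iN0 Ki0]|noi] := pselect (exists2 i, (i < grid_size Q)%N & K (grid Q i)).
  pose P i := (i < grid_size Q)%N && `[< K (grid Q i) >].
  have exP : exists i, P i by exists i0; rewrite /P iN0/=; apply/asboolP.
  have leP i : P i -> (i <= grid_size Q)%N by case/andP => /ltnW.
  case: (ex_minnP exP) => a /andP[aN /asboolP Ka] mina.
  case: (ex_maxnP exP leP) => b /andP[bN /asboolP Kb] maxb.
  have ab : (a <= b)%N by apply: mina; rewrite /P bN; exact/asboolP.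
  have -> : grid_sum Q \1_K = (b - a).+1%:R.
    rewrite -(@sum_nat_itv (grid_size Q)) ?ab// natr_sum; apply: eq_bigr => i _.
    rewrite indicE; congr (nat_of_bool _)%:R; apply/idP/idP => [|/andP[ai ib]].
      rewrite inE => Ki; have Pi : P i by rewrite /P ltn_ord; exact/asboolP.
      by rewrite mina// maxb.
    by rewrite inE; apply: (iK _ _ Ka Kb); rewrite !grid_le// ai.
  have E : grid Q b - grid Q a = (b - a)%:R / Q.
    by rewrite /grid -mulrBl natrB//; congr (_ / _); lra.
  have lo : grid Q b - grid Q a <= fine (lebesgue_measure K).
    apply: lb; first by rewrite grid_le.
    by move=> x; rewrite /= in_itv/=; exact: iK.
  have hi : fine (lebesgue_measure K) <= (grid Q b + Q^-1) - (grid Q a - Q^-1).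
    apply: ub.
      by have : grid Q a <= grid Q b by [rewrite grid_le|]; lra.
    move=> x Kx /=; rewrite in_itv/=; apply/andP; split; rewrite leNgt; apply/negP => xa.
      have [|||j jN /andP[xj ja]] := @grid_between Q x (x + Q^-1) Q0.
      - by have /andP[] := KE _ Kx.
      - by lra.
      - by have /andP[] := KE _ Ka; lra.
      have Pj : P j.
        rewrite /P jN; apply/asboolP; apply: (iK _ _ Kx Ka).
        by rewrite (ltW xj); lra.
      by have := mina _ Pj; rewrite -(grid_le _ _ Q0); lra.
    have [|||i iN /andP[xi ia]] := @grid_between Q (grid Q b) x Q0.
    - by have /andP[] := KE _ Kb.
    - by lra.
    - by have /andP[] := KE _ Kx; lra.
    have Pi : P i.
      rewrite /P iN; apply/asboolP; apply: (iK _ _ Kb Kx).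
      by rewrite (ltW xi).
    have := maxb _ Pi; rewrite -(grid_le _ _ Q0); lra.
  have lo' : (b - a)%:R <= Q * fine (lebesgue_measure K).
    by move: lo; rewrite E ler_pdivrMr// mulrC.
  have hi' : Q * fine (lebesgue_measure K) <= (b - a)%:R + 2.
    rewrite mulrC -ler_pdivlMr// mulrDl; move: hi; rewrite -E; lra.
  rewrite ler_norml -[(b - a).+1]addn1 natrD; lra.
have -> : grid_sum Q \1_K = 0.
  rewrite /grid_sum big1// => i _; rewrite indicE memNset// => Ki.
  by apply: noi; exists i.
rewrite subr0 ger0_norm; last by rewrite mulr_ge0 ?(ltW Q0)// fine_ge0.
rewrite mulrC -ler_pdivlMr//.
have [[x Kx]|] := pselect (K !=set0); last first.
  by move/set0P/negP/negPn/eqP => ->; rewrite measure0/= mulr_ge0// ltW.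
have -> : 2 / Q = (x + Q^-1) - (x - Q^-1) by lra.
apply: ub; first lra.
move=> y Ky /=; rewrite in_itv/=; apply/andP; split; rewrite leNgt; apply/negP => xa.
  have [|||i iN /andP[xi ia]] := @grid_between Q y x Q0.
  - by have /andP[] := KE _ Ky.
  - by lra.
  - by have /andP[] := KE _ Kx.
  by apply: noi; exists i => //; apply: (iK _ _ Ky Kx); rewrite (ltW xi).
have [|||i iN /andP[xi ia]] := @grid_between Q x y Q0.
- by have /andP[] := KE _ Kx.
- by lra.
- by have /andP[] := KE _ Ky.
by apply: noi; exists i => //; apply: (iK _ _ Kx Ky); rewrite (ltW xi).
Qed.

End grid.

(** * Real roots of the pencil p + x X^k as x varies *)

Section root_count.
Variable R : realType.
Implicit Types (p : {poly R}) (A : set R).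

(** [rootsR] lists distinct roots and is empty for the zero polynomial, so multiplicities are
    ignored and the degree bound always holds. *)
Definition root_count A p : nat := count (fun t => `[< A t >]) (rootsR p).

Lemma mem_rootsR p t : p != 0 -> (t \in rootsR p) = root p t.
Proof. by move=> p0; rewrite -(roots_on_rootsR p0) in_itv. Qed.

Lemma uniq_rootsR p : uniq (rootsR p).
Proof. exact: (sorted_uniq lt_trans ltxx (sorted_roots _ _ _)). Qed.

Lemma size_rootsR p : (size (rootsR p) <= (size p).-1)%N.
Proof.
have [->|p0] := eqVneq p 0; first by rewrite rootsR0.
rewrite -ltnS prednK ?lt0n ?size_poly_eq0//.
apply: max_poly_roots => //; last exact: uniq_rootsR.
by apply/allP => t; rewrite mem_rootsR.
Qed.

Lemma root_count_le A p : (root_count A p <= (size p).-1)%N.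
Proof. exact: leq_trans (count_size _ _) (size_rootsR p). Qed.

Lemma root_countU A1 A2 p : [disjoint A1 & A2]%classic ->
  root_count (A1 `|` A2) p = (root_count A1 p + root_count A2 p)%N.
Proof.
move=> dA; rewrite /root_count -count_predUI.
rewrite [X in (_ + X)%N](eq_count (a2 := pred0)) ?count_pred0 ?addn0; last first.
  move=> t /=; apply/negbTE/negP => /andP[/asboolP A1t /asboolP A2t].
  by move/disj_setPS : dA => /(_ t); apply.
by apply: eq_count => t /=; rewrite asbool_or.
Qed.

Lemma root_count1 A t p : A t -> p != 0 -> root p t ->
  (forall u, A u -> root p u -> u = t) -> root_count A p = 1%N.
Proof.
move=> At p0 pt tu; have <- : count_mem t (rootsR p) = 1%N.
  by rewrite count_uniq_mem ?uniq_rootsR// mem_rootsR// pt.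
rewrite /root_count; apply: eq_in_count => u; rewrite mem_rootsR// => pu /=.
by apply/asboolP/eqP => [/tu|->//]; apply.
Qed.

Lemma root_count0 A p : (forall t, A t -> ~~ root p t) -> root_count A p = 0%N.
Proof.
move=> H; have [->|p0] := eqVneq p 0; first by rewrite /root_count rootsR0.
rewrite /root_count (eq_in_count (a2 := pred0)) ?count_pred0//.
move=> t; rewrite mem_rootsR// => pt; apply/asboolP => /H.
by rewrite pt.
Qed.

Lemma root_count_set1 t p : p != 0 -> root_count [set t] p = root p t :> nat.
Proof.
move=> p0; case: (boolP (root p t)) => pt; first by apply: (@root_count1 _ t).
by apply: root_count0 => _ ->.
Qed.

Section level.
Variables (p : {poly R}) (k : nat).
Hypothesis pX0 : forall x, p + x *: 'X^k != 0.

(** For t != 0, p + x X^k vanishes at t exactly when x = [h t], and the derivative of [h] is - q(t)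
    / t^(k+1): the roots of [q], with 0, delimit the monotone pieces of [h]. *)
Let q := 'X * p^`() - k%:R *: p.
Let h (t : R) := - (p.[t] * (t ^+ k)^-1).

Lemma root_level t x : t != 0 -> root (p + x *: 'X^k) t = (x == h t).
Proof.
move=> t0; rewrite /root !hornerE /h.
have tk : t ^+ k != 0 by rewrite expf_neq0.
rewrite -[RHS](inj_eq (mulIf tk)) mulNr mulfVK// -[RHS]subr_eq0.
by congr (_ == 0); rewrite opprK addrC.
Qed.

Lemma is_derive_level (t : R) : t != 0 ->
  is_derive t 1 h (- (q.[t] / t ^+ k.+1)).
Proof.
move=> t0; have tk : t ^+ k != 0 by rewrite expf_neq0.
have dX : is_derive t 1 (fun u : R => u ^+ k) (k%:R * t ^+ k.-1).
  have := @is_deriveX _ _ (@id R) k t 1 1 (is_derive_id t 1).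
  rewrite (_ : id ^+ k = (fun u : R => u ^+ k)); last first.
    by apply/funext => u; rewrite fctE.
  by move/trigger_derive; apply; rewrite /GRing.scale/= mulr1.
have dV := @is_deriveV R (fun u : R => u ^+ k) t _ _ tk dX.
have dM := is_deriveM (is_derive_poly p t) dV.
have := is_deriveN dM.
move/trigger_derive; apply.
rewrite /q !hornerE /= /GRing.scale/=.
case: k tk => [|k'] tk /=; first by rewrite !expr0 expr1; field.
rewrite !exprS; field.
by rewrite t0 expf_neq0.
Qed.

Let h_cont t : t != 0 -> {for t, continuous h}.
Proof.
move=> t0; apply: differentiable_continuous; apply/derivable1_diffP.
by have [] := is_derive_level t0.
Qed.

(** By Rolle [h] is injective on [A], so each x is attained at most once; by continuity the image of
    [A] is again an interval. *)
Lemma root_count_level A : is_interval A ->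
    (forall t, A t -> t != 0 /\ q.[t] != 0) ->
  is_interval (h @` A) /\
  forall x, (root_count A (p + x *: 'X^k))%:R = \1_(h @` A) x :> R.
Proof.
move=> iA A0.
have hinj a b : A a -> A b -> a < b -> h a <> h b.
  move=> Aa Ab ab hab.
  have Aab t : t \in `[a, b] -> A t by rewrite in_itv/=; exact: iA.
  have [t tab|||t tab dt] := @Rolle R h a b ab.
  - have /is_derive_level[] // : t != 0.
    by have [] := A0 t (Aab _ (subset_itv_oo_cc tab)).
  - apply: continuous_in_subspaceT => t /set_mem tab; apply: h_cont.
    by have [] := A0 t (Aab _ tab).
  - exact: hab.
  have [t0 qt] := A0 t (Aab _ (subset_itv_oo_cc tab)).
  have [_ ] := is_derive_level t0; have [_ ->] := dt.
  by move/eqP; rewrite eq_sym oppr_eq0 mulf_eq0 invr_eq0 expf_eq0/= (negbTE qt) (negbTE t0).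
split.
  apply/connected_intervalP/connected_continuous_connected.
    exact/connected_intervalP.
  apply: continuous_in_subspaceT => t /set_mem tab; apply: h_cont.
  by have [] := A0 t tab.
move=> x; rewrite indicE.
have [[t At htx]|nx] := pselect ((h @` A) x).
  rewrite mem_set; last by exists t.
  rewrite (@root_count1 _ t)//; first by rewrite root_level ?htx//; have [] := A0 _ At.
  move=> u Au; rewrite root_level; last by have [] := A0 _ Au.
  rewrite -htx => /eqP htu.
  have [ut|tu|//] := ltgtP u t; first by case: (hinj _ _ Au At ut).
  by case: (hinj _ _ At Au tu).
rewrite memNset// root_count0// => t At.
rewrite root_level; last by have [] := A0 _ At.
by apply/eqP => xE; apply: nx; exists t.
Qed.

(** If t^k != 0, the point t is a root for exactly one x; if t^k = 0, being a root does not depend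
    on x, and [K] is empty or the whole line. *)
Lemma root_count_level1 (t : R) :
  exists2 K : set R, is_interval K &
  forall x, (root_count [set t] (p + x *: 'X^k))%:R = \1_K x :> R.
Proof.
exists [set x | root (p + x *: 'X^k) t]; last first.
  by move=> x; rewrite root_count_set1// indicE; congr (nat_of_bool _)%:R; apply/idP/idP; rewrite inE.
move=> x y /=; rewrite !/(root _ _) !hornerE.
have [tk|tk] := eqVneq (t ^+ k) 0.
  by move=> xE _ z _; move: xE; rewrite /root !hornerE tk !mulr0.
move=> /eqP xE /eqP yE z /andP[xz zy].
have xy : x = y by apply: (mulIf tk); move: xE yE; lra.
have zx : z = x by apply/eqP; rewrite eq_le xz xy zy.
by rewrite zx /root !hornerE xE.
Qed.

Lemma root_count_intervals (s : seq R) A : is_interval A ->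
    (forall t, A t -> t \notin s -> t != 0 /\ q.[t] != 0) ->
  exists Ks : seq (set R), [/\ (size Ks <= 2 ^ (size s).+1)%N,
    (forall i, (i < size Ks)%N -> is_interval (nth set0 Ks i)) &
    forall x, (root_count A (p + x *: 'X^k))%:R = \sum_(i < size Ks) \1_(nth set0 Ks i) x :> R].
Proof.
(* The strict bound carries the induction: two families of at most 2^(r+1) - 1 intervals, and one
   more for the split point, still number less than 2^(r+2). *)
suff : is_interval A -> (forall t, A t -> t \notin s -> t != 0 /\ q.[t] != 0) ->
  exists Ks : seq (set R), [/\ (size Ks < 2 ^ (size s).+1)%N,
    (forall i, (i < size Ks)%N -> is_interval (nth set0 Ks i)) &
    forall x, (root_count A (p + x *: 'X^k))%:R = \sum_(i < size Ks) \1_(nth set0 Ks i) x :> R].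
  by move=> H iA As; have [Ks [? ? ?]] := H iA As; exists Ks; split => //; exact: ltnW.
elim: s A => [|a s IH] A iA As.
  have [t At|iK KE] := root_count_level iA; first exact: As.
  exists [:: h @` A]; split => //; first by case.
  by move=> x; rewrite big_ord1.
have iL : is_interval (A `&` [set t | t < a]).
  move=> x y [Ax /= xa] [Ay /= ya] z /andP[xz zy]; split.
    by apply: (iA _ _ Ax Ay); rewrite xz.
  exact: le_lt_trans ya.
have iG : is_interval (A `&` [set t | a < t]).
  move=> x y [Ax /= xa] [Ay /= ya] z /andP[xz zy]; split.
    by apply: (iA _ _ Ax Ay); rewrite xz.
  exact: lt_le_trans xz.
have [|L [sL iLs LE]] := IH _ iL.
  move=> t [At /= ta] ts; apply: As => //.
  by rewrite inE negb_or ts lt_eqF.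
have [|G [sG iGs GE]] := IH _ iG.
  move=> t [At /= ta] ts; apply: As => //.
  by rewrite inE negb_or ts gt_eqF.
have [K iK KE] : exists2 K : set R, is_interval K &
  forall x, (root_count (A `&` [set a]) (p + x *: 'X^k))%:R = \1_K x :> R.
  have [Aa|nAa] := pselect (A a).
    rewrite (_ : A `&` [set a] = [set a]); first exact: root_count_level1.
    by apply/seteqP; split=> [t []|t ->].
  exists set0; first by move=> ? ? [].
  by move=> x; rewrite root_count0 ?indic0// => t [At ta]; case: nAa; rewrite -ta.
exists (K :: L ++ G); split.
- by rewrite /= size_cat expnS; move: sL sG; rewrite expnS; lia.
- case=> [//|i] /=; rewrite size_cat nth_cat ltnS.
  by case: (ltnP i (size L)) => [iL' _|Li]; [exact: iLs|rewrite -ltn_subLR// => /iGs].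
move=> x; rewrite /= big_ord_recl/= -KE size_cat big_split_ord/=.
under eq_bigr do rewrite nth_cat ltn_ord.
have nthG i : nth set0 (L ++ G) (size L + i) = nth set0 G i.
  by rewrite nth_cat ltnNge leq_addr addKn.
under [X in _ + (_ + X)]eq_bigr do rewrite nthG.
rewrite -LE -GE -!natrD -!root_countU.
- congr (root_count _ _)%:R; apply/seteqP; split => t; last by case=> [[]//|[[]|[]]].
  by move=> At; have [ta|ta|ta] := ltgtP t a; [right; left|right; right|left].
- apply/disj_setPS => t [[_ ta] [[_ /= at']|[_ /= at']]]; move: at'; rewrite ta ltxx//.
- by apply/disj_setPS => t [[_ /= ta] [_ /= /(lt_trans ta)]]; rewrite ltxx.
Qed.

End level.

End root_count.
Section grid_discrepancy.
Variable R : realType.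
Local Notation mu := (@lebesgue_measure R).
Implicit Types (p g : {poly R}) (A K : set R) (Q : R).

Lemma is_intervalI (A1 A2 : set R) : is_interval A1 -> is_interval A2 ->
  is_interval (A1 `&` A2).
Proof.
by move=> i1 i2 x y [x1 x2] [y1 y2] z xyz; split; [apply: i1 xyz|apply: i2 xyz].
Qed.

Lemma lebesgue_itv11 : mu `[-1 : R, 1]%classic = 2%:E.
Proof. by rewrite lebesgue_measure_itv/= lte_fin ifT ?EFinN; [congr EFin|]; lra. Qed.

(** The points to avoid are 0 and the at most n roots of [q]; they give at most 2^(n+2) intervals,
    each with error 2 by [grid_count]. *)
Lemma root_count_grid p k n A Q : 0 < Q -> (size p <= n.+1)%N ->
    (forall x, p + x *: 'X^k != 0) -> 'X * p^`() - k%:R *: p != 0 ->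
    is_interval A ->
  let N x := (root_count A (p + x *: 'X^k))%:R : R in
  measurable_fun setT N /\
  `|Q * \int[mu]_(x in `[-1, 1]) N x - grid_sum Q N| <= 2 * 2 ^+ n.+2.
Proof.
move=> Q0 sp pX0 q0 iA N; set q := _ - _ in q0.
have sq : (size q <= n.+1)%N.
  apply/leq_sizeP => i ni; rewrite coefB coefZ coefXM.
  have pi0 : p`_i = 0 by rewrite nth_default// (leq_trans sp ni).
  by case: i ni pi0 => [|i] // _; rewrite coef_deriv /= => ->; rewrite mul0rn mulr0 subrr.
have [|Ks [sK iK KE]] := @root_count_intervals R p k pX0 (0 :: rootsR q) A iA.
  by move=> t At; rewrite inE negb_or mem_rootsR// => /andP[-> qt].
have NE : N = fun x => \sum_(i < size Ks) \1_(nth set0 Ks i) x by apply/funext.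
have mK (i : 'I_(size Ks)) : measurable (nth set0 Ks i).
  by apply: is_interval_measurable; exact: iK.
split; first by rewrite NE; apply: measurable_sum => i; exact: measurable_indic.
pose L (i : 'I_(size Ks)) := nth set0 Ks i `&` `[-1, 1].
have Loo i : mu (L i) \is a fin_num.
  rewrite ge0_fin_numE// (@le_lt_trans _ _ (mu `[-1 : R, 1]%classic))//.
    apply: le_measure; rewrite ?inE//=; last exact: subIsetr.
    by apply: measurableI => //; exact: mK.
  by rewrite lebesgue_itv11 ltry.
have -> : \int[mu]_(x in `[-1, 1]) N x = \sum_(i < size Ks) fine (mu (L i)).
  rewrite /Rintegral NE; under eq_integral do rewrite -sumEFin.
  rewrite ge0_integral_sum//; last first.
    by move=> i; apply/measurable_EFinP/measurable_indic; exact: mK.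
  rewrite (eq_bigr (fun i => mu (L i))); last first.
    by move=> i _; rewrite integral_indic//; exact: mK.
  by rewrite -sum_fine.
have -> : grid_sum Q N = \sum_(i < size Ks) grid_sum Q \1_(L i).
  rewrite /grid_sum exchange_big/=; apply: eq_bigr => j _; rewrite NE.
  apply: eq_bigr => i _; rewrite !indicE; congr (nat_of_bool _)%:R.
  apply/idP/idP; rewrite !inE; last by case.
  by move=> Kj; split => //=; rewrite in_itv/=; exact: gridP.
rewrite mulr_sumr -sumrB (le_trans (ler_norm_sum _ _ _))//.
apply: (@le_trans _ _ (\sum_(i < size Ks) 2)).
  apply: ler_sum => i _; apply: grid_count => //; last exact: subIsetr.
  by apply: is_intervalI; [exact: iK|exact: interval_is_interval].
rewrite sumr_const card_ord -[_ *+ size Ks]mulr_natr ler_pM2l// -natrX ler_nat (leq_trans sK)//.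
rewrite leq_pexp2l//= ltnS ltnS (leq_trans (size_rootsR _))//.
by move: sq; case: (size q).
Qed.

End grid_discrepancy.
(** * The area formula *)

Section area.
Variable R : realType.
Local Notation mu := (@lebesgue_measure R).
Implicit Types (p g : {poly R}) (A K : set R).

Lemma poly_sublevel_bounded g : (1 < size g)%N ->
  exists M : R, forall t, `|g.[t]| <= 1 -> `|t| <= M.
Proof.
have side p : (1 < size p)%N -> exists M : R, forall t, `|p.[t]| <= 1 -> t <= M.
  move=> sp; have p0 : p != 0 by rewrite -size_poly_gt0 ltnW.
  (* Squaring makes the leading coefficient positive whatever the sign of [p] at infinity, so that
     p^2 - 2 is positive beyond some [M]. *)
  have lc : lead_coef (p ^+ 2 - 2%:P) = lead_coef p ^+ 2.
    rewrite lead_coefDl ?lead_coef_exp// size_polyN size_polyC pnatr_eq0/=.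
    have := size_exp p 2; move: sp.
    by case: (size p) => [//|[//|s]] _; case: (size _) => [|[|r]].
  have [|M HM] := @poly_pinfty_gt_lc _ (p ^+ 2 - 2%:P).
    by rewrite lc exprn_even_gt0// lead_coef_eq0.
  exists M => t; apply: contraTT; rewrite -!ltNge => /ltW/HM.
  rewrite lc !hornerE => H.
  have l2 : 0 <= lead_coef p ^+ 2 by exact: sqr_ge0.
  have : 1 < `|p.[t]| ^+ 2 by rewrite real_normK ?num_real//; move: H l2; rewrite !expr2; lra.
  by rewrite expr_gt1.
move=> sg; have [M1 H1] := side _ sg.
have [|M2 H2] := side (g \Po (- 'X)).
  by rewrite size_comp_poly2// size_polyN size_polyX.
exists (Num.max M1 M2) => t gt; rewrite ler_norml lerNl !le_max (H1 t gt)/= andbT.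
apply/orP; right; apply: H2.
by rewrite horner_comp !hornerE opprK.
Qed.

Lemma poly_between g x y z : (forall t, t \in `]x, y[ -> g^`().[t] != 0) ->
  x <= z <= y -> 0 <= (g.[z] - g.[x]) * (g.[y] - g.[z]).
Proof.
move=> g0 /andP[]; rewrite le_eqVlt => /predU1P[->|xz]; first by rewrite subrr mul0r.
rewrite le_eqVlt => /predU1P[->|zy]; first by rewrite subrr mulr0.
have mvt a b : a < b -> exists2 c, c \in `]a, b[ & g.[b] - g.[a] = g^`().[c] * (b - a).
  by move=> ab; apply: MVT => //; apply: continuous_subspaceT; exact: continuous_horner.
have [c cxz ->] := mvt _ _ xz.
have [d dzy ->] := mvt _ _ zy.
have cxy : c \in `]x, y[ by move: cxz; rewrite !in_itv/= => /andP[-> /lt_trans->].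
have dxy : d \in `]x, y[ by move: dzy; rewrite !in_itv/= => /andP[/(lt_trans xz)-> ->].
have sE := @polyrN0_itv _ `]x, y[ g^`() _ _ _ cxy dxy.
have : 0 < g^`().[c] * g^`().[d].
  rewrite -sgr_gt0 sgrM sE; first by rewrite -expr2 exprn_even_gt0//= sgr_eq0 g0.
  by move=> t txy; rewrite /root g0.
have : 0 < (z - x) * (y - z) by rewrite mulr_gt0// subr_gt0.
by move=> H1 H2; rewrite mulrACA mulr_ge0// ltW.
Qed.

Lemma FTC_abs_deriv g (a b : R) : a < b ->
  (forall t, t \in `]a, b[ -> g^`().[t] != 0) ->
  (\int[mu]_(t in `[a, b]) (`|g^`().[t]|)%:E = `|g.[b] - g.[a]|%:E)%E.
Proof.
move=> ab g0; set m := (a + b) / 2.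
have mab : m \in `]a, b[ by exact: mid_in_itvoo.
pose s := Num.sg g^`().[m].
have sE t : t \in `]a, b[ -> `|g^`().[t]| = s * g^`().[t].
  move=> tab; rewrite /s normrEsg; congr (_ * _).
  by apply: (@polyrN0_itv _ `]a, b[) => // u uab; rewrite /root g0.
rewrite (@continuous_FTC2 _ _ (fun t => s * g.[t])%R)//.
- rewrite -EFinB -mulrBr; congr EFin.
  have [c cab cE] : exists2 c, c \in `]a, b[ & g.[b] - g.[a] = g^`().[c] * (b - a).
    by apply: MVT => //; apply: continuous_subspaceT; exact: continuous_horner.
  by rewrite cE mulrA -sE// normrM [X in _ = _ * X]ger0_norm// subr_ge0 ltW.
- apply: continuous_subspaceT => t.
  by apply: (@continuous_comp _ _ _ (horner g^`()) Num.norm); [exact: continuous_horner|exact: norm_continuous].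
- have cs : continuous (fun t : R => s * g.[t])%R.
    by move=> t; apply: cvgM; [exact: cvg_cst|exact: continuous_horner].
  split.
  + by move=> t tab; apply: derivableM; [exact: derivable_cst|exact: derivable_horner].
  + exact/cvg_at_right_filter/cs.
  + exact/cvg_at_left_filter/cs.
- move=> t tab; rewrite sE// derive1E.
  have [_ ->] := @is_deriveZ _ _ _ (horner g) s t 1 _ (is_derive_poly g t).
  by [].
Qed.

(** Without critical points [g] is monotone, and integrating |g'| measures its range. The minus sign
    is there because t is a root of g + x exactly when x = - g(t). *)
Lemma area_mono g A : (1 < size g)%N -> is_interval A ->
    (forall t, A t -> g^`().[t] != 0) ->
  (\int[mu]_(t in A) (`|g^`().[t]| * (`|g.[t]| <= 1)%R%:R)%:E =
   mu ((fun t => - g.[t])%R @` A `&` `[(-1)%R, 1%R]))%E.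
Proof.
move=> sg iA g0.
pose W := A `&` [set t | `|g.[t]| <= 1].
have -> : (fun t => - g.[t]) @` A `&` `[-1, 1] = (fun t => - g.[t]) @` W.
  apply/seteqP; split => [_ [[t At <-] /=]|_ [t [At /= gt] <-]].
    rewrite in_itv/= => gt; exists t => //; split => //=.
    by rewrite ler_norml; lra.
  split; first by exists t.
  by rewrite /= in_itv/=; move: gt; rewrite ler_norml; lra.
have iW : is_interval W.
  move=> x y [Ax /= gx] [Ay /= gy] z xzy; split; first exact: iA xzy.
  have := @poly_between g x y z _ xzy.
  rewrite /= => /(_ _)/wrap[t|].
    by rewrite in_itv/= => /andP[/ltW xt /ltW ty]; apply/g0/(iA _ _ Ax Ay); rewrite xt.
  move: gx gy; rewrite !ler_norml => /andP[? ?] /andP[? ?] H; apply/andP; split.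
    rewrite leNgt; apply/negP => ?.
    have : 0 < (g.[x] - g.[z]) * (g.[y] - g.[z]) by apply: mulr_gt0; lra.
    lra.
  rewrite leNgt; apply/negP => ?.
  have : 0 < (g.[z] - g.[x]) * (g.[z] - g.[y]) by apply: mulr_gt0; lra.
  lra.
transitivity (\int[mu]_(t in W) (`|g^`().[t]|)%:E)%E.
  rewrite [RHS]integral_mkcondr; apply: eq_integral => t _.
  rewrite patchE; case: ifPn; first by rewrite inE/= => ->; rewrite mulr1.
  by rewrite notin_setE/= => /negP/negbTE ->; rewrite mulr0.
have [M HM] := poly_sublevel_bounded sg.
have WM t : W t -> `|t| <= M by case=> _ /HM.
have hW : W = [set` Rhull W] by rewrite -[LHS](RhullK (mem_set iW)).
have triv : (forall t u, W t -> W u -> t = u) ->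
    (\int[mu]_(t in W) (`|g^`().[t]|)%:E = mu ((fun t => - g.[t])%R @` W))%E.
  move=> H; have [[t Wt]|/set0P/negP/negPn/eqP ->] := pselect (W !=set0); last first.
    by rewrite integral_set0 image_set0 measure0.
  have -> : W = [set t] by apply/seteqP; split => [u Wu|_ -> //]; exact: H.
  by rewrite integral_set1 image_set1 lebesgue_measure_set1.
(* A hull with an infinite endpoint is either empty or unbounded, the latter against the bound [M];
   a bounded hull with b <= a has at most one point. Only a nondegenerate bounded interval
   remains. *)
case E : (Rhull W) => [[ba a|[]] [bb b|[]]]; rewrite E in hW; last 8 first.
all: try by apply: triv => t u; rewrite hW /= !in_itv/= ?andbF.
- have : W (Num.max (a + 1) (M + 1)).
    rewrite hW /= in_itv/= andbT.
    by case: ba {E hW}; rewrite /= ?lt_max ?le_max; apply/orP; left; lra.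
  by move=> /WM {triv} H; exfalso; move: H; rewrite ler_norml ge_max; lra.
- have : W (Num.min (b - 1) (- M - 1)).
    rewrite hW /= in_itv/=.
    by case: bb {E hW}; rewrite /= ?gt_min ?ge_min; apply/orP; left; lra.
  by move=> /WM {triv} H; exfalso; move: H; rewrite ler_norml le_min; lra.
- have : W (M + 1) by rewrite hW /= in_itv.
  by move=> /WM {triv} H; exfalso; move: H; rewrite ler_norml; lra.
have [ab|ba'] := ltP a b; last first.
  apply: triv => t u; rewrite hW /= !in_itv/= => ht hu.
  by apply/eqP; move: ht hu; case: (ba); case: (bb); rewrite /=; lra.
have sub t : t \in `]a, b[ -> W t.
  by rewrite hW /= => tab; apply: subset_itv tab; rewrite bnd_simp.
have g0ab t : t \in `]a, b[ -> g^`().[t] != 0 by move=> /sub[At _]; exact: g0.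
rewrite [in LHS]hW integral_itv_bndoo; last first.
  by apply: measurable_funTS; apply/measurable_EFinP/measurableT_comp => //; apply: continuous_measurable_fun; exact: continuous_horner.
rewrite -[LHS](@integral_itv_bndoo _ a b _ true false); last first.
  by apply: measurable_funTS; apply/measurable_EFinP/measurableT_comp => //; apply: continuous_measurable_fun; exact: continuous_horner.
rewrite FTC_abs_deriv//.
have Wab t : W t -> a <= t <= b.
  by rewrite hW/= in_itv/=; case: (ba); case: (bb) => /=; lra.
set K := _ @` W.
pose al := Num.min (- g.[a]) (- g.[b]); pose be := Num.max (- g.[a]) (- g.[b]).
have beal : be - al = `|g.[b] - g.[a]|.
  rewrite /al /be; have [gab|gab] := leP (- g.[a]) (- g.[b]).
    by rewrite ler0_norm; lra.
  by rewrite ger0_norm; lra.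
have albe : al <= be by rewrite -subr_ge0 beal.
have subK : `]al, be[%classic `<=` K.
  move=> y /=; rewrite in_itv/= => /andP[aly ybe].
  have [||c] := @IVT R (fun t => - g.[t]) a b y (ltW ab).
  - by apply: continuous_subspaceT => t; apply: cvgN; exact: continuous_horner.
  - by rewrite -/al -/be !ltW.
  rewrite in_itv/= => /andP[ac cb] cy; exists c => //; apply: sub.
  rewrite in_itv/= !lt_neqAle ac cb !andbT; apply/andP; split; apply/eqP => ce.
    by move: aly ybe; rewrite /al /be -cy -ce lt_max ltxx/= gt_min ltxx/= => ?; rewrite ltNge ltW.
  by move: aly ybe; rewrite /al /be -cy -ce lt_max ltxx/= gt_min ltxx/= !orbF => ?; rewrite ltNge ltW.
have Ksub : K `<=` `[al, be]%classic.
  move=> _ [t /Wab abt <-]; have := @poly_between g a b t g0ab abt => H.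
  rewrite /= in_itv/= /al /be; apply/andP; split; rewrite leNgt; apply/negP.
    rewrite lt_min => /andP[ta tb].
    have : 0 < (g.[t] - g.[a]) * (g.[t] - g.[b]) by apply: mulr_gt0; lra.
    lra.
  rewrite gt_max => /andP[ta tb].
  have : 0 < (g.[a] - g.[t]) * (g.[b] - g.[t]) by apply: mulr_gt0; lra.
  lra.
have mK : measurable K.
  apply: is_interval_measurable; apply/connected_intervalP/connected_continuous_connected.
    exact/connected_intervalP.
  by apply: continuous_subspaceT => t; apply: cvgN; exact: continuous_horner.
rewrite -beal; apply/eqP; rewrite eq_le; apply/andP; split.
  apply: (@le_trans _ _ (mu `]al, be[%classic)); last by apply: le_measure; rewrite ?inE.
  rewrite lebesgue_measure_itv/= lte_fin; case: ltP => [_|beal']; first by rewrite EFinB.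
  by rewrite lee_fin; lra.
apply: (@le_trans _ _ (mu `[al, be]%classic)); first by apply: le_measure; rewrite ?inE.
rewrite lebesgue_measure_itv/= lte_fin; case: ltP => [_|beal']; first by rewrite EFinB.
by rewrite lee_fin subr_ge0.
Qed.

Lemma measurable_area_integrand g (D : set R) :
  measurable_fun D (fun t => (`|g^`().[t]| * (`|g.[t]| <= 1)%R%:R)%:E).
Proof.
have mh p : measurable_fun setT (horner p).
  by apply: continuous_measurable_fun; exact: continuous_horner.
apply: measurable_funTS; apply/measurable_EFinP/measurable_funM.
  exact: measurableT_comp.
rewrite (_ : (fun t => _) = \1_[set t | `|g.[t]| <= 1]); last first.
  by apply/funext => t; rewrite indicE; congr (nat_of_bool _)%:R; apply/idP/idP; rewrite inE.
apply: measurable_indic; rewrite -[X in measurable X]setTI.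
by apply: (measurable_fun_le _ _) => //; exact: measurableT_comp.
Qed.

(** After cutting at the critical points, [area_mono] and [root_count_level] compute the two sides
    as the length of the same set. The point 0 is cut out as well because [root_count_level] asks
    for it. *)
Lemma area_formula g A : (1 < size g)%N -> is_interval A ->
  (\int[mu]_(t in A) (`|g^`().[t]| * (`|g.[t]| <= 1)%R%:R)%:E =
   \int[mu]_(x in `[(-1)%R, 1%R]) (root_count A (g + x *: 'X^0))%:R%:E)%E.
Proof.
move=> sg.
have dg0 : g^`() != 0 by rewrite -size_poly_gt0 polyorder.size_deriv; move: sg; case: size => [|[|]].
have gx0 x : g + x *: 'X^0 != 0.
  rewrite -size_poly_gt0 expr0 size_polyDl; first exact: ltnW.
  by rewrite (leq_ltn_trans (size_scale_leq _ _))// size_poly1.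
have mN (B : set R) : is_interval B ->
    measurable_fun setT (fun x : R => (root_count B (g + x *: 'X^0))%:R : R).
  move=> iB.
  have [] := @root_count_grid R g 0 (size g) B 1 ltr01 _ gx0 _ iB => //.
  by rewrite scale0r subr0 mulf_neq0// polyX_eq0.
suff H (s : seq R) (B : set R) : is_interval B ->
    (forall t, B t -> t \notin s -> t != 0 /\ g^`().[t] != 0) ->
  (\int[mu]_(t in B) (`|g^`().[t]| * (`|g.[t]| <= 1)%R%:R)%:E =
   \int[mu]_(x in `[(-1)%R, 1%R]) (root_count B (g + x *: 'X^0))%:R%:E)%E.
  move=> iA; apply: (H (0 :: rootsR g^`())) => // t _.
  by rewrite inE mem_rootsR// negb_or => /andP[].
elim: s B => [|a s IH] B iB Bs.
  rewrite area_mono//; last by move=> t /Bs[].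
  have [|iK KE] := @root_count_level R g 0 gx0 B iB.
    move=> t /Bs[]// t0 gt; split => //.
    by rewrite scale0r subr0 hornerM hornerX mulf_neq0.
  under eq_integral do rewrite KE.
  rewrite integral_indic//; last exact: is_interval_measurable.
  congr (mu (_ @` B `&` _)); apply/funext => t.
  by rewrite expr0 invr1 mulr1.
have iL : is_interval (B `&` [set t | t < a]).
  apply: is_intervalI => // x y /= _ ya z /andP[_ zy]; exact: le_lt_trans ya.
have iG : is_interval (B `&` [set t | a < t]).
  apply: is_intervalI => // x y /= xa _ z /andP[xz _]; exact: lt_le_trans xz.
have i1 : is_interval (B `&` [set a]).
  apply: is_intervalI => // x y /= -> -> z /andP[az za].
  by apply/eqP; rewrite eq_le az za.
have BE : B = (B `&` [set a]) `|` ((B `&` [set t | t < a]) `|` (B `&` [set t | a < t])).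
  apply/seteqP; split => t; last by case=> [[]//|[[]|[]]].
  by move=> At; have [ta|ta|ta] := ltgtP t a; [right; left|right; right|left].
have d1 : [disjoint (B `&` [set a]) & ((B `&` [set t | t < a]) `|` (B `&` [set t | a < t]))].
  by apply/disj_setPS => t [[_ ta] [[_ /= at']|[_ /= at']]]; move: at'; rewrite ta ltxx.
have d2 : [disjoint (B `&` [set t | t < a]) & (B `&` [set t | a < t])].
  by apply/disj_setPS => t [[_ /= ta] [_ /= /(lt_trans ta)]]; rewrite ltxx.
have mi := @is_interval_measurable R.
have f0 (t : R) : (0 <= (`|g^`().[t]| * (`|g.[t]| <= 1)%R%:R)%:E)%E.
  by rewrite lee_fin mulr_ge0.
rewrite [in LHS]BE ge0_integral_setU//; [|exact: mi|by apply: measurableU; exact: mi|exact: measurable_area_integrand].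
rewrite ge0_integral_setU//; [|exact: mi|exact: mi|exact: measurable_area_integrand].
rewrite (IH _ iL); last first.
  move=> t [Bt /= ta] ts; apply: Bs => //.
  by rewrite inE negb_or ts lt_eqF.
rewrite (IH _ iG); last first.
  move=> t [Bt /= ta] ts; apply: Bs => //.
  by rewrite inE negb_or ts gt_eqF.
rewrite [X in (X + _)%E](@integral_Sset1 _ _ _ a); last by move=> t [_ ->].
rewrite add0e -ge0_integralD//.
(* The split point [a] is a root of g + x only for x = - g(a). Deleting this single value of x makes
   its root count 0, which matches the null integral over the point [a] on the left. *)
- have mD : measurable (`[(-1 : R)%R, 1%R] `\ (- g.[a])) by exact: measurableD.
  rewrite -[RHS](@integral_setD1 _ _ (- g.[a]))//; last first.
    by apply: measurable_funTS; apply/measurable_EFinP; exact: mN.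
  rewrite -[LHS](@integral_setD1 _ _ (- g.[a]))//; last first.
    by apply: emeasurable_funD; apply: measurable_funTS; apply/measurable_EFinP; exact: mN.
  apply: eq_integral => x; rewrite inE/= => -[_ /eqP xa].
  rewrite [in RHS]BE root_countU// [X in (_ = (X + _)%:R%:E)%E]root_count0 ?add0n; last first.
    move=> t [_ ->]; rewrite /root !hornerE; apply: contra xa => /eqP; lra.
  by rewrite root_countU// natrD.
- by apply: measurable_funTS; apply/measurable_EFinP; exact: mN.
- by apply: measurable_funTS; apply/measurable_EFinP; exact: mN.
Qed.

End area.
(** * Lattice sums and integrals over the box *)

Section box_integral.
Variable R : realType.
Local Notation mR := (measurableTypeR R).
Local Notation mu := (@lebesgue_measure R).
Local Open Scope ereal_scope.

(* Functions on R^m are modelled as functions on [seq R], of which only the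
   values on sequences of size [m] matter: this makes removing, adding or
   changing a coordinate a plain list operation. *)
Definition box m : set (m.-tuple mR) := [set v | all (fun x : R => `|x| <= 1)%R v].

Arguments box : clear implicits.

Definition ebox m (f : seq R -> \bar R) : \bar R :=
  \int[lebesgue_tuple R m]_(v in box m) f v.

Lemma measurable_box m : measurable (box m).
Proof.
have -> : box m = \bigcap_(k in [set: 'I_m]) (fun p : m.-tuple mR => tnth p k) @^-1` `[(-1)%R, 1%R]%classic.
  apply/seteqP; split => v /=.
    move=> /allP H k _; rewrite /= in_itv/= -ler_norml; apply: H; exact: mem_tnth.
  move=> H; apply/allP => x /tnthP[k ->].
  by have := H k Logic.I; rewrite /= in_itv/= ler_norml.
apply: fin_bigcap_measurable => // k _.
by rewrite -[X in measurable X]setTI; apply: measurable_tnth.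
Qed.
Hint Resolve measurable_box : core.

Lemma box_cons m (x : R) (s : m.-tuple mR) :
  box m.+1 (tuple_consp (x, s)) <-> (`[(-1)%R, 1%R]%classic x /\ box m s).
Proof.
rewrite /box /=; split.
  by case/andP => x1 ?; split => //; rewrite in_itv/= -ler_norml.
by case; rewrite in_itv/= -ler_norml => -> ->.
Qed.

Lemma measurable_param d (T : measurableType d) m (f : T -> seq R -> \bar R) :
    measurable_fun setT (fun z : T * m.-tuple mR => f z.1 z.2) ->
    (forall z s, 0 <= f z s) ->
  measurable_fun setT (fun z => ebox m (f z)).
Proof.
move=> mf f0; pose g (z : T * m.-tuple mR) := f z.1 z.2 * (\1_(box m) z.2)%:E.
have -> : (fun z => ebox m (f z)) = fubini_F (lebesgue_tuple R m) g.
  apply/funext => z; rewrite /ebox integral_mkcond/= /fubini_F; apply: eq_integral => v _.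
  rewrite patchE /g/= indicE; case: ifPn => vb; first by rewrite mule1.
  by rewrite mule0.
apply: measurable_fun_fubini_tonelli_F => //.
  apply: emeasurable_funM => //; apply/measurable_EFinP.
  by apply: (@measurableT_comp _ _ _ _ _ _ (\1_(box m) : m.-tuple mR -> R)) => //; apply: measurable_indic; exact: measurable_box.
by move=> z; rewrite mule_ge0// lee_fin.
Qed.

(** [lebesgue_tuple] is by construction the image of a product measure under [tuple_consp], so
    Tonelli applies after a change of variables. *)
Lemma ebox_cons m (f : seq R -> \bar R) :
    measurable_fun setT (fun v : m.+1.-tuple mR => f v) ->
    (forall s, 0 <= f s) ->
  ebox m.+1 f = \int[mu]_(x in `[(-1)%R, 1%R]) ebox m (fun s => f (x :: s)).
Proof.
move=> mf f0; rewrite /ebox /=.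
transitivity (\int[pushforward (mu \x lebesgue_tuple R m) (@tuple_consp R m)]_(v in box m.+1) f v); first by [].
have mc := @measurable_tuple_consp R m.
have mb := @measurable_box m.+1.
rewrite (ge0_integral_pushforward mc)//; last exact: measurable_funTS.
rewrite integral_mkcond fubini_tonelli1; last 2 first.
- apply/(measurable_restrictT _ _).1.
    by rewrite -[X in measurable X]setTI; apply: (mc measurableT _ mb).
  by apply: measurable_funTS; apply: (measurableT_comp (f := fun v : m.+1.-tuple mR => f v)).
- by move=> z; rewrite patchE; case: ifP => _; [exact: f0|].
rewrite [RHS]integral_mkcond; apply: eq_integral => x _; rewrite /fubini_F patchE.
case: ifPn => x1.
  rewrite [RHS]integral_mkcond; apply: eq_integral => v _; rewrite !patchE/=.
  move: x1; rewrite inE => x1.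
  case: ifPn => [|/negP xv]; first by rewrite inE/= => /box_cons[_ bv]; rewrite mem_set.
  rewrite ifF//; apply/negP; rewrite inE => bv; apply: xv; rewrite inE/=.
  exact/box_cons.
rewrite integral0_eq// => v _; rewrite patchE ifF//; apply/negP.
rewrite inE/= => /box_cons[x1' _]; move: x1; rewrite notin_setE; exact.
Qed.

Lemma ebox0 (f : seq R -> \bar R) : ebox 0 f = f [::].
Proof.
have -> : ebox 0 f = \int[\d_([tuple] : 0.-tuple mR)]_(v in box 0) cst (f [::]) v.
  by apply: eq_integral => v _; rewrite tuple0.
rewrite integral_dirac//; last exact: measurable_box.
by rewrite diracE mem_set ?mul1e.
Qed.

Lemma eq_ebox m (f g : seq R -> \bar R) :
  (forall s, size s = m -> all (fun x : R => `|x| <= 1)%R s -> f s = g s) ->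
  ebox m f = ebox m g.
Proof.
by move=> fg; apply: eq_integral => v; rewrite inE => bv; apply: fg => //; rewrite size_tuple.
Qed.

Lemma ebox_ge0 m (f : seq R -> \bar R) : (forall s, 0 <= f s) -> 0 <= ebox m f.
Proof. by move=> f0; apply: integral_ge0. Qed.

Definition mtuple m (f : seq R -> \bar R) :=
  measurable_fun setT (fun v : m.-tuple mR => f v).

Lemma ebox_cst m (c : R) : (0 <= c)%R -> ebox m (fun=> c%:E) = (2 ^+ m * c)%R%:E.
Proof.
move=> c0; elim: m => [|m IH]; first by rewrite ebox0 expr0 mul1r.
rewrite ebox_cons; last by move=> s; rewrite lee_fin.
  rewrite IH integral_cst//= lebesgue_itv11 -EFinM; congr EFin.
  by rewrite exprS; ring.
exact: measurable_cst.
Qed.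

Lemma ge0_le_ebox m (f g : seq R -> \bar R) : mtuple m f -> mtuple m g ->
    (forall s, 0 <= f s) -> (forall s, 0 <= g s) ->
    (forall s, size s = m -> all (fun x : R => `|x| <= 1)%R s -> f s <= g s) ->
  ebox m f <= ebox m g.
Proof.
move=> mf mg f0 g0 fg; apply: ge0_le_integral => //; first exact: measurable_box.
- exact: measurable_funTS.
- exact: measurable_funTS.
- by move=> v bv; apply: fg => //; rewrite size_tuple.
Qed.

Lemma mtuple_cons m (f : seq R -> \bar R) x : mtuple m.+1 f -> mtuple m (fun s => f (x :: s)).
Proof.
move=> mf; rewrite /mtuple.
apply: (measurableT_comp (f := fun v : m.+1.-tuple mR => f v) (g := fun v : m.-tuple mR => tuple_consp (x, v))) => //.
apply: (measurableT_comp (measurable_tuple_consp (m := m))).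
exact: measurable_pair1.
Qed.

Lemma mtuple_cons1 m (f : seq R -> \bar R) s : size s = m -> mtuple m.+1 f ->
  measurable_fun setT (fun x : mR => f (x :: s)).
Proof.
move=> sm mf; have sP : size s == m by exact/eqP.
apply: (measurableT_comp (f := fun v : m.+1.-tuple mR => f v) (g := fun x : mR => tuple_consp (x, Tuple sP))) => //.
apply: (measurableT_comp (measurable_tuple_consp (m := m))).
exact: measurable_pair2.
Qed.

End box_integral.
#[global] Hint Resolve measurable_box : core.
Arguments box : clear implicits.

(** * Replacing lattice sums by integrals, one coordinate at a time *)

Section hybrid.
Variable R : realType.
Local Notation mR := (measurableTypeR R).
Local Notation mu := (@lebesgue_measure R).
Variable Q : R.
Hypothesis Q1 : 1 <= Q.

Fixpoint lattice_sum m (f : seq R -> R) : R := if m is m'.+1 then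
  grid_sum Q (fun x => lattice_sum m' (fun s => f (x :: s))) else f [::].

Let Q0 : 0 < Q. Proof. exact: lt_le_trans Q1. Qed.

Lemma grid_size_le : (grid_size Q)%:R <= 3 * Q.
Proof.
have /andP[B1 B2] := truncn_itv (ltW Q0).
rewrite /grid_size -[_.*2.+1]addn1 natrD -addnn natrD; move: Q1; lra.
Qed.

Lemma grid_sum_le (f : R -> R) (M : R) : (forall x, f x <= M) -> 0 <= M ->
  grid_sum Q f <= 3 * Q * M.
Proof.
move=> fM M0; rewrite (@le_trans _ _ (\sum_(i < grid_size Q) M))//; first exact: ler_sum.
by rewrite sumr_const card_ord -[M *+ _]mulr_natl ler_wpM2r// grid_size_le.
Qed.

Lemma grid_sum_norm_le (f : R -> R) (M : R) : (forall x, `|f x| <= M) ->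
  `|grid_sum Q f| <= 3 * Q * M.
Proof.
move=> fM; have M0 : 0 <= M by rewrite (le_trans _ (fM 0)).
by rewrite (le_trans (ler_norm_sum _ _ _))//; exact: (@grid_sum_le (fun x => `|f x|)).
Qed.

Lemma lattice_sum_norm_le m (f : seq R -> R) (M : R) :
  (forall s, size s = m -> `|f s| <= M) -> `|lattice_sum m f| <= (3 * Q) ^+ m * M.
Proof.
elim: m f => [|m IH] f fM /=; first by rewrite mul1r fM.
rewrite exprS -mulrA; apply: grid_sum_norm_le => x; apply: IH => s sm.
by apply: fM; rewrite /= sm.
Qed.

Lemma lattice_sumB m (f g : seq R -> R) :
  lattice_sum m f - lattice_sum m g = lattice_sum m (fun s => f s - g s).
Proof.
elim: m f g => [//|m IH] f g /=.
by rewrite /grid_sum -sumrB; apply: eq_bigr => i _; rewrite IH.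
Qed.

Lemma lattice_sumZ m (c : R) (f : seq R -> R) :
  c * lattice_sum m f = lattice_sum m (fun s => c * f s).
Proof.
elim: m f => [//|m IH] f /=.
by rewrite /grid_sum mulr_sumr; apply: eq_bigr => i _; rewrite IH.
Qed.

Lemma bounded_integrable11 (f : R -> R) (M : R) : measurable_fun setT f ->
  (forall x, `|f x| <= M) -> mu.-integrable `[-1, 1] (EFin \o f).
Proof.
move=> mf fM; apply: measurable_bounded_integrable => //.
- have : (mu `[(-1)%R, 1%R]%classic < +oo)%E by rewrite lebesgue_itv11 ltry.
  exact.
- exact: measurable_funTS.
- exists M; split; first exact: num_real.
  by move=> x Mx y _ /=; rewrite (le_trans (fM y))// ltW.
Qed.

Lemma normr_Rint11 (f : R -> R) (M : R) : measurable_fun setT f ->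
  (forall x, `|f x| <= M) -> `|\int[mu]_(x in `[-1, 1]) f x| <= 2 * M.
Proof.
move=> mf fM; have M0 : 0 <= M by rewrite (le_trans _ (fM 0)).
have If := bounded_integrable11 mf fM.
rewrite (le_trans (le_normr_Rintegral _ _))//.
have -> : 2 * M = \int[mu]_(x in `[-1 : R, 1]) M.
  by rewrite Rintegral_cst//= lebesgue_itv11 mulrC.
apply: le_Rintegral => //.
- by apply: bounded_integrable11 (M) _ _; [exact: measurableT_comp|move=> x; rewrite normr_id].
- by apply: bounded_integrable11 (M) _ _ => // x; rewrite ger0_norm.
Qed.

Definition grid_disc (f : R -> R) : R :=
  Q * \int[mu]_(x in `[-1, 1]) f x - grid_sum Q f.

(** The integral and the grid sum in x both commute with the finite sum over the other coordinates,
    so the discrepancies add up over at most (3Q)^m lattice points. The bound [M] makes each summand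
    integrable. *)
Lemma grid_disc_lattice_sum m (f : R -> seq R -> R) (C M : R) :
    (forall s, size s = m -> measurable_fun setT (f ^~ s)) ->
    (forall s, size s = m -> forall x, `|f x s| <= M) ->
    (forall s, size s = m -> `|grid_disc (f ^~ s)| <= C) ->
  [/\ measurable_fun setT (fun x => lattice_sum m (f x)),
      forall x, `|lattice_sum m (f x)| <= (3 * Q) ^+ m * M &
      `|grid_disc (fun x => lattice_sum m (f x))| <= (3 * Q) ^+ m * C].
Proof.
elim: m f => [|m IH] f mf fM fC.
  by rewrite /= !mul1r; split; [exact: (mf [::])|exact: (fM [::])|exact: (fC [::])].
have IHi i := IH (fun x s => f x (grid Q i :: s)).
have {}IHi i : [/\ measurable_fun setT (fun x => lattice_sum m (fun s => f x (grid Q i :: s))),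
      forall x, `|lattice_sum m (fun s => f x (grid Q i :: s))| <= (3 * Q) ^+ m * M &
      `|grid_disc (fun x => lattice_sum m (fun s => f x (grid Q i :: s)))| <= (3 * Q) ^+ m * C].
  by apply: IH => s sm; [apply: mf|apply: fM|apply: fC]; rewrite /= sm.
split => /=.
- by apply: measurable_sum => i; have [] := IHi i.
- by move=> x; apply: (@lattice_sum_norm_le m.+1) => s sm; exact: fM.
have -> : grid_disc (fun x => grid_sum Q (fun y => lattice_sum m (fun s => f x (y :: s)))) =
  \sum_(i < grid_size Q) grid_disc (fun x => lattice_sum m (fun s => f x (grid Q i :: s))).
  rewrite /grid_disc sumrB; congr (_ - _); last by rewrite /grid_sum exchange_big.
  rewrite -mulr_sumr; congr (_ * _); rewrite /Rintegral.
  under eq_integral do rewrite /grid_sum -sumEFin.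
  have Ii (i : 'I_(grid_size Q)) : mu.-integrable `[-1, 1] (EFin \o (fun x => lattice_sum m (fun s => f x (grid Q i :: s)))).
    by have [mi iM _] := IHi i; exact: bounded_integrable11 mi iM.
  rewrite integral_sum//= -sum_fine// => i _.
  by apply: integrable_fin_num => //; exact: Ii.
rewrite (le_trans (ler_norm_sum _ _ _))// (@le_trans _ _ (\sum_(i < grid_size Q) ((3 * Q) ^+ m * C)))//.
  by apply: ler_sum => i _; have [] := IHi i.
rewrite sumr_const card_ord -[_ *+ grid_size Q]mulr_natl exprS -mulrA ler_wpM2r ?grid_size_le//.
by have [_ _] := IHi 0%N; apply: le_trans.
Qed.

Definition rbox m (f : seq R -> R) : R := fine (ebox m (EFin \o f)).

(** Boundedness keeps every partial integral finite, so that [fine] can be moved through the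
    iterated integral. *)
Lemma rbox_cons m (f : seq R -> R) (M : R) : mtuple m.+1 (EFin \o f) ->
    (forall s, 0 <= f s <= M) ->
  [/\ ebox m.+1 (EFin \o f) = (rbox m.+1 f)%:E,
      rbox m.+1 f = \int[mu]_(x in `[-1, 1]) rbox m (fun s => f (x :: s)),
      measurable_fun setT (fun x => rbox m (fun s => f (x :: s))) &
      forall x, `|rbox m (fun s => f (x :: s))| <= 2 ^+ m * M].
Proof.
move=> mf fM.
have M0 : 0 <= M by have /andP[/le_trans] := fM [::]; exact.
have f0 s : (0 <= (EFin \o f) s)%E by rewrite /= lee_fin; case/andP: (fM s).
have bound k g : mtuple k (EFin \o g) -> (forall s, 0 <= g s <= M) ->
    (ebox k (EFin \o g) <= (2 ^+ k * M)%:E)%E.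
  move=> mg gM; rewrite -ebox_cst//; apply: ge0_le_ebox => //.
  - exact: measurable_cst.
  - by move=> s; rewrite lee_fin; case/andP: (gM s).
  - by move=> s _ _; rewrite lee_fin; case/andP: (gM s).
have fin k g : mtuple k (EFin \o g) -> (forall s, 0 <= g s <= M) ->
    ebox k (EFin \o g) = (rbox k g)%:E.
  move=> mg gM; rewrite /rbox fineK// ge0_fin_numE.
    by rewrite (le_lt_trans (bound _ _ mg gM))// ltry.
  by apply: ebox_ge0 => s; rewrite lee_fin; case/andP: (gM s).
have finx x := fin m (fun s => f (x :: s)) (mtuple_cons x mf) (fun s => fM (x :: s)).
split => //; first exact: fin.
- rewrite [LHS]/rbox ebox_cons// /Rintegral; congr fine.
  by apply: eq_integral => x _; rewrite -finx.
- have mp : measurable_fun setT (fun z : mR * m.-tuple mR => (f (z.1 :: z.2))%:E).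
    exact: (measurableT_comp (mf : measurable_fun setT (fun v : m.+1.-tuple mR => (EFin \o f) v)) (@measurable_tuple_consp R m)).
  have H := @measurable_param R _ mR m (fun x s => (f (x :: s))%:E) mp (fun x s => f0 (x :: s)).
  apply/measurable_EFinP.
  suff -> : EFin \o (fun x => rbox m (fun s => f (x :: s))) = (fun x => ebox m (fun s => (f (x :: s))%:E)) by [].
  by apply/funext => x; exact/esym/finx.
- move=> x; rewrite ger0_norm; last by apply: fine_ge0; apply: ebox_ge0 => s; exact: (f0 (x :: s)).
  by rewrite -lee_fin -finx; apply: bound => //; exact: (mtuple_cons x mf).
Qed.

(* Hybrid argument: the coordinates are passed from sum to integral one by one. *)
Lemma box_lattice m (f : seq R -> R) (C M : R) :
    mtuple m (EFin \o f) -> (forall s, 0 <= f s <= M) ->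
    (forall s k, size s = m -> (k < m)%N ->
       `|grid_disc (fun x => f (set_nth 0 s k x))| <= C) ->
  `|Q ^+ m * rbox m f - lattice_sum m f| <= m%:R * C * (3 * Q) ^+ m.-1.
Proof.
elim: m f => [|m IH] f mf fM fC.
  by rewrite /rbox ebox0/= !mul1r subrr normr0 !mul0r.
have [E1 E2 mE bE] := rbox_cons mf fM.
have C0 : 0 <= C.
  by rewrite (le_trans _ (fC (nseq m.+1 0) 0%N _ _))// size_nseq.
have M0 : 0 <= M by have /andP[/le_trans] := fM [::]; exact.
have fn s : `|f s| <= M by case/andP: (fM s) => f0 ?; rewrite ger0_norm.
have IHx x : `|Q ^+ m * rbox m (fun s => f (x :: s)) - lattice_sum m (fun s => f (x :: s))| <= m%:R * C * (3 * Q) ^+ m.-1.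
  apply: IH => //; first exact: mtuple_cons mf.
  by move=> s k sm km; apply: (fC (x :: s) k.+1) => //=; rewrite sm.
have [|||ml lM lC] := @grid_disc_lattice_sum m (fun x s => f (x :: s)) C M.
- by move=> s sm; have := mtuple_cons1 sm mf => /measurable_EFinP.
- by [].
- move=> s sm; have := fC (0 :: s) 0%N; rewrite /= sm => /(_ erefl isT).
  exact: le_trans.
rewrite /= E2.
set I := \int[mu]_(x in _) _; set L := grid_sum _ _.
set J := \int[mu]_(x in `[-1, 1]) lattice_sum m (fun s => f (x :: s)).
(* [J] is the hybrid term: integral in the first coordinate, lattice sum in the others. The
   induction closes because the length 2 of [-1, 1] is below the factor 3 of [grid_size_le]. *)
have -> : Q ^+ m.+1 * I - L = Q * (Q ^+ m * I - J) + (Q * J - L).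
  by rewrite exprS; ring.
rewrite (le_trans (ler_normD _ _))//.
have JL : `|Q * J - L| <= (3 * Q) ^+ m * C by [].
have IJ : `|Q ^+ m * I - J| <= 2 * (m%:R * C * (3 * Q) ^+ m.-1).
  have -> : Q ^+ m * I - J = \int[mu]_(x in `[-1, 1]) (Q ^+ m * rbox m (fun s => f (x :: s)) - lattice_sum m (fun s => f (x :: s))).
    rewrite RintegralB//.
    - by rewrite RintegralZl//; exact: bounded_integrable11 mE bE.
    - rewrite (_ : _ \o _ = (fun x => (Q ^+ m)%:E * (rbox m (fun s => f (x :: s)))%:E)%E)//.
      by apply: integrableZl => //; exact: bounded_integrable11 mE bE.
    - exact: bounded_integrable11 ml lM.
  apply: normr_Rint11 => //; apply: measurable_funB => //.
  exact: measurable_funM.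
rewrite normrM (ger0_norm (ltW Q0)).
have QIJ := ler_wpM2l (ltW Q0) IJ.
rewrite (le_trans (lerD QIJ JL))//.
have -> : m.+1%:R * C * (3 * Q) ^+ m.+1.-1 = m%:R * C * (3 * Q) ^+ m + (3 * Q) ^+ m * C.
  by rewrite -[m.+1]addn1 natrD addn1/=; ring.
rewrite lerD2r; case: (m) => [|k]; first by rewrite !mul0r !mulr0.
rewrite /= exprS.
have : 0 <= Q * (k.+1%:R * C * (3 * Q) ^+ k).
  by rewrite !mulr_ge0// ?exprn_ge0// ?mulr_ge0// ltW.
lra.
Qed.

End hybrid.

(** * Root counts over the lattice and the integral of psi *)

Section lattice_roots.
Variable R : realType.
Local Notation mR := (measurableTypeR R).
Local Notation mu := (@lebesgue_measure R).
Implicit Types (A : set R) (xi Q t : R) (s : seq R) (p : {poly R}).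

(** The constant term is left out: it is the level x in [gpoly xi m s + x *: 'X^0], summed or
    integrated apart from the entries of [s]. *)
Definition gpoly xi m s : {poly R} :=
  xi *: 'X^(m.+1) + \sum_(k < m) s`_k *: 'X^(k.+1).

Definition geval xi m s t : R := xi * t ^+ m.+1 + \sum_(k < m) s`_k * t ^+ k.+1.

Definition gderiv xi m s t : R :=
  xi * m.+1%:R * t ^+ m + \sum_(k < m) k.+1%:R * s`_k * t ^+ k.

Definition gdens xi m s t : R := `|gderiv xi m s t| * (`|geval xi m s t| <= 1)%R%:R.

Lemma horner_gpoly xi m s t : (gpoly xi m s).[t] = geval xi m s t.
Proof.
rewrite /gpoly !hornerE horner_sum; congr (_ + _).
by apply: eq_bigr => i _; rewrite !hornerE.
Qed.

Lemma horner_deriv_gpoly xi m s t : ((gpoly xi m s)^`()).[t] = gderiv xi m s t.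
Proof.
rewrite /gpoly derivD derivZ derivXn linear_sum/= !hornerE horner_sum /gderiv.
congr (_ + _); first by rewrite hornerMn hornerXn -mulrA mulr_natl.
apply: eq_bigr => i _; rewrite derivZ derivXn !hornerE hornerMn hornerXn/=.
by rewrite -[_ *+ _]mulr_natl; ring.
Qed.

Lemma coef_gpoly_lead xi m s : (gpoly xi m s)`_m.+1 = xi.
Proof.
rewrite /gpoly coefD coefZ coefXn eqxx mulr1 coef_sum big1 ?addr0// => i _.
by rewrite coefZ coefXn eqSS gtn_eqF ?mulr0.
Qed.

Lemma size_gpoly_le xi m s : (size (gpoly xi m s) <= m.+2)%N.
Proof.
apply/leq_sizeP => j mj; rewrite /gpoly coefD coefZ coefXn gtn_eqF// mulr0 add0r.
rewrite coef_sum big1// => i _; rewrite coefZ coefXn gtn_eqF ?mulr0//.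
by rewrite (leq_trans _ mj)// !ltnS ltnW.
Qed.

Lemma coef_lead_neq0 p m : p`_m != 0 -> p != 0.
Proof. by apply: contraNneq => ->; rewrite coef0. Qed.

(** The error of [root_count_grid] in degree m + 1. *)
Definition disc_bound (m : nat) : R := 2 * 2 ^+ m.+3.

(** As k <= m, adding x X^k does not touch the coefficient of X^(m+1), and that of X p' - k p is (m
    + 1 - k) times it; hence neither polynomial vanishes identically. *)
Lemma root_count_grid_lead p m k A Q : 0 < Q -> (size p <= m.+2)%N ->
    p`_m.+1 != 0 -> (k <= m)%N -> is_interval A ->
  measurable_fun setT (fun x : R => (root_count A (p + x *: 'X^k))%:R : R) /\
  `|grid_disc Q (fun x : R => (root_count A (p + x *: 'X^k))%:R)| <= disc_bound m.
Proof.
move=> Q0 sp pm km iA.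
apply: (@root_count_grid R p k m.+1 A Q Q0 sp _ _ iA).
  move=> x; apply: (@coef_lead_neq0 _ m.+1).
  by rewrite coefD coefZ coefXn gtn_eqF ?ltnS// mulr0 addr0.
apply: (@coef_lead_neq0 _ m.+1).
rewrite coefB coefXM/= coef_deriv coefZ -[_ *+ _]mulr_natl -mulrBl -natrB; last exact: leqW.
by rewrite mulf_neq0// pnatr_eq0 subn_eq0 -ltnNge.
Qed.

Lemma root_count_bound p m A : (size p <= m.+2)%N -> `|(root_count A p)%:R| <= m.+1%:R :> R.
Proof.
move=> sp; rewrite ger0_norm// ler_nat (leq_trans (root_count_le _ _))//.
by move: sp; case: size.
Qed.

Definition farea A xi m s : R := \int[mu]_(t in A) gdens xi m s t.

Lemma gdens_ge0 xi m s t : 0 <= gdens xi m s t.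
Proof. by rewrite /gdens mulr_ge0. Qed.

Lemma size_gpolyX xi m s k x : (k <= m)%N -> (size (gpoly xi m s + x *: 'X^k)%R <= m.+2)%N.
Proof.
move=> km; rewrite (leq_trans (size_polyD _ _))// geq_max size_gpoly_le/=.
by rewrite (leq_trans (size_scale_leq _ _))// size_polyXn ltnS leqW.
Qed.

(** This is the area formula, with finiteness coming from at most m + 1 roots over a bounded range
    of constant terms. *)
Lemma farea_rootE A xi m s : xi != 0 -> is_interval A ->
  (\int[mu]_(t in A) (gdens xi m s t)%:E = (farea A xi m s)%:E)%E /\
  farea A xi m s = \int[mu]_(x in `[-1, 1]) (root_count A (gpoly xi m s + x *: 'X^0))%:R.
Proof.
move=> xi0 iA.
have sg : (1 < size (gpoly xi m s))%N.
  rewrite ltnNge; apply/negP => /leq_sizeP/(_ m.+1 isT).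
  by rewrite coef_gpoly_lead; exact/eqP.
have E : (\int[mu]_(t in A) (gdens xi m s t)%:E =
   \int[mu]_(x in `[(-1)%R, 1%R]) (root_count A (gpoly xi m s + x *: 'X^0))%:R%:E)%E.
  rewrite -area_formula//; apply: eq_integral => t _.
  by rewrite /gdens horner_deriv_gpoly horner_gpoly.
split; last by rewrite /farea /Rintegral E.
rewrite /farea /Rintegral fineK// E; apply: integrable_fin_num => //.
apply: (@bounded_integrable11 _ _ m.+1%:R).
  by have [] := @root_count_grid_lead (gpoly xi m s) m 0 A 1 ltr01 (size_gpoly_le _ _ _) _ _ iA; rewrite ?coef_gpoly_lead.
by move=> x; apply: root_count_bound; exact: size_gpolyX.
Qed.

Lemma farea_bound A xi m s : xi != 0 -> is_interval A ->
  0 <= farea A xi m s <= 2 * m.+1%:R.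
Proof.
move=> xi0 iA; apply/andP; split.
  by apply: Rintegral_ge0 => t _; exact: gdens_ge0.
rewrite (le_trans (ler_norm _))// (farea_rootE _ _ _ _).2//.
apply: normr_Rint11.
  by have [] := @root_count_grid_lead (gpoly xi m s) m 0 A 1 ltr01 (size_gpoly_le _ _ _) _ _ iA; rewrite ?coef_gpoly_lead.
by move=> x; apply: root_count_bound; exact: size_gpolyX.
Qed.

Lemma measurable_gdens d (T : measurableType d) xi m (a : T -> seq R) :
    (forall k, measurable_fun setT (fun z => (a z)`_k)) ->
  measurable_fun setT (fun z : T * mR => (gdens xi m (a z.1) z.2)%:E).
Proof.
move=> ma.
have m1 k : measurable_fun setT (fun z : T * mR => (a z.1)`_k).
  exact: (measurableT_comp (ma k) measurable_fst).
have m2 k : measurable_fun setT (fun z : T * mR => z.2 ^+ k).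
  apply: measurable_funX; exact: measurable_snd.
apply/measurable_EFinP; apply: measurable_funM.
  apply: measurableT_comp => //; apply: measurable_funD.
    by apply: measurable_funM => //; exact: measurable_cst.
  apply: measurable_sum => k; apply: measurable_funM => //.
  by apply: measurable_funM => //; exact: measurable_cst.
have mg : measurable_fun setT (fun z : T * mR => geval xi m (a z.1) z.2).
  apply: measurable_funD.
    by apply: measurable_funM => //; exact: measurable_cst.
  by apply: measurable_sum => k; apply: measurable_funM.
rewrite (_ : (fun z => _) = \1_[set z : T * mR | `|geval xi m (a z.1) z.2| <= 1]); last first.
  by apply/funext => t; rewrite indicE; congr (nat_of_bool _)%:R; apply/idP/idP; rewrite inE.
apply: measurable_indic; rewrite -[X in measurable X]setTI.
by apply: (measurable_fun_le _ _) => //; exact: measurableT_comp.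
Qed.

Lemma measurable_farea d (T : measurableType d) A xi m (a : T -> seq R) :
    xi != 0 -> is_interval A -> (forall k, measurable_fun setT (fun z => (a z)`_k)) ->
  measurable_fun setT (fun z => farea A xi m (a z)).
Proof.
move=> xi0 iA ma; have mA := is_interval_measurable iA.
apply/measurable_EFinP.
have mg := measurable_gdens xi m ma.
pose g (z : T * mR) := ((gdens xi m (a z.1) z.2)%:E * (\1_A z.2)%:E)%E.
rewrite (_ : _ \o _ = fubini_F mu g).
  apply: measurable_fun_fubini_tonelli_F.
    apply: emeasurable_funM => //; apply/measurable_EFinP.
    by apply: (measurableT_comp (f := (\1_A : mR -> R))) => //; exact: measurable_indic.
  by move=> z; rewrite mule_ge0// lee_fin// gdens_ge0.
apply/funext => z; rewrite /= -(farea_rootE _ _ xi0 iA).1 /fubini_F [LHS]integral_mkcond.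
apply: eq_integral => t _; rewrite patchE /g/= indicE.
by case: ifPn => tA; rewrite ?mule1 ?mule0.
Qed.

Lemma mtuple_nth m k : measurable_fun setT (fun v : m.-tuple mR => (v : seq R)`_k).
Proof.
have [km|mk] := ltnP k m.
  rewrite (_ : (fun v => _) = (fun v : m.-tuple mR => tnth v (Ordinal km))).
    exact: measurable_tnth.
  by apply/funext => v; rewrite (tnth_nth 0).
rewrite (_ : (fun v => _) = cst 0); first exact: measurable_cst.
by apply/funext => v; rewrite nth_default// size_tuple.
Qed.

Lemma mtuple_farea A xi m : xi != 0 -> is_interval A ->
  mtuple m (EFin \o farea A xi m).
Proof.
by move=> xi0 iA; apply/measurable_EFinP/measurable_farea => // k; exact: mtuple_nth.
Qed.

Section one_coordinate.
Variables (A : set R) (Q : R) (m : nat).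
Hypotheses (Q1 : 1 <= Q) (iA : is_interval A).
Let xi := Q^-1.
Let Q0 : 0 < Q. Proof. exact: lt_le_trans Q1. Qed.
Let xi0 : xi != 0. Proof. by rewrite invr_eq0 gt_eqF. Qed.

Definition root_sum s : R :=
  grid_sum Q (fun y : R => (root_count A (gpoly xi m s + y *: 'X^0))%:R).

Lemma farea_root_sum s : `|Q * farea A xi m s - root_sum s| <= disc_bound m.
Proof.
rewrite (farea_rootE _ _ xi0 iA).2.
by have [] := @root_count_grid_lead (gpoly xi m s) m 0 A Q Q0 (size_gpoly_le _ _ _) _ _ iA; rewrite ?coef_gpoly_lead.
Qed.

Lemma gpoly_set_nth s k x : size s = m -> (k < m)%N ->
  gpoly xi m (set_nth 0 s k x) = gpoly xi m (set_nth 0 s k 0) + x *: 'X^(k.+1).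
Proof.
move=> sm km; rewrite /gpoly -addrA; congr (_ + _).
rewrite (bigD1 (Ordinal km))//= [in RHS](bigD1 (Ordinal km))//= !nth_set_nth/= !eqxx.
rewrite scale0r add0r addrC; congr (_ + _); apply: eq_bigr => i ik.
rewrite !nth_set_nth/= ifF//; last by apply/negbTE; move: ik; rewrite -val_eqE.
by rewrite ifF//; apply/negbTE; move: ik; rewrite -val_eqE.
Qed.

(** With F the area and S the sum of root counts over the grid of p_0, Q F - S is at most c in
    absolute value, so its discrepancy in p_k is at most 2 Q c + 3 Q c (length of [-1, 1], number of
    grid points). S has at most 3 Q terms of discrepancy c. The total 8 Q c, divided by Q, is the
    claim. *)
Lemma grid_disc_farea s k : size s = m -> (k < m)%N ->
  `|grid_disc Q (fun x => farea A xi m (set_nth 0 s k x))| <= 8 * disc_bound m.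
Proof.
move=> sm km; set c := disc_bound m.
pose F x := farea A xi m (set_nth 0 s k x).
pose S x := root_sum (set_nth 0 s k x).
have mF : measurable_fun setT F.
  apply: measurable_farea => // j.
  under eq_fun do rewrite nth_set_nth/=.
  by case: (j == k); [exact: measurable_id|exact: measurable_cst].
have [mS SM SC] : [/\ measurable_fun setT S, forall x, `|S x| <= 3 * Q * m.+1%:R
    & `|grid_disc Q S| <= 3 * Q * c].
  (* [S] is viewed as a lattice sum in dimension one, whose only coordinate [head 0 z] is p_0. *)
  have [|||mS SM SC] := @grid_disc_lattice_sum R Q Q1 1 (fun (x : R) z => (root_count A (gpoly xi m (set_nth 0 s k x) + (head 0 z) *: 'X^0))%:R) c m.+1%:R.
  - move=> z _; under eq_fun do rewrite gpoly_set_nth// addrAC.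
    have [] := @root_count_grid_lead (gpoly xi m (set_nth 0 s k 0) + head 0 z *: 'X^0) m k.+1 A Q Q0 _ _ _ iA => //.
      exact: size_gpolyX.
    by rewrite coefD coef_gpoly_lead coefZ coefXn mulr0 addr0.
  - by move=> z _ x; apply: root_count_bound; exact: size_gpolyX.
  - move=> z _.
    rewrite (_ : (fun x => _) = (fun x : R => (root_count A (gpoly xi m (set_nth 0 s k 0) + head 0 z *: 'X^0 + x *: 'X^(k.+1)))%:R)); last first.
      by apply/funext => x; rewrite gpoly_set_nth// addrAC.
    have [] := @root_count_grid_lead (gpoly xi m (set_nth 0 s k 0) + head 0 z *: 'X^0) m k.+1 A Q Q0 _ _ _ iA => //.
      exact: size_gpolyX.
    by rewrite coefD coef_gpoly_lead coefZ coefXn mulr0 addr0.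
  by move: mS SM SC; rewrite expr1.
have FM x : `|F x| <= 2 * m.+1%:R.
  by have /andP[F0 ?] := farea_bound m (set_nth 0 s k x) xi0 iA; rewrite ger0_norm.
have D x : `|Q * F x - S x| <= c by exact: farea_root_sum.
have c0 : 0 <= c by rewrite (le_trans _ (D 0)).
have iF := bounded_integrable11 mF FM.
have iS := bounded_integrable11 mS SM.
have iQF : mu.-integrable `[-1, 1] (EFin \o (fun x => Q * F x)).
  apply: (@bounded_integrable11 _ _ (Q * (2 * m.+1%:R))); first exact: measurable_funM.
  by move=> x; rewrite normrM (ger0_norm (ltW Q0)) ler_pM2l.
have E : Q * grid_disc Q F = grid_disc Q (fun x => Q * F x - S x) + grid_disc Q S.
  rewrite /grid_disc RintegralB// RintegralZl// /grid_sum sumrB mulrBr mulr_sumr.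
  by ring.
have : `|Q * grid_disc Q F| <= Q * (8 * c).
  rewrite E (le_trans (ler_normD _ _))//.
  have : `|grid_disc Q (fun x => Q * F x - S x)| <= 5 * Q * c.
    rewrite /grid_disc (le_trans (ler_normB _ _))//.
    have := grid_sum_norm_le Q1 D.
    have := @normr_Rint11 R (fun x => Q * F x - S x) c _ D.
    move=> /(_ _)/wrap[|]; first by apply: measurable_funB => //; exact: measurable_funM.
    rewrite normrM (ger0_norm (ltW Q0)) -(ler_pM2l Q0); lra.
  lra.
by rewrite normrM (ger0_norm (ltW Q0)) ler_pM2l.
Qed.

Lemma root_sum_rbox :
  `|lattice_sum Q m root_sum - Q ^+ m.+1 * rbox m (farea A xi m)| <=
  (8 * m%:R + 1) * disc_bound m * (3 * Q) ^+ m.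
Proof.
set c := disc_bound m; have c0 : 0 <= c by rewrite /c /disc_bound mulr_ge0// exprn_ge0.
have H1 := @box_lattice R Q Q1 m (farea A xi m) (8 * c) (2 * m.+1%:R)
  (@mtuple_farea A xi m xi0 iA) (fun s => farea_bound m s xi0 iA) (fun s k => @grid_disc_farea s k).
have H2 : `|lattice_sum Q m root_sum - Q * lattice_sum Q m (farea A xi m)| <= (3 * Q) ^+ m * c.
  rewrite lattice_sumZ lattice_sumB; apply: lattice_sum_norm_le => // s _.
  by rewrite distrC; exact: farea_root_sum.
have -> : lattice_sum Q m root_sum - Q ^+ m.+1 * rbox m (farea A xi m) =
  (lattice_sum Q m root_sum - Q * lattice_sum Q m (farea A xi m)) -
  Q * (Q ^+ m * rbox m (farea A xi m) - lattice_sum Q m (farea A xi m)).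
  by rewrite exprS; ring.
rewrite (le_trans (ler_normB _ _))// normrM (ger0_norm (ltW Q0)).
have H3 : Q * (m%:R * (8 * c) * (3 * Q) ^+ m.-1) <= 8 * m%:R * c * (3 * Q) ^+ m.
  case: (m) => [|k]; first by rewrite !(mul0r,mulr0).
  rewrite /= exprS.
  have : 0 <= Q * (k.+1%:R * c * (3 * Q) ^+ k).
    apply: mulr_ge0; first exact: ltW.
    apply: mulr_ge0; first exact: mulr_ge0.
    by apply: exprn_ge0; apply: mulr_ge0 => //; exact: ltW.
  lra.
have := ler_wpM2l (ltW Q0) H1; lra.
Qed.

End one_coordinate.

Definition psi xi m t : R := rbox m (fun s => gdens xi m s t).

Lemma rbox_ereal A xi m : xi != 0 -> is_interval A ->
  ebox m (EFin \o farea A xi m) = (rbox m (farea A xi m))%:E.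
Proof.
move=> xi0 iA; case: m => [|m]; first by rewrite /rbox ebox0.
have [//] := rbox_cons (@mtuple_farea A xi m.+1 xi0 iA) (fun s => farea_bound m.+1 s xi0 iA).
Qed.

(** By Tonelli the coefficients may be integrated first, at fixed t; this is how the density [psi]
    arises from root counts. *)
Lemma rbox_farea A xi m : xi != 0 -> is_interval A ->
  (\int[mu]_(t in A) ebox m (fun s => (gdens xi m s t)%:E) = (rbox m (farea A xi m))%:E)%E.
Proof.
move=> xi0 iA; have mA := is_interval_measurable iA.
have mb := @measurable_box R m.
pose g (z : m.-tuple mR * mR) := ((gdens xi m z.1 z.2)%:E * (\1_(box R m) z.1)%:E * (\1_A z.2)%:E)%E.
have g0 z : (0 <= g z)%E by rewrite !mule_ge0// lee_fin// gdens_ge0.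
have mg : measurable_fun setT g.
  apply: emeasurable_funM; first apply: emeasurable_funM.
  - exact: (measurable_gdens xi m (@mtuple_nth m)).
  - apply/measurable_EFinP.
    by apply: (measurableT_comp (f := (\1_(box R m) : m.-tuple mR -> R))) => //; exact: measurable_indic.
  - apply/measurable_EFinP.
    by apply: (measurableT_comp (f := (\1_A : mR -> R))) => //; exact: measurable_indic.
have fub := fubini_tonelli (m1 := lebesgue_tuple R m) (m2 := mu) g mg g0.
rewrite -(rbox_ereal m xi0 iA).
transitivity (\int[mu]_t \int[lebesgue_tuple R m]_v g (v, t))%E.
  rewrite integral_mkcond; apply: eq_integral => t _; rewrite patchE /g/= indicE.
  case: ifPn => tA; last by rewrite integral0_eq// => v _; rewrite mule0.
  rewrite /ebox integral_mkcond; apply: eq_integral => v _; rewrite patchE indicE mule1.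
  by case: ifPn => vb; rewrite ?mule1 ?mule0.
rewrite -fub /ebox [RHS]integral_mkcond; apply: eq_integral => v _; rewrite patchE /g/= indicE.
case: ifPn => vb; last by rewrite integral0_eq// => t _; rewrite mule0 mul0e.
rewrite -(farea_rootE _ _ xi0 iA).1 [RHS]integral_mkcond; apply: eq_integral => t _.
by rewrite patchE indicE mule1; case: ifPn => tA; rewrite ?mule1 ?mule0.
Qed.

End lattice_roots.
(** * Comparison of densities *)

Section box_calculus.
Variable R : realType.
Local Notation mR := (measurableTypeR R).
Local Notation mu := (@lebesgue_measure R).
Local Open Scope ereal_scope.

Lemma measurable_seq_comp d (T : measurableType d) n (f : seq R -> \bar R) (a : T -> seq R) :
    (forall z, size (a z) = n) -> (forall k, measurable_fun setT (fun z => (a z)`_k)%R) ->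
    mtuple n f ->
  measurable_fun setT (fun z => f (a z)).
Proof.
move=> sa ma mf; have sP z : size (a z) == n by rewrite sa.
pose b z : n.-tuple mR := Tuple (sP z).
apply: (measurableT_comp (mf : measurable_fun setT (fun v : n.-tuple mR => f v)) (g := b)).
apply/measurable_fun_tnthP => i.
suff : measurable_fun setT (fun z => tnth (b z) i) by [].
under eq_fun do rewrite (tnth_nth 0%R).
exact: ma.
Qed.

Lemma mtuple_rcons m (f : seq R -> \bar R) : mtuple m.+1 f ->
  measurable_fun setT (fun z : m.-tuple mR * mR => f (rcons z.1 z.2)).
Proof.
move=> mf; apply: measurable_seq_comp mf => [z|k]; first by rewrite size_rcons size_tuple.
have [km|mk|km] := ltngtP k m.
- under eq_fun do rewrite nth_rcons size_tuple km.
  exact: (measurableT_comp (@mtuple_nth R m k) measurable_fst).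
- under eq_fun do rewrite nth_default ?size_rcons ?size_tuple//.
  exact: measurable_cst.
- under eq_fun do rewrite nth_rcons size_tuple km ltnn eqxx.
  exact: measurable_snd.
Qed.

Lemma mtuple_int_rcons m (f : seq R -> \bar R) : mtuple m.+1 f ->
  (forall s, 0 <= f s) ->
  mtuple m (fun s => \int[mu]_(x in `[(-1)%R, 1%R]) f (rcons s x)).
Proof.
move=> mf f0; rewrite /mtuple.
pose g (z : m.-tuple mR * mR) := f (rcons z.1 z.2) * (\1_(`[(-1)%R, 1%R]%classic : set mR) z.2)%:E.
rewrite (_ : (fun v => _) = fubini_F mu g).
  apply: measurable_fun_fubini_tonelli_F.
    apply: emeasurable_funM; first exact: mtuple_rcons.
    by apply/measurable_EFinP; apply: (measurableT_comp (f := (\1_(`[(-1)%R, 1%R]%classic) : mR -> R))) => //; exact: measurable_indic.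
  by move=> z; rewrite mule_ge0// lee_fin.
apply/funext => v; rewrite integral_mkcond /fubini_F; apply: eq_integral => x _.
by rewrite patchE /g/= indicE; case: ifPn; rewrite ?mule1 ?mule0.
Qed.

(** [ebox_cons] peels off the first entry, whereas the slab argument integrates over the top
    coefficient, which is the last entry, before all others. *)
Lemma ebox_rcons m (f : seq R -> \bar R) : mtuple m.+1 f -> (forall s, 0 <= f s) ->
  ebox m.+1 f = ebox m (fun s => \int[mu]_(x in `[(-1)%R, 1%R]) f (rcons s x)).
Proof.
elim: m f => [|m IH] f mf f0.
  by rewrite ebox_cons// ebox0; apply: eq_integral => x _; rewrite ebox0.
rewrite ebox_cons// [RHS]ebox_cons//; last first.
- by move=> s; apply: integral_ge0.
- exact: mtuple_int_rcons.
by apply: eq_integral => x _; rewrite IH//; exact: mtuple_cons mf.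
Qed.

Lemma integral_opp11 (h : R -> \bar R) : measurable_fun setT h -> (forall x, 0 <= h x) ->
  \int[mu]_(x in `[(-1)%R, 1%R]) h (- x)%R = \int[mu]_(x in `[(-1)%R, 1%R]) h x.
Proof.
move=> mh h0.
have mopp : measurable_fun setT (-%R : mR -> mR) by exact: oppr_measurable.
have := @ge0_integral_pushforward _ _ mR mR R _ mopp mu `[(-1)%R, 1%R]%classic h.
rewrite opp_preimage_itvbndbnd opprK => <-//; last exact: measurable_funTS.
by apply: eq_measure_integral => //= A mA _; exact: lebesgue_measureN.
Qed.

(** Allows averaging over r and - r for an odd function r of the coefficients. *)
Lemma ebox_opp m (f : seq R -> \bar R) : mtuple m f -> (forall s, 0 <= f s) ->
  ebox m (fun s => f (map -%R s)) = ebox m f.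
Proof.
elim: m f => [|m IH] f mf f0; first by rewrite !ebox0.
have mof : mtuple m.+1 (fun s => f (map -%R s)).
  apply: measurable_seq_comp mf => [v|k]; first by rewrite size_map size_tuple.
  have [km|mk] := ltnP k m.+1.
    under eq_fun do rewrite (nth_map 0%R) ?size_tuple//.
    by apply: measurableT_comp => //; exact: mtuple_nth.
  under eq_fun do rewrite nth_default ?size_map ?size_tuple//.
  exact: measurable_cst.
rewrite (ebox_cons mof (fun s => f0 _)) (ebox_cons mf f0) -[RHS]integral_opp11; last first.
- by move=> x; apply: ebox_ge0 => s; exact: f0.
- apply: (@measurable_param R _ mR m (fun x s => f (x :: s))) => //.
  exact: (measurableT_comp (mf : measurable_fun setT (fun v : m.+1.-tuple mR => f v)) (@measurable_tuple_consp R m)).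
apply: eq_integral => x _ /=.
by rewrite -(IH (fun s => f (- x :: s)%R))//; exact: mtuple_cons mf.
Qed.

Lemma eboxD m (f g : seq R -> \bar R) : mtuple m f -> mtuple m g ->
    (forall s, 0 <= f s) -> (forall s, 0 <= g s) ->
  ebox m (fun s => f s + g s) = ebox m f + ebox m g.
Proof.
move=> mf mg f0 g0; rewrite /ebox ge0_integralD//.
- exact: measurable_box.
- exact: measurable_funTS.
- exact: measurable_funTS.
Qed.

Lemma eboxZ m (c : R) (f : seq R -> \bar R) : mtuple m f ->
    (forall s, 0 <= f s) -> (0 <= c)%R ->
  ebox m (fun s => c%:E * f s) = c%:E * ebox m f.
Proof.
move=> mf f0 c0; rewrite /ebox ge0_integralZl_EFin//; first exact: measurable_box.
exact: measurable_funTS.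
Qed.

End box_calculus.

Section abs_affine.
Variable R : realType.
Local Notation mR := (measurableTypeR R).
Local Notation mu := (@lebesgue_measure R).
Implicit Types (A B D a b c r t x : R).

Let sq A D : {poly R} := (2 * D)^-1 *: (A%:P + D *: 'X) ^+ 2.

Let sqE A D x : (sq A D).[x] = (A + D * x) ^+ 2 / (2 * D).
Proof. by rewrite /sq hornerZ horner_exp hornerD hornerC hornerZ hornerX mulrC. Qed.

Let sq'E A D x : D != 0 -> ((sq A D)^`()).[x] = A + D * x.
Proof.
move=> D0; rewrite /sq derivZ expr2 derivM derivD derivC derivZ derivX add0r.
rewrite alg_polyC hornerZ hornerD !hornerM hornerD hornerZ hornerX !hornerC.
by field.
Qed.

Lemma measurable_abs_affine A D (S : set R) :
  measurable_fun S (fun x => (`|A + D * x|)%:E).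
Proof.
apply: measurable_funTS; apply/measurable_EFinP; apply: measurableT_comp => //.
by apply: measurable_funD => //; exact: measurable_funM.
Qed.

(** With u = A + D x, the antiderivative is u |u| / (2 D). Where u keeps its sign this is
    [FTC_abs_deriv] applied to u^2 / (2 D); otherwise the interval is cut at the zero - A / D. *)
Lemma integral_abs_affine A D a b : D != 0 -> a <= b ->
  (\int[mu]_(x in `[a, b]) (`|A + D * x|)%:E =
   (((A + D * b) * `|A + D * b| - (A + D * a) * `|A + D * a|) / (2 * D))%:E)%E.
Proof.
move=> D0.
have base u v : u <= v -> - A / D <= u \/ v <= - A / D ->
  (\int[mu]_(x in `[u, v]) (`|A + D * x|)%:E =
   (((A + D * v) * `|A + D * v| - (A + D * u) * `|A + D * u|) / (2 * D))%:E)%E.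
  rewrite le_eqVlt => /predU1P[<- _|uv uvz].
    by rewrite set_itv1 integral_set1 subrr mul0r.
  transitivity (\int[mu]_(x in `[u, v]) (`|(sq A D)^`().[x]|)%:E)%E.
    by apply: eq_integral => x _; rewrite sq'E.
  have AD : A + D * (- A / D) = 0 by field.
  rewrite FTC_abs_deriv//; last first.
    move=> x; rewrite in_itv/= => /andP[ux xv]; rewrite sq'E//; apply/eqP => x0.
    have : x = - A / D by apply: (mulfI D0); lra.
    by case: uvz => ?; lra.
  congr EFin; rewrite !sqE -mulrBl.
  have uE x : A + D * x = D * (x - - A / D) by field.
  rewrite !uE; set z := - A / D in uvz *.
  have -> : (D * (v - z)) ^+ 2 - (D * (u - z)) ^+ 2 = D ^+ 2 * ((v - z) ^+ 2 - (u - z) ^+ 2) by ring.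
  rewrite !normrM normfV normrM (ger0_norm (ler0n R 2)).
  have nD0 : `|D| != 0 by rewrite normr_eq0.
  have -> : (D * (v - z) * (`|D| * `|v - z|) - D * (u - z) * (`|D| * `|u - z|)) / (2 * D) =
    `|D| * ((v - z) * `|v - z| - (u - z) * `|u - z|) / 2 by field.
  have -> : `|D| * `|D| * `|(v - z) ^+ 2 - (u - z) ^+ 2| / (2 * `|D|) =
    `|D| * `|(v - z) ^+ 2 - (u - z) ^+ 2| / 2 by field.
  congr (_ * _ / _); rewrite subr_sqr.
  have -> : v - z - (u - z) = v - u by ring.
  rewrite normrM (ger0_norm (_ : 0 <= v - u)) ?subr_ge0 ?(ltW uv)//.
  case: uvz => H.
    rewrite !ger0_norm; [ring|lra|lra|lra].
  rewrite !ler0_norm; [ring|lra|lra|lra].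
move=> ab; have [za|az] := leP (- A / D) a; first by apply: base => //; left.
have [zb|bz] := leP b (- A / D); first by apply: base => //; right.
set z := - A / D in az bz *.
have -> : `[a, b]%classic = `[a, z]%classic `|` `]z, b]%classic.
  apply/seteqP; split => x /=; rewrite !in_itv/=.
    by move=> /andP[ax xb]; have [xz|zx] := leP x z; [left; rewrite ax|right].
  by case=> /andP[ax xb]; apply/andP; split => //; [exact: le_trans (ltW bz)|exact: le_trans (ltW az) (ltW ax)].
rewrite ge0_integral_setU//; last 2 first.
- exact: measurable_abs_affine.
- by apply/disj_setPS => x /= []; rewrite !in_itv/= => /andP[_ xz] /andP[]; rewrite ltNge xz.
rewrite integral_itv_obnd_cbnd; last exact: measurable_abs_affine.
rewrite (base a z (ltW az))//; last by right.
rewrite (base z b (ltW bz))//; last by left.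
rewrite -EFinD; congr EFin.
have -> : A + D * z = 0 by rewrite /z; field.
by rewrite normr0 !mul0r; field.
Qed.

Definition absint a : \bar R := (\int[mu]_(y in `[(-1)%R, 1%R]) (`|a - y|)%:E)%E.

Let absintE a : absint a = (((a + 1) * `|a + 1| - (a - 1) * `|a - 1|) / 2)%:E.
Proof.
rewrite /absint (eq_integral (fun y : mR => (`|a + (-1) * y|)%:E)); last by move=> y _; rewrite mulN1r.
have N11 : -1 <= 1 :> R by lra.
rewrite integral_abs_affine ?oppr_eq0 ?oner_eq0//.
congr EFin; have -> : a + -1 * 1 = a - 1 by ring.
have -> : a + -1 * -1 = a + 1 by ring.
by field.
Qed.

Lemma absint_le1 a : `|a| <= 1 -> absint a = (1 + a ^+ 2)%:E.
Proof.
rewrite ler_norml => /andP[a1 a2]; rewrite absintE ger0_norm; last lra.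
by rewrite ler0_norm; [congr EFin; field|lra].
Qed.

Lemma absint_ge1 a : 1 <= a -> absint a = (2 * a)%:E.
Proof.
by move=> a1; rewrite absintE !ger0_norm; [congr EFin; field|lra|lra].
Qed.

Lemma absint_ub a : (absint a <= (2 * `|a| + 2)%:E)%E.
Proof.
have [a1|a1] := leP 1 `|a|; last first.
  rewrite (absint_le1 (ltW a1)) lee_fin -(real_normK (num_real a)).
  have : `|a| ^+ 2 <= 1 by rewrite expr_le1// ltW.
  have := normr_ge0 a; lra.
rewrite absintE lee_fin.
have [a0|a0] := leP 0 a.
  rewrite ger0_norm// in a1 *; rewrite !ger0_norm; lra.
rewrite ltr0_norm// in a1 *; rewrite !ler0_norm; lra.
Qed.

Lemma absint_ge0 a : (0 <= absint a)%E.
Proof. by apply: integral_ge0 => y _; rewrite lee_fin. Qed.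

Lemma slab_integral al be B c : c != 0 -> be != 0 ->
  (\int[mu]_(x in [set x : R | (`|B + x * c| <= 1)%R]) (`|al + be * (B + x * c)|)%:E =
   (`|c|^-1)%:E * \int[mu]_(z in `[(-1)%R, 1%R]) (`|al + be * z|)%:E)%E.
Proof.
move=> c0 be0.
have N11 : -1 <= 1 :> R by lra.
rewrite [X in (_ = _ * X)%E]integral_abs_affine//.
pose x1 := (-1 - B) / c; pose x2 := (1 - B) / c.
have E x : al + be * (B + x * c) = (al + be * B) + (be * c) * x by ring.
under eq_integral do rewrite E.
have bc0 : be * c != 0 by rewrite mulf_neq0.
have E1 : al + be * B + be * c * x1 = al + be * (-1) by rewrite /x1; field.
have E2 : al + be * B + be * c * x2 = al + be * 1 by rewrite /x2; field.
have [cp|cn] := ltP 0 c.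
  have -> : [set x : R | `|B + x * c| <= 1] = `[x1, x2]%classic.
    apply/seteqP; split => x /=; rewrite in_itv/= ler_norml /x1 /x2 ler_pdivrMr// ler_pdivlMr//; lra.
  rewrite integral_abs_affine//; last by rewrite /x1 /x2 ler_pM2r ?invr_gt0//; lra.
  by rewrite E1 E2 -EFinM; congr EFin; rewrite (gtr0_norm cp); field; rewrite be0.
have {}cn : c < 0 by rewrite lt_neqAle c0.
have -> : [set x : R | `|B + x * c| <= 1] = `[x2, x1]%classic.
  apply/seteqP; split => x /=; rewrite in_itv/= ler_norml /x1 /x2 ler_ndivrMr// ler_ndivlMr//; lra.
rewrite integral_abs_affine//; last by rewrite /x1 /x2 ler_nM2r ?invr_lt0//; lra.
by rewrite E1 E2 -EFinM; congr EFin; rewrite (ltr0_norm cn); field; rewrite be0.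
Qed.

(** On the slab |x c| <= 1 + |B|; if this is at most |c|, the slab lies in [-1, 1] and nothing is
    lost by restricting to it. *)
Lemma slab11_integral al be B c : c != 0 -> be != 0 ->
  (\int[mu]_(x in `[(-1)%R, 1%R]) (`|al + be * (B + x * c)| * (`|B + x * c| <= 1)%R%:R)%:E <=
   (`|c|^-1)%:E * \int[mu]_(z in `[(-1)%R, 1%R]) (`|al + be * z|)%:E)%E /\
  ((1 + `|B| <= `|c|)%R ->
  \int[mu]_(x in `[(-1)%R, 1%R]) (`|al + be * (B + x * c)| * (`|B + x * c| <= 1)%R%:R)%:E =
   (`|c|^-1)%:E * \int[mu]_(z in `[(-1)%R, 1%R]) (`|al + be * z|)%:E)%E.
Proof.
move=> c0 be0; rewrite -(slab_integral al B c0 be0); set S := [set x : R | `|B + x * c| <= 1].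
have -> : (\int[mu]_(x in `[(-1)%R, 1%R]) (`|al + be * (B + x * c)| * (`|B + x * c| <= 1)%R%:R)%:E =
  \int[mu]_(x in `[(-1)%R, 1%R] `&` S) (`|al + be * (B + x * c)|)%:E)%E.
  rewrite [RHS]integral_mkcondr; apply: eq_integral => x _; rewrite patchE.
  case: ifPn; first by rewrite inE /S/= => ->; rewrite mulr1.
  by rewrite notin_setE /S/= => /negP/negbTE ->; rewrite mulr0.
have mS : measurable S.
  rewrite -[X in measurable X]setTI; apply: (measurable_fun_le _ _) => //.
  by apply: measurableT_comp => //; apply: measurable_funD => //; exact: mulrr_measurable.
split.
  have mI : measurable (`[(-1)%R, 1%R]%classic `&` S : set mR) by exact: measurableI.
  have mg : measurable_fun S (fun x => (`|al + be * (B + x * c)|)%:E).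
    have E x : al + be * (B + x * c) = (al + be * B) + (be * c) * x by ring.
    under eq_fun do rewrite E.
    exact: measurable_abs_affine.
  apply: (@ge0_subset_integral _ _ _ mu _ S mI mS) => //; exact: subIsetr.
move=> H; rewrite setIidr// => x; rewrite /S/= in_itv/= -ler_norml => xS.
have : `|x * c| <= 1 + `|B|.
  have -> : x * c = (B + x * c) - B by ring.
  by rewrite (le_trans (ler_normB _ _))// lerD2r.
by move/le_trans => /(_ _ H); rewrite normrM ger_pMl// normr_gt0.
Qed.

End abs_affine.

(** * The density psi for large t *)

Section large_t.
Variable R : realType.
Local Notation mR := (measurableTypeR R).
Local Notation mu := (@lebesgue_measure R).
Implicit Types (xi t c al be x : R) (s w : seq R) (n : nat).

Lemma big_rcons n (F : nat -> R -> R) s x : size s = n ->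
  \sum_(k < n.+1) F k (rcons s x)`_k = \sum_(k < n) F k s`_k + F n x.
Proof.
move=> sn; rewrite big_ord_recr/= nth_rcons sn ltnn eqxx; congr (_ + _).
by apply: eq_bigr => k _; rewrite nth_rcons sn ltn_ord.
Qed.

Definition bval xi n s t : R := xi * t ^+ n.+2 + \sum_(k < n) s`_k * t ^+ k.+1.

(** This is g' - (n + 1) g / t in degree n + 2: the multiple of g is chosen to cancel the last
    coefficient, that of t^(n+1). *)
Definition alpha xi n s t : R :=
  xi * t ^+ n.+1 - \sum_(k < n) (n - k)%:R * s`_k * t ^+ k.

Lemma geval_rcons xi n s x t : size s = n ->
  geval xi n.+1 (rcons s x) t = bval xi n s t + x * t ^+ n.+1.
Proof.
move=> sn; rewrite /geval /bval -addrA; congr (_ + _).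
exact: (@big_rcons n (fun k y => y * t ^+ k.+1)).
Qed.

Lemma gderiv_rcons xi n s x t : t != 0 -> size s = n ->
  gderiv xi n.+1 (rcons s x) t =
  alpha xi n s t + n.+1%:R / t * (bval xi n s t + x * t ^+ n.+1).
Proof.
move=> t0 sn; rewrite /gderiv (@big_rcons n (fun k y => k.+1%:R * y * t ^+ k))// /alpha /bval.
have -> : \sum_(k < n) k.+1%:R * s`_k * t ^+ k =
    n.+1%:R / t * (\sum_(k < n) s`_k * t ^+ k.+1) - \sum_(k < n) (n - k)%:R * s`_k * t ^+ k.
  rewrite mulr_sumr -sumrB; apply: eq_bigr => k _.
  rewrite natrB; last exact: ltnW.
  by rewrite -[n.+1]addn1 -[k.+1]addn1 !natrD exprD expr1; field.
rewrite -[n.+2]addn2 -[n.+1]addn1 !natrD !exprD expr1 expr2; field.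
exact: t0.
Qed.

Definition jint al be : \bar R := (\int[mu]_(z in `[(-1)%R, 1%R]) (`|al + be * z|)%:E)%E.

Lemma jint_ge0 al be : (0 <= jint al be)%E.
Proof. by apply: integral_ge0 => z _; rewrite lee_fin. Qed.

Lemma measurable_jint be : be != 0 -> measurable_fun setT (fun al => jint al be).
Proof.
move=> be0; rewrite /jint; under eq_fun do rewrite integral_abs_affine ?lerN10//.
apply/measurable_EFinP; apply: measurable_funM => //; apply: measurable_funB;
  apply: measurable_funM; try (apply: measurableT_comp => //); exact: measurable_funD.
Qed.

Lemma measurable_absint : measurable_fun setT (@absint R).
Proof.
rewrite (_ : @absint R = (fun a => jint a (-1))); last first.
  by apply/funext => a; apply: eq_integral => y _; rewrite mulN1r.
by apply: measurable_jint; rewrite oppr_eq0 oner_eq0.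
Qed.

Lemma measurable_nth_linear d (T : measurableType d) n (a : T -> seq R) (b : nat -> R) c :
    (forall k, measurable_fun setT (fun z => (a z)`_k)) ->
  measurable_fun setT (fun z => c + \sum_(k < n) b k * (a z)`_k).
Proof.
move=> ma; apply: measurable_funD => //; apply: measurable_sum => k.
exact: measurable_funM.
Qed.

Lemma mtuple_gdens xi m t : mtuple m (fun s => (gdens xi m s t)%:E).
Proof.
have := measurable_gdens xi m (@mtuple_nth R m).
move=> /(measurable_fun_pair1 t)/=; exact.
Qed.

Lemma mtuple_jint xi n t be : be != 0 -> mtuple n (fun s => jint (alpha xi n s t) be).
Proof.
move=> be0; apply: (measurableT_comp (measurable_jint be0)).
have -> : (fun v : n.-tuple mR => alpha xi n v t) =
    (fun v => xi * t ^+ n.+1 + \sum_(k < n) (- ((n - k)%:R * t ^+ k)) * (v : seq R)`_k).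
  by apply/funext => v; rewrite /alpha -sumrN; congr (_ + _); apply: eq_bigr => k _; ring.
exact: (@measurable_nth_linear _ _ n _ (fun k => - ((n - k)%:R * t ^+ k)) _ (@mtuple_nth R n)).
Qed.

(* The last coordinate [p] ranges over the slab [|g(t)| <= 1], on which [g'(t)]
   is affine in [p]. *)
Lemma gdens_slab xi n s t : t != 0 -> size s = n ->
  (\int[mu]_(x in `[(-1)%R, 1%R]) (gdens xi n.+1 (rcons s x) t)%:E <=
   (`|t ^+ n.+1|^-1)%:E * jint (alpha xi n s t) (n.+1%:R / t))%E /\
  ((1 + `|bval xi n s t| <= `|t ^+ n.+1|)%R ->
   \int[mu]_(x in `[(-1)%R, 1%R]) (gdens xi n.+1 (rcons s x) t)%:E =
   (`|t ^+ n.+1|^-1)%:E * jint (alpha xi n s t) (n.+1%:R / t))%E.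
Proof.
move=> t0 sn.
have E x : gdens xi n.+1 (rcons s x) t =
    `|alpha xi n s t + n.+1%:R / t * (bval xi n s t + x * t ^+ n.+1)| *
    (`|bval xi n s t + x * t ^+ n.+1| <= 1)%R%:R.
  by rewrite /gdens gderiv_rcons// geval_rcons.
under eq_integral do rewrite E.
apply: slab11_integral; first by rewrite expf_neq0.
by rewrite mulf_neq0// invr_eq0.
Qed.

(* The odd perturbation [r = O(1/t)] of the header, as a function of the
   coefficients other than [p_m]. *)
Definition rfun n w t : R := if n is n'.+1 then
  (\sum_(k < n') (n'.+1 - k)%:R * w`_k * t ^+ k - n'.+2%:R * w`_n' / t) / t ^+ n' else 0.

Lemma mtuple_rfun n t : measurable_fun setT (fun w : n.-tuple mR => rfun n w t).
Proof.
case: n => [|n] /=; first exact: measurable_cst.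
apply: measurable_funM => //; apply: measurable_funB.
  apply: measurable_sum => k; apply: measurable_funM => //; apply: measurable_funM => //.
  exact: mtuple_nth.
apply: measurable_funM => //; apply: measurable_funM => //.
exact: mtuple_nth.
Qed.

Lemma mtuple_absint c n t : mtuple n (fun w => absint (c - rfun n w t)).
Proof.
apply: (measurableT_comp measurable_absint); apply: measurable_funB => //.
exact: mtuple_rfun.
Qed.

Lemma swap11 (a b d : R) :
  (\int[mu]_(y in `[(-1)%R, 1%R]) \int[mu]_(z in `[(-1)%R, 1%R]) (`|a + b * y + d * z|)%:E =
   \int[mu]_(z in `[(-1)%R, 1%R]) \int[mu]_(y in `[(-1)%R, 1%R]) (`|a + b * y + d * z|)%:E)%E.
Proof.
pose I : set mR := `[(-1)%R, 1%R]%classic.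
pose g (z : mR * mR) := ((`|a + b * z.1 + d * z.2|)%:E * (\1_I z.1)%:E * (\1_I z.2)%:E)%E.
have g0 z : (0 <= g z)%E by rewrite !mule_ge0// lee_fin.
have mI : measurable I by exact: measurable_itv.
have mg : measurable_fun setT g.
  apply: emeasurable_funM; first apply: emeasurable_funM.
  - apply/measurable_EFinP; apply: measurableT_comp => //.
    apply: measurable_funD; first apply: measurable_funD => //.
      by apply: measurable_funM => //; exact: measurable_cst.
    by apply: measurable_funM => //; exact: measurable_cst.
  - by apply/measurable_EFinP; apply: (measurableT_comp (f := (\1_I : mR -> R))) => //; exact: measurable_indic.
  - by apply/measurable_EFinP; apply: (measurableT_comp (f := (\1_I : mR -> R))) => //; exact: measurable_indic.
have fub := fubini_tonelli (m1 := mu) (m2 := mu) g mg g0.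
transitivity (\int[mu]_x \int[mu]_y g (x, y))%E; last rewrite fub.
  rewrite [LHS]integral_mkcond; apply: eq_integral => y _; rewrite patchE /g/= indicE.
  case: ifPn => yI; last by apply/esym/integral0_eq => z _; rewrite mule0 mul0e.
  rewrite [LHS]integral_mkcond; apply: eq_integral => z _; rewrite patchE indicE mule1.
  by case: ifPn => zI; rewrite ?mule1 ?mule0.
rewrite [RHS]integral_mkcond; apply: eq_integral => z _; rewrite patchE /g/= indicE.
case: ifPn => zI; last by apply: integral0_eq => y _; rewrite mule0.
rewrite [RHS]integral_mkcond; apply: eq_integral => y _; rewrite patchE indicE mule1.
by case: ifPn => yI; rewrite ?mule1 ?mule0.
Qed.

(** Let z be the slab variable and y the last entry of [s]. In the absolute value y has factor -
    t^(n-1) and z has factor (n + 1) / t. Dividing by t^(n-1) gives y the factor -1, so that y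
    becomes the variable of [absint], while z takes its place at the end of the list [w] and enters
    [rfun]. For n = 0 there is no y, and z is the variable of [absint] up to sign. *)
Lemma jbox_absint xi n t : t != 0 ->
  ((`|t ^+ n.+1|^-1)%:E * ebox n (fun s => jint (alpha xi n s t) (n.+1%:R / t)) =
   (t ^- 2)%:E * ebox n (fun w => absint (xi * t ^+ 2 - rfun n w t)))%E.
Proof.
move=> t0; case: n => [|n].
  rewrite !ebox0 /alpha big_ord0 subr0 /= subr0 !expr1.
  have -> : absint (xi * t ^+ 2) = jint (xi * t ^+ 2) 1.
    rewrite /absint -integral_opp11.
    - by apply: eq_integral => y _; rewrite opprK mul1r.
    - rewrite (_ : (fun y : R => _) = (fun y => (`|xi * t ^+ 2 + (-1) * y|)%:E)); first exact: measurable_abs_affine.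
      by apply/funext => y; rewrite mulN1r.
    - by move=> y; rewrite lee_fin.
  have tn : `|t| != 0 by rewrite normr_eq0.
  have -> : jint (xi * t) (1 / t) = ((`|t|^-1)%:E * jint (xi * t ^+ 2) 1)%E.
    rewrite /jint -ge0_integralZl_EFin ?invr_ge0//; last exact: measurable_abs_affine.
    apply: eq_integral => z _; rewrite -EFinM; congr EFin.
    rewrite -normfV -normrM; congr (`| _ |).
    by rewrite expr2; field.
  rewrite muleA -EFinM; congr (_%:E * _)%E.
  by rewrite -invfM -expr2 real_normK ?num_real.
have be0 : n.+2%:R / t != 0 by rewrite mulf_neq0// invr_eq0.
rewrite (ebox_rcons (@mtuple_jint xi n.+1 t _ be0) (fun s => jint_ge0 _ _)).
rewrite (ebox_rcons (@mtuple_absint (xi * t ^+ 2) n.+1 t) (fun s => absint_ge0 _)).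
pose S s := \sum_(k < n) (n.+1 - k)%:R * s`_k * t ^+ k.
have tn0 : t ^+ n != 0 by rewrite expf_neq0.
have alE s y : size s = n -> alpha xi n.+1 (rcons s y) t = xi * t ^+ n.+2 - S s - t ^+ n * y.
  move=> sn; rewrite /alpha (@big_rcons n (fun k y => (n.+1 - k)%:R * y * t ^+ k))//.
  by rewrite subSnn /S; ring.
have rE s z : size s = n -> rfun n.+1 (rcons s z) t = (S s - n.+2%:R * z / t) / t ^+ n.
  move=> sn /=; rewrite nth_rcons sn ltnn eqxx; congr ((_ - _) / _).
  by apply: eq_bigr => k _; rewrite nth_rcons sn ltn_ord.
have key s : size s = n ->
  (\int[mu]_(y in `[(-1)%R, 1%R]) jint (alpha xi n.+1 (rcons s y) t) (n.+2%:R / t) =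
   `|t ^+ n|%:E * \int[mu]_(z in `[(-1)%R, 1%R]) absint (xi * t ^+ 2 - rfun n.+1 (rcons s z) t))%E.
  move=> sn.
  transitivity (\int[mu]_(y in `[(-1)%R, 1%R]) \int[mu]_(z in `[(-1)%R, 1%R])
      (`|(xi * t ^+ n.+2 - S s) + (- t ^+ n) * y + (n.+2%:R / t) * z|)%:E)%E.
    by apply: eq_integral => y _; rewrite alE// mulNr.
  (* The exchange of y and z is what lets them trade roles. *)
  rewrite swap11 -ge0_integralZl_EFin//; last 2 first.
  - by move=> z _; exact: absint_ge0.
  - apply: measurable_funTS; apply: (measurableT_comp measurable_absint).
    under eq_fun do rewrite rE//.
    apply: measurable_funB => //; apply: measurable_funM => //; apply: measurable_funB => //.
    by apply: measurable_funM => //; exact: measurable_funM.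
  apply: eq_integral => z _; rewrite /absint -ge0_integralZl_EFin//; last first.
    rewrite (_ : (fun y : R => _) = (fun y : R => (`|xi * t ^+ 2 - rfun n.+1 (rcons s z) t + (-1) * y|)%:E)); first exact: measurable_abs_affine.
    by apply/funext => y; rewrite mulN1r.
  apply: eq_integral => y _; rewrite -EFinM -normrM rE//; congr (`| _ |)%:E.
  rewrite -[n.+2]addn2 exprD; field.
  by rewrite t0 tn0.
have -> : ebox n (fun s => \int[mu]_(y in `[(-1)%R, 1%R]) jint (alpha xi n.+1 (rcons s y) t) (n.+2%:R / t))%E =
  ebox n (fun s => `|t ^+ n|%:E * \int[mu]_(z in `[(-1)%R, 1%R]) absint (xi * t ^+ 2 - rfun n.+1 (rcons s z) t))%E.
  by apply: eq_ebox => s sn _; exact: key.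
rewrite eboxZ//; last 2 first.
- apply: (@mtuple_int_rcons R n (fun w => absint (xi * t ^+ 2 - rfun n.+1 w t))).
    exact: mtuple_absint.
  by move=> s; exact: absint_ge0.
- by move=> s; apply: integral_ge0 => z _; exact: absint_ge0.
rewrite muleA -EFinM; congr (_%:E * _)%E.
have -> : t ^- 2 = `|t ^+ 2|^-1 by rewrite ger0_norm ?sqr_ge0.
by rewrite -[n.+2]addn2 exprD normrM; field; rewrite !normr_eq0 tn0 expf_neq0.
Qed.

Definition Psi xi n t : \bar R := ebox n.+1 (fun s => (gdens xi n.+1 s t)%:E).

Definition Ebox n c t : \bar R := ebox n (fun w => absint (c - rfun n w t)).

Lemma Psi_le xi n t : t != 0 -> (Psi xi n t <= (t ^- 2)%:E * Ebox n (xi * t ^+ 2) t)%E.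
Proof.
move=> t0; rewrite /Ebox -jbox_absint// /Psi ebox_rcons//; last 2 first.
- exact: mtuple_gdens.
- by move=> s; rewrite lee_fin gdens_ge0.
have be0 : n.+1%:R / t != 0 by rewrite mulf_neq0// invr_eq0.
rewrite -eboxZ ?invr_ge0//; last 2 first.
- exact: mtuple_jint.
- by move=> s; exact: jint_ge0.
apply: ge0_le_ebox.
- apply: (@mtuple_int_rcons R n (fun w => (gdens xi n.+1 w t)%:E)).
    exact: mtuple_gdens.
  by move=> s; rewrite lee_fin gdens_ge0.
- by apply: measurable_funeM; exact: mtuple_jint.
- by move=> s; apply: integral_ge0 => z _; rewrite lee_fin gdens_ge0.
- by move=> s; rewrite mule_ge0 ?jint_ge0// lee_fin invr_ge0.
- by move=> s sn _; have [] := gdens_slab xi t0 sn.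
Qed.

Lemma sum_expr_le n t : 1 < `|t| ->
  1 + \sum_(k < n) `|t| ^+ k.+1 <= `|t| ^+ n.+1 * (`|t| - 1)^-1.
Proof.
move=> t1; have t10 : 0 < `|t| - 1 by rewrite subr_gt0.
rewrite ler_pdivlMr//; have -> : 1 + \sum_(k < n) `|t| ^+ k.+1 = \sum_(k < n.+1) `|t| ^+ k.
  by rewrite big_ord_recl expr0.
by rewrite mulrC -subrX1 lerBlDr lerDl.
Qed.

(** By the geometric sum; thus [xi * |t| + (|t| - 1)^-1 <= 1] suffices for the slab to lie inside
    [-1, 1], whatever the other coefficients. *)
Lemma bval_le xi n s t : all (fun x => `|x| <= 1) s -> size s = n -> 0 <= xi -> 1 < `|t| ->
  1 + `|bval xi n s t| <= `|t ^+ n.+1| * (xi * `|t| + (`|t| - 1)^-1).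
Proof.
move=> sb sn xi0 t1; rewrite normrX mulrDr.
have -> : `|t| ^+ n.+1 * (xi * `|t|) = xi * `|t| ^+ n.+2 by rewrite [in RHS]exprSr; ring.
apply: (@le_trans _ _ (xi * `|t| ^+ n.+2 + (1 + \sum_(k < n) `|t| ^+ k.+1))); last first.
  by rewrite lerD2l sum_expr_le.
rewrite addrCA lerD2l /bval (le_trans (ler_normD _ _))//.
rewrite normrM normrX (ger0_norm xi0) lerD2l (le_trans (ler_norm_sum _ _ _))//.
apply: ler_sum => k _; rewrite normrM normrX ler_piMl ?exprn_ge0//.
by move/allP : sb; apply; apply: mem_nth; rewrite sn.
Qed.

Lemma Psi_eq xi n t : 0 <= xi -> 1 < `|t| -> xi * `|t| + (`|t| - 1)^-1 <= 1 ->
  Psi xi n t = ((t ^- 2)%:E * Ebox n (xi * t ^+ 2) t)%E.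
Proof.
move=> xi0 t1 H; have t0 : t != 0 by rewrite -normr_gt0 (lt_trans _ t1).
rewrite /Ebox -jbox_absint// /Psi ebox_rcons//; last 2 first.
- exact: mtuple_gdens.
- by move=> s; rewrite lee_fin gdens_ge0.
have be0 : n.+1%:R / t != 0 by rewrite mulf_neq0// invr_eq0.
rewrite -eboxZ ?invr_ge0//; last 2 first.
- exact: mtuple_jint.
- by move=> s; exact: jint_ge0.
apply: eq_ebox => s sn sb; have [_ ->//] := gdens_slab xi t0 sn.
by rewrite (le_trans (bval_le sb sn xi0 t1))// ler_piMr.
Qed.

(** Bounds |t r|: for n + 1 entries, n weights of at most n + 1 and one weight n + 2 add up to at
    most (n + 2)^2. *)
Definition Kc n : R := n.+1%:R ^+ 2.

Lemma rfun_bound n w t : size w = n -> all (fun x => `|x| <= 1) w -> 1 <= `|t| ->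
  `|rfun n w t| <= Kc n / `|t|.
Proof.
move=> wn wb t1; have tp : 0 < `|t| by exact: lt_le_trans t1.
have wk k : (k < n)%N -> `|w`_k| <= 1.
  by move=> kn; move/allP : wb; apply; apply: mem_nth; rewrite wn.
case: n wn wk => [|n] wn wk /=; first by rewrite normr0 divr_ge0// /Kc sqr_ge0.
rewrite normrM normfV normrX ler_pdivrMr ?exprn_gt0//.
rewrite (le_trans (ler_normB _ _))//.
apply: (@le_trans _ _ (\sum_(k < n) n.+1%:R * (`|t| ^+ n / `|t|) + n.+2%:R * (`|t| ^+ n / `|t|))).
  apply: lerD; last first.
    rewrite !normrM normfV normr_nat -mulrA ler_wpM2l// ler_pM2r ?invr_gt0//.
    by rewrite (le_trans (wk _ _))// exprn_ege1.
  rewrite (le_trans (ler_norm_sum _ _ _))//; apply: ler_sum => k _.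
  rewrite !normrM normrX normr_nat -mulrA; apply: ler_pM => //.
    by rewrite ler_nat leq_subr.
  rewrite ler_pdivlMr// -mulrA -exprSr (le_trans (ler_piMl _ (wk _ _)))//.
  - by rewrite ltnW// ltnS.
  - by rewrite ler_weXn2l.
rewrite sumr_const card_ord -[_ *+ n]mulr_natl mulrA -mulrDl.
have -> : Kc n.+1 / `|t| * `|t| ^+ n = Kc n.+1 * (`|t| ^+ n / `|t|) by ring.
rewrite ler_wpM2r ?mulr_ge0 ?invr_ge0 ?exprn_ge0//.
rewrite /Kc -natrX -natrM -natrD ler_nat; lia.
Qed.

Lemma rfun_opp n w t : size w = n -> rfun n (map -%R w) t = - rfun n w t.
Proof.
move=> wn; case: n wn => [|n] wn /=; first by rewrite oppr0.
rewrite (nth_map 0) ?wn//.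
have -> : \sum_(k < n) (n.+1 - k)%:R * (map -%R w)`_k * t ^+ k =
    - \sum_(k < n) (n.+1 - k)%:R * w`_k * t ^+ k.
  rewrite -sumrN; apply: eq_bigr => k _.
  by rewrite (nth_map 0) ?wn; [ring|rewrite ltnW// ltnS].
by ring.
Qed.

Lemma Ebox_ge0 n c t : (0 <= Ebox n c t)%E.
Proof. by apply: ebox_ge0 => w; exact: absint_ge0. Qed.

Lemma Ebox_ub n c t : 0 <= c -> 1 <= `|t| ->
  (Ebox n c t <= (2 ^+ n * (2 * c + 2 * Kc n + 2))%:E)%E.
Proof.
move=> c0 t1; have K0 : 0 <= Kc n by exact: sqr_ge0.
have M0 : 0 <= 2 * c + 2 * Kc n + 2 by lra.
rewrite -ebox_cst//; apply: ge0_le_ebox.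
- exact: mtuple_absint.
- exact: measurable_cst.
- by move=> w; exact: absint_ge0.
- by move=> w; rewrite lee_fin.
move=> w wn wb; rewrite (le_trans (absint_ub _))// lee_fin lerD2r.
have : `|c - rfun n w t| <= c + Kc n; last lra.
rewrite (le_trans (ler_normB _ _))// ger0_norm// lerD2l (le_trans (rfun_bound wn wb t1))//.
by rewrite ler_pdivrMr ?(lt_le_trans _ t1)// ler_peMr.
Qed.

Lemma Ebox_sym n c t : Ebox n c t = ebox n (fun w => absint (c + rfun n w t)).
Proof.
rewrite /Ebox -(ebox_opp (@mtuple_absint c n t)); last by move=> w; exact: absint_ge0.
by apply: eq_ebox => w wn _; rewrite rfun_opp// opprK.
Qed.

Lemma mtuple_absintD c n t : mtuple n (fun w => absint (c + rfun n w t)).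
Proof.
apply: (measurableT_comp measurable_absint); apply: measurable_funD => //.
exact: mtuple_rfun.
Qed.

(* The shift [r = rfun n w t] is odd in [w], hence may be averaged with [- r]. *)
Lemma Ebox_double n c t :
  (Ebox n c t + Ebox n c t = ebox n (fun w => absint (c - rfun n w t) + absint (c + rfun n w t)))%E.
Proof.
rewrite {2}Ebox_sym -eboxD//.
- exact: mtuple_absint.
- exact: mtuple_absintD.
- by move=> w; exact: absint_ge0.
- by move=> w; exact: absint_ge0.
Qed.

Lemma Ebox_fin n c t : 0 <= c -> 1 <= `|t| -> Ebox n c t \is a fin_num.
Proof.
move=> c0 t1; rewrite ge0_fin_numE ?Ebox_ge0//.
by rewrite (le_lt_trans (Ebox_ub n c0 t1))// ltry.
Qed.

Lemma half_eqe (u v : \bar R) (w : R) : u \is a fin_num -> v \is a fin_num ->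
  (u + u = (v + v) + (2 * w)%:E -> u = v + w%:E)%E.
Proof.
case: u => [u||]//; case: v => [v||]// _ _; rewrite -!EFinD => -[E].
by congr EFin; lra.
Qed.

(** Here all arguments of [absint] are in [-1, 1], where it is 1 + a^2, and (c - r)^2 + (c + r)^2 =
    2 r^2 + 2 c^2 has no mixed term. *)
Lemma Ebox_small n c t : 0 <= c -> 1 <= `|t| -> c + Kc n / `|t| <= 1 ->
  Ebox n c t = (Ebox n 0 t + (2 ^+ n * c ^+ 2)%:E)%E.
Proof.
move=> c0 t1 cK.
have fc := Ebox_fin n c0 t1; have f0 := Ebox_fin n (lexx 0) t1.
have E : (Ebox n c t + Ebox n c t = (Ebox n 0 t + Ebox n 0 t) + (2 * (2 ^+ n * c ^+ 2))%:E)%E.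
  rewrite mulrCA !Ebox_double -ebox_cst; last by rewrite mulr_ge0// sqr_ge0.
  rewrite -eboxD.
  - apply: eq_ebox => w wn wb; have := rfun_bound wn wb t1.
    rewrite ler_norml; set r := rfun n w t => /andP[r1 r2].
    do 4 (rewrite absint_le1; last by rewrite ler_norml; lra).
    by rewrite -!EFinD; congr EFin; ring.
  - by apply: emeasurable_funD; [exact: mtuple_absint|exact: mtuple_absintD].
  - exact: measurable_cst.
  - by move=> w; rewrite adde_ge0// absint_ge0.
  - by move=> w; rewrite lee_fin mulr_ge0// sqr_ge0.
exact: half_eqe fc f0 E.
Qed.

(** Both c - r and c + r are at least 1, where [absint] is linear, so that r cancels in the
    average. *)
Lemma Ebox_large n c t : 1 <= `|t| -> 1 + Kc n / `|t| <= c ->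
  Ebox n c t = (2 ^+ n * (2 * c))%:E.
Proof.
move=> t1 cK; have K0 : 0 <= Kc n / `|t| by rewrite divr_ge0// sqr_ge0.
have c0 : 0 <= c by lra.
have fc := Ebox_fin n c0 t1.
have E : (Ebox n c t + Ebox n c t = (0 + 0) + (2 * (2 ^+ n * (2 * c)))%:E)%E.
  rewrite !add0e mulrCA !Ebox_double -ebox_cst; last by rewrite !mulr_ge0.
  apply: eq_ebox => w wn wb; have := rfun_bound wn wb t1.
  rewrite ler_norml; set r := rfun n w t => /andP[r1 r2].
  by rewrite !absint_ge1; [rewrite -EFinD; congr EFin; ring|lra|lra].
by rewrite -[RHS]add0e; exact: half_eqe fc _ E.
Qed.

Lemma psiE xi n t : psi xi n.+1 t = fine (Psi xi n t).
Proof. by []. Qed.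

Lemma psi_ge0 xi m t : 0 <= psi xi m t.
Proof. by apply: fine_ge0; apply: ebox_ge0 => s; rewrite lee_fin gdens_ge0. Qed.

Lemma psi_eq xi n t : 0 <= xi -> 1 < `|t| -> xi * `|t| + (`|t| - 1)^-1 <= 1 ->
  psi xi n.+1 t = t ^- 2 * fine (Ebox n (xi * t ^+ 2) t).
Proof.
move=> xi0 t1 H; have c0 : 0 <= xi * t ^+ 2 by rewrite mulr_ge0// sqr_ge0.
by rewrite psiE Psi_eq// fineM//; exact: Ebox_fin (ltW t1).
Qed.

Lemma psi_small xi n t : 0 <= xi -> 2 <= `|t| -> xi * `|t| + (`|t| - 1)^-1 <= 1 ->
    xi * t ^+ 2 + Kc n / `|t| <= 1 ->
  psi xi n.+1 t = psi 0 n.+1 t + 2 ^+ n * xi ^+ 2 * t ^+ 2.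
Proof.
move=> xi0 t2 H cK.
have t1 : 1 < `|t| by lra.
have t0 : t != 0 by rewrite -normr_gt0 (lt_trans _ t1).
have c0 : 0 <= xi * t ^+ 2 by rewrite mulr_ge0// sqr_ge0.
(* The hypothesis [2 <= |t|] gives the slab condition at xi = 0 too. *)
rewrite !psi_eq//; last first.
  by rewrite mul0r add0r invf_le1; lra.
rewrite mul0r (Ebox_small c0 (ltW t1) cK) fineD//; last exact: Ebox_fin (ltW t1).
rewrite /= mulrDr; congr (_ + _).
have : t ^+ 2 != 0 by rewrite expf_neq0.
by move: (t ^+ 2) (2 ^+ n) => u a u0; field.
Qed.

Lemma psi_large xi n t : 0 <= xi -> 1 < `|t| -> xi * `|t| + (`|t| - 1)^-1 <= 1 ->
    1 + Kc n / `|t| <= xi * t ^+ 2 ->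
  psi xi n.+1 t = 2 ^+ n.+1 * xi.
Proof.
move=> xi0 t1 H cK.
have t0 : t != 0 by rewrite -normr_gt0 (lt_trans _ t1).
rewrite psi_eq// (Ebox_large (ltW t1) cK)/= [2 ^+ n.+1]exprS.
have : t ^+ 2 != 0 by rewrite expf_neq0.
by move: (t ^+ 2) (2 ^+ n) => u a u0; field.
Qed.

(** Follows from [Psi_le], hence also available where the slab leaves [-1, 1] and [psi_eq] fails. *)
Lemma psi_ub xi n t : 0 <= xi -> 1 <= `|t| ->
  psi xi n.+1 t <= 2 ^+ n * (2 * xi + (2 * Kc n + 2) / t ^+ 2).
Proof.
move=> xi0 t1; have t0 : t != 0 by rewrite -normr_gt0 (lt_le_trans _ t1).
have c0 : 0 <= xi * t ^+ 2 by rewrite mulr_ge0// sqr_ge0.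
have : (Psi xi n t <= (2 ^+ n * (2 * xi + (2 * Kc n + 2) / t ^+ 2))%:E)%E.
  rewrite (le_trans (Psi_le _ _ t0))//.
  have -> : 2 ^+ n * (2 * xi + (2 * Kc n + 2) / t ^+ 2) =
      t ^- 2 * (2 ^+ n * (2 * (xi * t ^+ 2) + 2 * Kc n + 2)).
    have : t ^+ 2 != 0 by rewrite expf_neq0.
    by move: (t ^+ 2) (2 ^+ n) => u a u0; field.
  by rewrite EFinM lee_wpmul2l ?Ebox_ub// lee_fin invr_ge0 sqr_ge0.
move=> H; have P0 : (0 <= Psi xi n t)%E by apply: ebox_ge0 => s; rewrite lee_fin gdens_ge0.
rewrite psiE -lee_fin fineK// ge0_fin_numE//.
by rewrite (le_lt_trans H)// ltry.
Qed.

(** Cauchy's root bound: the leading term of g exceeds the sum of the others by more than 1, so the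
    slab |g(t)| <= 1 is empty. *)
Lemma psi_eq0 xi n t : 1 < `|t| -> 1 <= xi * (`|t| - 1) -> psi xi n.+1 t = 0.
Proof.
move=> t1 H; rewrite psiE.
suff -> : Psi xi n t = 0%:E by [].
transitivity (@ebox R n.+1 (fun=> 0%:E)); last by rewrite ebox_cst// mulr0.
apply: eq_ebox => s sn sb; rewrite /gdens.
suff -> : (`|geval xi n.+1 s t| <= 1) = false by rewrite mulr0.
apply/negbTE; rewrite -ltNge.
have t10 : 0 < `|t| - 1 by lra.
have xi0 : 0 <= xi by rewrite -(pmulr_lge0 _ t10); lra.
have : 1 + \sum_(k < n.+1) `|t| ^+ k.+1 < xi * `|t| ^+ n.+2.
  rewrite -(ltr_pM2r t10).
  have -> : 1 + \sum_(k < n.+1) `|t| ^+ k.+1 = \sum_(k < n.+2) `|t| ^+ k.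
    by rewrite [RHS]big_ord_recl expr0.
  rewrite [X in X < _]mulrC -subrX1.
  have : `|t| ^+ n.+2 * 1 <= `|t| ^+ n.+2 * (xi * (`|t| - 1)) by rewrite ler_wpM2l ?exprn_ge0.
  lra.
have : `|\sum_(k < n.+1) s`_k * t ^+ k.+1| <= \sum_(k < n.+1) `|t| ^+ k.+1.
  rewrite (le_trans (ler_norm_sum _ _ _))//; apply: ler_sum => k _.
  rewrite normrM normrX ler_piMl ?exprn_ge0//.
  by move/allP : sb; apply; apply: mem_nth; rewrite sn.
have : `|xi * t ^+ n.+2| <= `|geval xi n.+1 s t| + `|\sum_(k < n.+1) s`_k * t ^+ k.+1|.
  by rewrite -[X in `|X| <= _](addrK (\sum_(k < n.+1) s`_k * t ^+ k.+1)) (le_trans (ler_normB _ _)).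
rewrite normrM (ger0_norm xi0) normrX; lra.
Qed.

Lemma phi_psi m t : phi m t = psi 0 m t.
Proof.
rewrite /phi /psi /rbox /ebox /Rintegral; congr fine.
have -> : G_dom t = box R m `&` [set p : m.-tuple mR | `|geval 0 m p t| <= 1].
  apply/seteqP; split => p /= [].
    move=> pm pt; split.
      apply/allP => x /tnthP[k ->]; apply: le_trans pm.
      exact: (@le_bigmax _ _ _ 0 (fun k => `|tnth p k|)).
    by rewrite /geval mul0r add0r; under eq_bigr do rewrite -tnth_nth.
  move=> /allP pb pt; split.
    by apply: bigmax_le => // k _; apply: pb; exact: mem_tnth.
  by move: pt; rewrite /geval mul0r add0r; under eq_bigr do rewrite -tnth_nth.
rewrite integral_mkcondr; apply: eq_integral => p _; rewrite patchE /gdens /=.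
have -> : gderiv 0 m p t = \sum_(k < m) k.+1%:R * tnth p k * t ^+ k.
  by rewrite /gderiv !mul0r add0r; apply: eq_bigr => k _; rewrite -tnth_nth.
case: ifPn; first by rewrite inE/= => ->; rewrite mulr1.
by rewrite notin_setE/= => /negP/negbTE ->; rewrite mulr0.
Qed.

End large_t.

(** * The density psi for bounded t *)

Section small_t.
Variable R : realType.
Local Notation mR := (measurableTypeR R).
Local Notation mu := (@lebesgue_measure R).
Implicit Types (xi t de B : R) (s : seq R) (m n : nat).

Lemma measurable_bool_natr d (T : measurableType d) (P : T -> bool) :
  measurable [set x | P x] -> measurable_fun setT (fun x => (P x)%:R : R).
Proof.
move=> mP; rewrite (_ : (fun x => _) = \1_[set x | P x]); first exact: measurable_indic.
by apply/funext => x; rewrite indicE; congr (nat_of_bool _)%:R; apply/idP/idP; rewrite inE.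
Qed.

(** When |xi t^(m+1)| <= de, the indicator of |g(t)| <= 1 can differ between xi and 0 only at such
    [s]. *)
Definition near_level m t de s : bool := `| `|geval 0 m s t| - 1| <= de.

Lemma mtuple_near_level m t de : mtuple m (fun s => (near_level m t de s)%:R%:E).
Proof.
have mg : measurable_fun setT (fun s : m.-tuple mR => geval 0 m s t).
  apply: measurable_funD => //; apply: measurable_sum => k.
  by apply: measurable_funM => //; exact: mtuple_nth.
apply/measurable_EFinP/measurable_bool_natr; rewrite -[X in measurable X]setTI.
apply: (measurable_fun_le _ _) => //; apply: measurableT_comp => //.
by apply: measurable_funB => //; exact: measurableT_comp.
Qed.

Lemma measurable_near t B (c : R) de :
  measurable_fun setT (fun x : R => (`| `|B + x * t| - c| <= de)%R%:R%:E : \bar R).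
Proof.
apply/measurable_EFinP/measurable_bool_natr; rewrite -[X in measurable X]setTI.
apply: (measurable_fun_le _ _) => //; apply: measurableT_comp => //.
apply: measurable_funB => //; apply: measurableT_comp => //.
by apply: measurable_funD => //; exact: mulrr_measurable.
Qed.

Lemma integral_near_line t B (c : R) de : t != 0 -> 0 <= de ->
  (\int[mu]_x (`| `|B + x * t| - c| <= de)%R%:R%:E <= (4 * (de / `|t|))%:E)%E.
Proof.
move=> t0 de0; set r := de / `|t|.
have r0 : 0 <= r by rewrite divr_ge0.
pose I (e : R) : set mR := `[(e - B) / t - r, (e - B) / t + r]%classic.
have mI e : measurable (I e) by exact: measurable_itv.
have lI e : mu (I e) = (2 * r)%:E.
  rewrite /I lebesgue_measure_itv/= lte_fin; case: ltP => [_|H].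
    by rewrite -EFinB; congr EFin; ring.
  by congr EFin; lra.
have inI e x : `|B + x * t - e| <= de -> I e x.
  move=> H; rewrite /I/= in_itv/= -ler_distl distrC /r ler_pdivlMr ?normr_gt0// -normrM.
  by have -> : ((e - B) / t - x) * t = - (B + x * t - e); [field|rewrite normrN].
(* The two bands around the values c and - c, each of length 2 de / |t|, account for the factor
   4. *)
apply: (@le_trans _ _ (\int[mu]_x ((\1_(I c) x)%:E + (\1_(I (- c)) x)%:E))%E); last first.
  rewrite ge0_integralD//; try by apply/measurable_EFinP; exact: measurable_indic.
  have eI e : (\int[mu]_x (\1_(I e) x)%:E = (2 * r)%:E)%E.
    by rewrite integral_indic// setIT; exact: lI.
  rewrite !eI -EFinD lee_fin; lra.
apply: ge0_le_integral => //.
- exact: measurable_near.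
- by apply: emeasurable_funD; apply/measurable_EFinP; exact: measurable_indic.
move=> x _; rewrite -EFinD lee_fin !indicE.
case: (boolP (_ <= de)) => [H|_]; last by rewrite addr_ge0.
suff [H1|H1] : I c x \/ I (- c) x.
- by rewrite (mem_set H1) lerDl.
- by rewrite (mem_set H1) lerDr.
have [u0|u0] := leP 0 (B + x * t).
  by left; apply: inI; move: H; rewrite (ger0_norm u0).
right; apply: inI; move: H; rewrite (ltr0_norm u0).
by rewrite (_ : - (B + x * t) - c = - (B + x * t - - c)) ?normrN//; ring.
Qed.

Lemma integral_near t B de : t != 0 -> 0 <= de ->
  (\int[mu]_(x in `[(-1)%R, 1%R]) (`| `|B + x * t| - 1| <= de)%R%:R%:E <= (4 * (de / `|t|))%:E)%E.
Proof.
move=> t0 de0; apply: (le_trans _ (integral_near_line B 1 t0 de0)).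
apply: ge0_subset_integral => //.
exact: measurable_near.
Qed.

Lemma sum_expr_small m t : `|t| <= 4^-1 -> \sum_(k < m) `|t| ^+ k.+1 <= 3^-1.
Proof.
move=> t4; elim: m => [|m IH]; first by rewrite big_ord0.
rewrite big_ord_recl expr1 (eq_bigr (fun k : 'I_m => `|t| * `|t| ^+ k.+1)); last first.
  by move=> k _; rewrite -exprS.
rewrite -mulr_sumr.
have : `|t| * \sum_(k < m) `|t| ^+ k.+1 <= 4^-1 * 3^-1.
  by apply: ler_pM => //; apply: sumr_ge0 => k _; rewrite exprn_ge0.
lra.
Qed.

Lemma geval_norm_le m s t : size s = m -> all (fun x => `|x| <= 1) s ->
  `|geval 0 m s t| <= \sum_(k < m) `|t| ^+ k.+1.
Proof.
move=> sm sb; rewrite /geval mul0r add0r (le_trans (ler_norm_sum _ _ _))//.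
apply: ler_sum => k _; rewrite normrM normrX ler_piMl ?exprn_ge0//.
by move/allP : sb; apply; apply: mem_nth; rewrite sm.
Qed.

Lemma gderiv_near xi m s t T : 0 <= xi -> 1 <= T -> `|t| <= T ->
  `|gderiv xi m s t - gderiv 0 m s t| <= xi * (m.+1%:R * T ^+ m).
Proof.
move=> xi0 T1 tT; rewrite /gderiv !mul0r add0r addrK -mulrA normrM (ger0_norm xi0).
rewrite ler_wpM2l// normrM normr_nat normrX ler_wpM2l// lerXn2r ?nnegrE//; lra.
Qed.

Lemma gderiv_bound m s t T : 1 <= T -> `|t| <= T -> size s = m ->
  all (fun x => `|x| <= 1) s -> `|gderiv 0 m s t| <= m%:R * (m%:R * T ^+ m).
Proof.
move=> T1 tT sm sb; rewrite /gderiv !mul0r add0r (le_trans (ler_norm_sum _ _ _))//.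
apply: (@le_trans _ _ (\sum_(k < m) m%:R * T ^+ m)).
  apply: ler_sum => k _; rewrite !normrM normr_nat normrX -mulrA.
  have tk : `|t| ^+ k <= T ^+ m.
    apply: (@le_trans _ _ (T ^+ k)); first by rewrite lerXn2r ?nnegrE//; lra.
    by rewrite ler_weXn2l// ltnW.
  apply: ler_pM => //; first by rewrite ler_nat.
  rewrite (le_trans _ tk)// ler_piMl//.
  by move/allP : sb; apply; apply: mem_nth; rewrite sm.
by rewrite sumr_const card_ord -[_ *+ m]mulr_natl.
Qed.

Lemma geval_near xi m s t T : 0 <= xi -> 1 <= T -> `|t| <= T ->
  `|geval xi m s t - geval 0 m s t| <= xi * T ^+ m.+1.
Proof.
move=> xi0 T1 tT; rewrite /geval mul0r add0r addrK normrM (ger0_norm xi0) normrX.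
by rewrite ler_wpM2l// lerXn2r ?nnegrE//; lra.
Qed.

(** If |t| <= 1/4, then |g(t)| <= 1/3 and the level 1 is out of reach. Otherwise the last coordinate
    has coefficient t^(n+1), at least 4^-(n+1) in absolute value, and [integral_near] bounds the
    measure uniformly in t. *)
Lemma ebox_near n t de : 0 <= de -> de <= 2^-1 ->
  (ebox n.+1 (fun s => (near_level n.+1 t de s)%:R%:E) <= (2 ^+ n * (4 * (4 ^+ n.+1 * de)))%:E)%E.
Proof.
move=> de0 de2; have C0 : 0 <= 4 * (4 ^+ n.+1 * de) by rewrite !mulr_ge0 ?exprn_ge0.
have [t4|t4] := leP `|t| 4^-1.
  have -> : ebox n.+1 (fun s => (near_level n.+1 t de s)%:R%:E) = ebox n.+1 (fun=> 0%:E).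
    apply: eq_ebox => s sn sb.
    suff -> : near_level n.+1 t de s = false by []; apply/negbTE.
    rewrite /near_level -ltNge.
    have := geval_norm_le t sn sb; have := sum_expr_small n.+1 t4.
    move=> H1 /le_trans/(_ H1) H; rewrite ltr0_norm; lra.
  by rewrite ebox_cst// mulr0 lee_fin mulr_ge0// exprn_ge0.
have t0 : t != 0 by rewrite -normr_gt0 (lt_trans _ t4).
rewrite (ebox_rcons (@mtuple_near_level n.+1 t de)); last by move=> s; rewrite lee_fin.
rewrite -ebox_cst//; apply: ge0_le_ebox.
- apply: (mtuple_int_rcons (@mtuple_near_level n.+1 t de)).
  by move=> s; rewrite lee_fin.
- exact: measurable_cst.
- by move=> s; apply: integral_ge0 => x _; rewrite lee_fin.
- by move=> s; rewrite lee_fin.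
move=> s sn _; rewrite /near_level; under eq_integral do rewrite geval_rcons//.
apply: (le_trans (integral_near _ _ de0)); first by rewrite expf_neq0.
rewrite lee_fin ler_wpM2l// mulrC ler_wpM2r// normrX -exprVn.
rewrite lerXn2r ?nnegrE ?invr_ge0// -[leRHS]invrK.
by rewrite lef_pV2 ?posrE ?normr_gt0// ltW.
Qed.

Lemma Psi_bounded xi n t T : 0 <= xi -> xi <= 1 -> 1 <= T -> `|t| <= T ->
  Psi xi n t \is a fin_num.
Proof.
move=> xi0 xi1 T1 tT; rewrite ge0_fin_numE; last first.
  by apply: ebox_ge0 => s; rewrite lee_fin gdens_ge0.
pose D := n.+1%:R * (n.+1%:R * T ^+ n.+1) + n.+2%:R * T ^+ n.+1.
have T0 : 0 <= T by lra.
have D0 : 0 <= D by rewrite /D addr_ge0// !mulr_ge0 ?exprn_ge0.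
apply: (@le_lt_trans _ _ (2 ^+ n.+1 * D)%:E); last by rewrite ltry.
rewrite -ebox_cst//; apply: ge0_le_ebox.
- exact: mtuple_gdens.
- exact: measurable_cst.
- by move=> s; rewrite lee_fin gdens_ge0.
- by move=> s; rewrite lee_fin.
move=> s sn sb; rewrite lee_fin /gdens.
have H1 := gderiv_bound T1 tT sn sb.
have H2 := @gderiv_near xi n.+1 s t T xi0 T1 tT.
apply: (@le_trans _ _ `|gderiv xi n.+1 s t|); first by rewrite ler_piMr// lern1 leq_b1.
rewrite -[X in `|X|](subrK (gderiv 0 n.+1 s t)) (le_trans (ler_normD _ _))// addrC lerD//.
by rewrite (le_trans H2)// ler_piMl// mulr_ge0// exprn_ge0.
Qed.

(** Passing from xi to 0 changes g' by at most [xi * a], and changes the indicator only on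
    [near_level], which has measure O(xi) and where |g'| <= [D]. *)
Lemma psi_near n T : 1 <= T -> exists2 C : R, 0 <= C &
  forall xi t, 0 <= xi -> xi * T ^+ n.+2 <= 2^-1 -> `|t| <= T ->
  `|psi xi n.+1 t - psi 0 n.+1 t| <= C * xi.
Proof.
move=> T1; have T0 : 0 <= T by lra.
pose D := n.+1%:R * (n.+1%:R * T ^+ n.+1) + n.+2%:R * T ^+ n.+1.
pose a := n.+2%:R * T ^+ n.+1.
pose C := 2 ^+ n.+1 * a + D * (2 ^+ n * (4 * (4 ^+ n.+1 * T ^+ n.+2))).
have a0 : 0 <= a by rewrite /a !mulr_ge0 ?exprn_ge0.
have D0 : 0 <= D by rewrite /D addr_ge0// !mulr_ge0 ?exprn_ge0.
exists C.
  have eT k : 0 <= T ^+ k by exact: exprn_ge0.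
  have e2 k : 0 <= 2 ^+ k :> R by exact: exprn_ge0.
  have e4 k : 0 <= 4 ^+ k :> R by exact: exprn_ge0.
  apply: addr_ge0; first exact: mulr_ge0.
  by apply: mulr_ge0 => //; apply: mulr_ge0 => //; apply: mulr_ge0 => //; exact: mulr_ge0.
move=> xi t xi0 xiT tT.
have xi1 : xi <= 1.
  have : 1 <= T ^+ n.+2 by rewrite exprn_ege1.
  move=> TT; have : xi * 1 <= xi * T ^+ n.+2 by rewrite ler_wpM2l.
  lra.
set de := xi * T ^+ n.+2; have de0 : 0 <= de by rewrite mulr_ge0// exprn_ge0.
(* Taking (u, v) to be (xi, 0) or (0, xi) yields both halves of the absolute value from one
   estimate. *)
have pw s (u v : R) : size s = n.+1 -> all (fun x => `|x| <= 1) s ->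
    (u = xi /\ v = 0) \/ (u = 0 /\ v = xi) ->
    gdens u n.+1 s t <= gdens v n.+1 s t + (xi * a + D * (near_level n.+1 t de s)%:R).
  move=> sn sb uv.
  have H1 := gderiv_bound T1 tT sn sb.
  have H2 := @gderiv_near xi n.+1 s t T xi0 T1 tT.
  have H3 := @geval_near xi n.+1 s t T xi0 T1 tT.
  have xa0 : 0 <= xi * a by rewrite mulr_ge0.
  have Hu : `|gderiv u n.+1 s t| <= D.
    have : `|gderiv xi n.+1 s t| <= D.
      rewrite -[X in `|X|](subrK (gderiv 0 n.+1 s t)) (le_trans (ler_normD _ _))// addrC lerD//.
      by rewrite (le_trans H2)// ler_piMl.
    by case: uv => -[-> _] // _; rewrite (le_trans H1)// /D lerDl.
  have Huv : `|gderiv u n.+1 s t| <= `|gderiv v n.+1 s t| + xi * a.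
    have : `|gderiv u n.+1 s t - gderiv v n.+1 s t| <= xi * a.
      by case: uv => -[-> ->] //; rewrite distrC.
    by move=> H; rewrite -[X in `|X|](subrK (gderiv v n.+1 s t)) (le_trans (ler_normD _ _))// addrC lerD2l.
  have Huv' : `|geval u n.+1 s t - geval v n.+1 s t| <= de.
    by case: uv => -[-> ->] //; rewrite distrC.
  rewrite /gdens; case: (leP `|geval u n.+1 s t| 1) => gu; last first.
    by rewrite mulr0 !addr_ge0// !mulr_ge0.
  rewrite mulr1; case: (leP `|geval v n.+1 s t| 1) => gv.
    by rewrite mulr1 addrA (le_trans Huv)// lerDl mulr_ge0.
  rewrite mulr0 add0r.
  suff -> : near_level n.+1 t de s by rewrite mulr1 (le_trans Hu)// lerDr.
  rewrite /near_level; case: uv => -[uE vE]; rewrite uE vE in gu gv Huv'.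
    rewrite ger0_norm; last lra.
    have : `|geval 0 n.+1 s t| <= `|geval xi n.+1 s t| + `|geval xi n.+1 s t - geval 0 n.+1 s t|.
      by rewrite -[X in `|X| <= _](subKr (geval xi n.+1 s t)) (le_trans (ler_normB _ _)).
    lra.
  rewrite distrC in Huv'; rewrite ler0_norm; last lra.
  have : `|geval xi n.+1 s t| <= `|geval 0 n.+1 s t| + `|geval xi n.+1 s t - geval 0 n.+1 s t|.
    by rewrite -[X in `|X| <= _](subrK (geval 0 n.+1 s t)) addrC (le_trans (ler_normD _ _)).
  lra.
have errE : (ebox n.+1 (fun s => (xi * a)%:E + D%:E * (near_level n.+1 t de s)%:R%:E) <= (C * xi)%:E)%E.
  rewrite eboxD.
  - have -> : (ebox n.+1 (fun s => D%:E * (near_level n.+1 t de s)%:R%:E) =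
        D%:E * ebox n.+1 (fun s => (near_level n.+1 t de s)%:R%:E))%E.
      by apply: eboxZ => //; exact: mtuple_near_level.
    rewrite ebox_cst; last exact: mulr_ge0.
    have -> : C * xi = 2 ^+ n.+1 * (xi * a) + D * (2 ^+ n * (4 * (4 ^+ n.+1 * de))).
      by rewrite /C /de; ring.
    rewrite [X in (_ <= X)%E]EFinD; apply: leeD => //; rewrite EFinM; apply: lee_wpmul2l; first by rewrite lee_fin.
    exact: ebox_near.
  - exact: measurable_cst.
  - by apply: measurable_funeM; exact: mtuple_near_level.
  - by move=> s; rewrite lee_fin mulr_ge0.
  - by move=> s; rewrite lee_fin mulr_ge0.
have err0 s : (0 <= (xi * a)%:E + D%:E * (near_level n.+1 t de s)%:R%:E)%E.
  by apply: adde_ge0; [rewrite lee_fin; exact: mulr_ge0|apply: mule_ge0; rewrite lee_fin].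
have fin u : u = xi \/ u = 0 -> Psi u n t \is a fin_num.
  by case=> ->; apply: (@Psi_bounded _ n t T).
have cmp (u v : R) : (u = xi /\ v = 0) \/ (u = 0 /\ v = xi) -> psi u n.+1 t <= psi v n.+1 t + C * xi.
  move=> uv; rewrite !psiE -lee_fin EFinD !fineK; last 2 first.
  - by apply: fin; case: uv => -[_ ->]; [right|left].
  - by apply: fin; case: uv => -[-> _]; [left|right].
  have mE : mtuple n.+1 (fun s => ((xi * a)%:E + D%:E * (near_level n.+1 t de s)%:R%:E)%E).
    apply: emeasurable_funD; first exact: measurable_cst.
    by apply: measurable_funeM; exact: mtuple_near_level.
  apply: (le_trans _ (leeD2l _ errE)); rewrite -eboxD//.
  - apply: ge0_le_ebox.
    + exact: mtuple_gdens.
    + by apply: emeasurable_funD => //; exact: mtuple_gdens.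
    + by move=> s; rewrite lee_fin gdens_ge0.
    + by move=> s; apply: adde_ge0; [rewrite lee_fin gdens_ge0|exact: err0].
    + by move=> s sn sb; rewrite -EFinM -!EFinD lee_fin; exact: pw.
  - exact: mtuple_gdens.
  - by move=> s; rewrite lee_fin gdens_ge0.
have h1 := cmp xi 0 (or_introl (conj erefl erefl)).
have h2 := cmp 0 xi (or_intror (conj erefl erefl)).
by rewrite ler_norml; lra.
Qed.

End small_t.

(** * Comparison of psi and omega in the mean *)

Section density_comparison.
Variable R : realType.
Local Notation mR := (measurableTypeR R).
Local Notation mu := (@lebesgue_measure R).
Implicit Types (Q t : R) (n : nat).

Lemma powR_inv_half Q : 0 <= Q -> Q^-1 `^ (- 2^-1) = Num.sqrt Q.
Proof. by move=> Q0; rewrite powRN powR12_sqrt ?invr_ge0// sqrtrV// invrK. Qed.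

Lemma omegaE n Q t : 0 <= Q -> omega n.+2 Q^-1 t =
  if `|t| <= Num.sqrt Q then psi 0 n.+1 t + 2 ^+ n * Q^-1 ^+ 2 * t ^+ 2
  else if `|t| < Q + 1 then 2 ^+ n.+1 * Q^-1 else 0.
Proof. by move=> Q0; rewrite /omega powR_inv_half// invrK subn1 subn2/= phi_psi. Qed.

(** Covers the places where psi and omega may differ: near 0 and near the boundaries of the cases of
    omega. The width T = 2 K + 8 is what the two cubic inequalities below require, with K =
    [Kc R n]. *)
Definition window n Q t : R :=
  let T := 2 * (Kc R n + 4) in
  (`|t| <= T)%R%:R + (`| `|t| - Num.sqrt Q| <= T)%R%:R + (`| `|t| - Q| <= 4)%R%:R.

(** With a = |t| and tau^2 = Q, division by a Q gives K / a <= 1 - a^2 / Q, the condition of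
    [psi_small]. The factor 2 K + 8 is supplied by tau - a if a >= tau / 2, and by a itself
    otherwise. *)
Lemma cubic_gap_below (K tau a : R) : 0 <= K -> 2 * K + 8 < a -> a < tau - (2 * K + 8) ->
  K * tau ^+ 2 <= a * (tau ^+ 2 - a ^+ 2).
Proof.
move=> K0 Ka atau; rewrite subr_sqr.
have [ah|ah] := leP (tau / 2) a.
  have u1 : (2 * K + 8) * tau <= (tau - a) * (tau + a) by apply: ler_pM; lra.
  have u2 : (tau / 2) * ((2 * K + 8) * tau) <= a * ((tau - a) * (tau + a)).
    by apply: ler_pM => //; [lra|apply: mulr_ge0; lra].
  apply: (le_trans _ u2); have -> : tau / 2 * ((2 * K + 8) * tau) = (K + 4) * tau ^+ 2 by field.
  by rewrite ler_wpM2r ?sqr_ge0//; lra.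
have u1 : (tau / 2) * tau <= (tau - a) * (tau + a) by apply: ler_pM; lra.
have u2 : (2 * K + 8) * ((tau / 2) * tau) <= a * ((tau - a) * (tau + a)).
  by apply: ler_pM => //; [lra|apply: mulr_ge0; lra|exact: ltW].
apply: (le_trans _ u2); have -> : (2 * K + 8) * (tau / 2 * tau) = (K + 4) * tau ^+ 2 by field.
by rewrite ler_wpM2r ?sqr_ge0//; lra.
Qed.

(** Division by a Q gives K / a <= a^2 / Q - 1, the condition of [psi_large]. *)
Lemma cubic_gap_above (K tau a : R) : 0 <= K -> 0 <= tau -> tau + (2 * K + 8) < a ->
  K * tau ^+ 2 <= a * (a ^+ 2 - tau ^+ 2).
Proof.
move=> K0 tau0 atau; rewrite subr_sqr.
have u1 : (2 * K + 8) * tau <= (a - tau) * (a + tau) by apply: ler_pM; lra.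
have u2 : tau * ((2 * K + 8) * tau) <= a * ((a - tau) * (a + tau)).
  by apply: ler_pM => //; [apply: mulr_ge0; lra|lra].
apply: (le_trans _ u2); have -> : tau * ((2 * K + 8) * tau) = (2 * K + 8) * tau ^+ 2 by ring.
by rewrite ler_wpM2r ?sqr_ge0//; lra.
Qed.

Lemma psi_omega_eq n Q t (T := 2 * (Kc R n + 4)) : 4 * T <= Num.sqrt Q -> Num.sqrt Q <= Q - 4 ->
    T < `|t| -> T < `| `|t| - Num.sqrt Q| -> 4 < `| `|t| - Q| ->
  psi Q^-1 n.+1 t = omega n.+2 Q^-1 t.
Proof.
have K0 : 0 <= Kc R n by exact: sqr_ge0.
rewrite /T {T} => tauT tauQ Ta B2 B3.
have Qp : 0 < Q by lra.
have s0 : 0 <= Num.sqrt Q by exact: sqrtr_ge0.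
have tau2 : Num.sqrt Q ^+ 2 = Q by rewrite sqr_sqrtr// ltW.
have xi0 : 0 < Q^-1 by rewrite invr_gt0.
have xi0' := ltW xi0.
have xiQ : Q^-1 * Q = 1 by rewrite mulVf// gt_eqF.
rewrite omegaE ?(ltW Qp)//.
have t2 : t ^+ 2 = `|t| ^+ 2 by rewrite real_normK// num_real.
move: Ta B2 B3.
have psmall := @psi_small R Q^-1 n t xi0'.
have plarge := @psi_large R Q^-1 n t xi0'.
have pzero := @psi_eq0 R Q^-1 n t.
rewrite t2 in psmall plarge *.
move: K0 tauT psmall plarge pzero; move: (Kc R n) => K K0 tauT.
move: tauT tauQ s0 tau2; move: (Num.sqrt Q) => tau tauT tauQ s0 tau2.
move: `|t| => a psmall plarge pzero Ta B2 B3.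
have ap : 0 < a by lra.
have inv1 : (a - 1)^-1 <= 2^-1 by rewrite lef_pV2 ?posrE; lra.
have QK (z : R) : K * tau ^+ 2 <= a * z -> K / a <= Q^-1 * z.
  rewrite tau2 => /(ler_wpM2l xi0'); rewrite mulrCA xiQ mulr1 => H.
  by rewrite ler_pdivrMr//; move: H; rewrite mulrCA mulrC.
have [atau|atau] := leP a tau.
  have at1 : a < tau - (2 * K + 8).
    by move: B2 {psmall plarge pzero QK}; rewrite ltr_normr => /orP[|]; lra.
  have := QK _ (cubic_gap_below K0 _ at1); rewrite tau2 mulrBr xiQ => sm.
  have {}sm : Q^-1 * a ^+ 2 + K / a <= 1.
    by have /sm : 2 * K + 8 < a; move: Ta {psmall plarge pzero QK sm}; lra.
  apply: psmall => //; first by move: Ta {plarge pzero QK sm B2 B3}; lra.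
  have Ka : 0 <= K / a by rewrite divr_ge0// ltW.
  have : Q^-1 * a * 8 <= Q^-1 * a ^+ 2.
    by rewrite expr2 mulrA ler_wpM2l ?mulr_ge0 ?(ltW ap)//; move: Ta {plarge pzero QK sm B2 B3}; lra.
  move: sm Ka inv1 {plarge pzero QK B2 B3 Ta}; lra.
have at1 : tau + (2 * K + 8) < a.
  by move: B2 {psmall plarge pzero QK}; rewrite ltr_normr => /orP[|]; lra.
have [aQ|aQ] := leP a Q.
  have aQ4 : a < Q - 4.
    by move: B3 {psmall plarge pzero QK}; rewrite ltr_normr => /orP[|]; lra.
  rewrite ifT; last by move: aQ {psmall plarge pzero QK}; lra.
  apply: plarge.
  - by move: at1 s0 {psmall pzero QK}; lra.
  (* Slab condition: up to Q / 2 both terms are at most 1/2; beyond it (a - 1)^-1 <= 4 / Q, exactly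
     the room left by a < Q - 4. This fixes the half-width 4 of the last window. *)
  - have [ah|ah] := leP a (Q / 2).
      have := ler_wpM2l xi0' ah; rewrite mulrA xiQ; move: inv1 {psmall pzero QK B2 B3}; lra.
    have i2 : (a - 1)^-1 <= 4 * Q^-1.
      have a1 : 0 < a - 1 by move: at1 s0 {psmall pzero QK}; lra.
      rewrite -[X in _ <= X]invrK lef_pV2 ?posrE//; last by rewrite invr_gt0 mulr_gt0.
      by rewrite invfM invrK; move: ah tauQ tauT {psmall pzero QK}; lra.
    have := ler_wpM2l xi0' (ltW aQ4); rewrite mulrBr xiQ; move: i2 {psmall pzero QK}; lra.
  - have := QK _ (cubic_gap_above K0 s0 at1); rewrite tau2 mulrBr xiQ.
    by move=> {psmall pzero QK}; lra.
have aQ4 : Q + 4 < a.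
  by move: B3 {psmall plarge pzero QK}; rewrite ltr_normr => /orP[|]; lra.
rewrite ifF; last by apply/negbTE; rewrite -leNgt; move: aQ4 {psmall plarge pzero QK}; lra.
apply: pzero; first by move: at1 s0 {psmall plarge QK}; lra.
have : Q <= a - 1 by move: aQ4 {psmall plarge QK}; lra.
by move=> /(ler_wpM2l xi0'); rewrite xiQ.
Qed.

Definition crude_const n : R :=
  2 ^+ n * (2 + (2 * Kc R n + 2) * 4) + (2 ^+ n * ((2 * Kc R n + 2) * 4) + 2 ^+ n) + 2 * 2 ^+ n.

(** For |t| >= sqrt Q / 2 one has t^-2 <= 4 / Q, so [psi_ub] makes both psi and its value at xi = 0
    of order 1/Q; the other terms of omega are so by their formulas. *)
Lemma psi_omega_crude n Q t : 0 < Q -> 1 <= `|t| -> Num.sqrt Q / 2 <= `|t| ->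
  `|psi Q^-1 n.+1 t - omega n.+2 Q^-1 t| <= crude_const n * Q^-1.
Proof.
move=> Qp t1 atau; set xi := Q^-1; set K := Kc R n; set tau := Num.sqrt Q in atau.
have K0 : 0 <= K by exact: sqr_ge0.
have e2 : 0 <= 2 ^+ n :> R by exact: exprn_ge0.
have s0 : 0 <= tau by exact: sqrtr_ge0.
have tau2 : tau ^+ 2 = Q by rewrite sqr_sqrtr// ltW.
have xi0 : 0 < xi by rewrite invr_gt0.
have xiQ : xi * Q = 1 by rewrite mulVf// gt_eqF.
have t2 : t ^+ 2 = `|t| ^+ 2 by rewrite real_normK// num_real.
have ia : (t ^+ 2)^-1 <= 4 * xi.
  rewrite -[X in _ <= X]invrK lef_pV2 ?posrE; last 2 first.
  - by rewrite t2 exprn_gt0// (lt_le_trans _ t1).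
  - by rewrite invr_gt0 mulr_gt0.
  have : (tau / 2) ^+ 2 <= t ^+ 2 by rewrite t2 lerXn2r ?nnegrE ?divr_ge0.
  have -> : (4 * xi)^-1 = Q / 4 by rewrite invfM /xi invrK mulrC.
  by rewrite expr_div_n tau2; lra.
have KK : 0 <= 2 * K + 2 by lra.
have k1 := ler_wpM2l KK ia.
have p1 : psi xi n.+1 t <= 2 ^+ n * (2 * xi + (2 * K + 2) * (4 * xi)).
  apply: (le_trans (psi_ub n (ltW xi0) t1)).
  by rewrite ler_wpM2l// lerD2l.
have p0 : psi 0 n.+1 t <= 2 ^+ n * ((2 * K + 2) * (4 * xi)).
  apply: (le_trans (psi_ub n (lexx 0) t1)).
  by rewrite ler_wpM2l// mulr0 add0r.
have q1 := psi_ge0 xi n.+1 t; have q0 := psi_ge0 0 n.+1 t.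
have z1 : 0 <= 2 ^+ n * xi by rewrite mulr_ge0// ltW.
have o0 : 0 <= omega n.+2 xi t <= 2 ^+ n * ((2 * K + 2) * (4 * xi)) + 2 ^+ n * xi + 2 * (2 ^+ n * xi).
  have z2 : 0 <= 2 ^+ n * ((2 * K + 2) * (4 * xi)).
    by apply: mulr_ge0 => //; apply: mulr_ge0 => //; rewrite mulr_ge0// ltW.
  rewrite omegaE ?(ltW Qp)// -/tau -/xi; case: ifPn => [atau'|_].
    have h2 : xi ^+ 2 * t ^+ 2 <= xi.
      have : `|t| ^+ 2 <= Q by rewrite -tau2 lerXn2r ?nnegrE.
      move=> /(ler_wpM2l (ltW xi0)); rewrite xiQ => h.
      by rewrite t2 expr2 -mulrA ler_piMr// ltW.
    have h3 : 0 <= xi ^+ 2 * t ^+ 2 by apply: mulr_ge0; exact: sqr_ge0.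
    have := ler_wpM2l e2 h2; have := ler_wpM2l e2 h3; rewrite mulr0 !mulrA.
    move: p0 q0 z1 z2; rewrite !mulrA; move: (2 ^+ n * xi ^+ 2 * t ^+ 2) (psi 0 n.+1 t) => u v.
    by move=> {k1 ia}; lra.
  have -> : 2 ^+ n.+1 * xi = 2 * (2 ^+ n * xi) by rewrite exprS mulrA.
  by case: ifPn => _; move: z1 z2 => {k1 ia p1 p0}; lra.
have -> : crude_const n * xi = 2 ^+ n * (2 * xi + (2 * K + 2) * (4 * xi)) +
      (2 ^+ n * ((2 * K + 2) * (4 * xi)) + 2 ^+ n * xi + 2 * (2 ^+ n * xi)).
  by rewrite /crude_const -/K; ring.
case/andP: o0 => o0 o1; move: p1 q1 o0 o1 z1 => {p0 q0 k1 ia}.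
move: (omega _ _ _) (psi _ _ _) (2 ^+ n * (2 * xi + _)) (_ + 2 * (2 ^+ n * xi)) => u v b c.
by move=> *; rewrite ler_norml; apply/andP; split; lra.
Qed.

Lemma psi_omega n : exists C Q0 : R, [/\ 0 <= C, 1 <= Q0 & forall Q t, Q0 <= Q ->
  `|psi Q^-1 n.+1 t - omega n.+2 Q^-1 t| <= C * Q^-1 * window n Q t].
Proof.
have K0 : 0 <= Kc R n by exact: sqr_ge0.
pose T := 2 * (Kc R n + 4).
have T1 : 8 <= T by rewrite /T; lra.
have T1' : 1 <= T by lra.
have [C1 C10 HC1] := @psi_near R n T T1'.
have e2 k : 0 <= 2 ^+ k :> R by exact: exprn_ge0.
have C20 : 0 <= crude_const n.
  have := e2 n; rewrite /crude_const => ?.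
  by rewrite !addr_ge0 ?mulr_ge0//; lra.
have T20 : 0 <= 2 ^+ n * T ^+ 2 by apply: mulr_ge0 => //; exact: sqr_ge0.
pose C := C1 + 2 ^+ n * T ^+ 2 + crude_const n.
have C0 : 0 <= C by apply: addr_ge0 => //; exact: addr_ge0.
(* The first summand gives 4 T <= sqrt Q, so |t| <= T falls in the first case of omega; the second
   gives xi T^(n+2) <= 1/2, as [psi_near] demands. *)
pose Q0 := (4 * T) ^+ 2 + 2 * T ^+ n.+2.
have TT : 0 <= T ^+ n.+2 by rewrite exprn_ge0//; lra.
have T4 : 1 <= (4 * T) ^+ 2 by rewrite exprn_ege1//; lra.
exists C, Q0; split => //; first by rewrite /Q0; lra.
move=> Q t QQ0.
have Q1 : (4 * T) ^+ 2 <= Q by move: QQ0; rewrite /Q0; lra.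
have Q2 : 2 * T ^+ n.+2 <= Q by move: QQ0; rewrite /Q0; lra.
have Qp : 0 < Q by lra.
have tauT : 4 * T <= Num.sqrt Q.
  rewrite -(ger0_norm (_ : 0 <= 4 * T)); last lra.
  by rewrite -sqrtr_sqr ler_wsqrtr.
have tau2 : Num.sqrt Q ^+ 2 = Q by rewrite sqr_sqrtr// ltW.
have tauQ : Num.sqrt Q <= Q - 4.
  have : Num.sqrt Q * 2 <= Q by rewrite -[leRHS]tau2 expr2 ler_wpM2l ?sqrtr_ge0//; lra.
  lra.
have xi0 : 0 < Q^-1 by rewrite invr_gt0.
have xi1 : Q^-1 <= 1 by rewrite invf_le1//; lra.
have b0 (b : bool) : 0 <= b%:R :> R by [].
have bump0 : 0 <= window n Q t by rewrite /window !addr_ge0.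
have bound_gen D : 0 <= D -> D <= C -> `|psi Q^-1 n.+1 t - omega n.+2 Q^-1 t| <= D * Q^-1 ->
    1 <= window n Q t -> `|psi Q^-1 n.+1 t - omega n.+2 Q^-1 t| <= C * Q^-1 * window n Q t.
  move=> D0 DC H B; apply: (le_trans H); rewrite -[leLHS]mulr1.
  apply: ler_pM => //; first by rewrite mulr_ge0// ltW.
  by rewrite ler_wpM2r// ltW.
have [aT|Ta] := leP `|t| T.
  apply: (bound_gen (C1 + 2 ^+ n * T ^+ 2)); first exact: addr_ge0.
  - by rewrite /C lerDl.
  - rewrite omegaE ?(ltW Qp)// ifT; last by move=> {bound_gen}; lra.
    rewrite opprD addrA (le_trans (ler_normB _ _))// mulrDl lerD//.
      apply: HC1 => //; first exact: ltW.
      by rewrite mulrC ler_pdivrMr//; move=> {bound_gen}; lra.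
    rewrite ger0_norm; last first.
      by apply: mulr_ge0; [apply: mulr_ge0 => //; exact: sqr_ge0|exact: sqr_ge0].
    have -> : 2 ^+ n * Q^-1 ^+ 2 * t ^+ 2 = 2 ^+ n * (Q^-1 ^+ 2 * t ^+ 2) by rewrite mulrA.
    have -> : 2 ^+ n * T ^+ 2 * Q^-1 = 2 ^+ n * (Q^-1 * T ^+ 2) by rewrite mulrA mulrAC.
    rewrite ler_wpM2l//; apply: ler_pM; [exact: sqr_ge0|exact: sqr_ge0| |].
      by rewrite expr2 ler_piMl// ltW.
    by rewrite -(real_normK (num_real t)) lerXn2r// nnegrE; lra.
  - rewrite /window -/T aT /=.
    by rewrite -addrA lerDl addr_ge0.
have [B2|B2] := boolP ((`| `|t| - Num.sqrt Q| <= T) || (`| `|t| - Q| <= 4)).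
  apply: (bound_gen (crude_const n)) => //.
  - by rewrite /C lerDr addr_ge0.
  - apply: psi_omega_crude => //; first by move=> {bound_gen}; lra.
    by case/orP: B2 => {bound_gen}; rewrite ler_norml => /andP[]; lra.
  - rewrite /window -/T; case/orP: B2 => ->; last by rewrite lerDr addr_ge0.
    by rewrite addrAC lerDr addr_ge0.
move: B2; rewrite negb_or -!ltNge => /andP[B2 B3].
rewrite psi_omega_eq// subrr normr0; apply: mulr_ge0 => //; apply: mulr_ge0 => //; exact: ltW.
Qed.

Lemma measurable_psi (xi : R) m : measurable_fun setT (fun t : R => psi xi m t).
Proof.
have : measurable_fun setT (fun t : mR => ebox m (fun s => (gdens xi m s t)%:E)).
  apply: (@measurable_param R _ mR m (fun t s => (gdens xi m s t)%:E)); last first.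
    by move=> t s; rewrite lee_fin gdens_ge0.
  have mg := measurable_gdens xi m (@mtuple_nth R m).
  exact: (measurableT_comp mg (@measurable_swap _ _ mR (m.-tuple mR))).
by move=> /(measurableT_comp (fine_measurable measurableT)); exact.
Qed.

Lemma measurable_window n Q : measurable_fun setT (window n Q).
Proof.
have mn (c r : R) : measurable_fun setT (fun t : R => (`| `|t| - c| <= r)%R%:R : R).
  have /measurable_EFinP := measurable_near 1 0 c r.
  by under eq_fun do rewrite add0r mulr1.
rewrite /window; apply: measurable_funD => //; apply: measurable_funD => //.
apply: measurable_bool_natr; rewrite -[X in measurable X]setTI.
exact: (measurable_fun_le _ _).
Qed.

Lemma window_ge0 n Q t : 0 <= window n Q t.
Proof. by rewrite /window !addr_ge0. Qed.

Lemma integral_window n Q : (\int[mu]_t (window n Q t)%:E <= (16 * (Kc R n + 4) + 16)%:E)%E.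
Proof.
have K0 : 0 <= Kc R n by exact: sqr_ge0.
pose b (c r t : R) := (`| `|0 + t * 1| - c| <= r)%R%:R : R.
set T := 2 * (Kc R n + 4).
have T0 : 0 <= T by rewrite /T; lra.
have E t : window n Q t = b 0 T t + b (Num.sqrt Q) T t + b Q 4 t.
  by rewrite /window /b add0r mulr1 subr0 normr_id.
have ib (c r : R) : 0 <= r -> (\int[mu]_t (b c r t)%:E <= (4 * r)%:E)%E.
  move=> r0; have := integral_near_line 0 c (oner_neq0 R) r0.
  by rewrite normr1 divr1.
have mb c r : measurable_fun setT (fun t : R => (b c r t)%:E) by exact: measurable_near.
have -> : (\int[mu]_t (window n Q t)%:E =
    \int[mu]_t ((b 0 T t)%:E + (b (Num.sqrt Q) T t)%:E + (b Q 4 t)%:E))%E.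
  by apply: eq_integral => t _; rewrite E.
have b0 c r t : (0 <= (b c r t)%:E)%E by rewrite lee_fin.
have m2 : measurable_fun setT (fun t : R => (b 0 T t)%:E + (b (Num.sqrt Q) T t)%:E)%E.
  exact: emeasurable_funD.
have p2 t : (0 <= (b 0 T t)%:E + (b (Num.sqrt Q) T t)%:E)%E by exact: adde_ge0.
have e1 := @ge0_integralD _ mR R mu setT measurableT (fun t => (b 0 T t)%:E + (b (Num.sqrt Q) T t)%:E)%E
  (fun t => (b Q 4 t)%:E) (fun t _ => p2 t) m2 (fun t _ => b0 _ _ t) (mb _ _).
have e2 := @ge0_integralD _ mR R mu setT measurableT (fun t => (b 0 T t)%:E)
  (fun t => (b (Num.sqrt Q) T t)%:E) (fun t _ => b0 _ _ t) (mb _ _) (fun t _ => b0 _ _ t) (mb _ _).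
rewrite e1 e2.
have -> : 16 * (Kc R n + 4) + 16 = 4 * T + 4 * T + 4 * 4 by rewrite /T; ring.
by rewrite !EFinD; apply: leeD; [apply: leeD; exact: ib|exact: ib].
Qed.

Lemma measurable_omega n Q : 0 <= Q -> measurable_fun setT (fun t : R => omega n.+2 Q^-1 t).
Proof.
move=> Q0; under eq_fun do rewrite omegaE//.
have mnorm : measurable_fun setT (fun t : R => `|t|) by exact: measurableT_comp.
apply: measurable_fun_if => //.
- exact: measurable_fun_ler.
- apply: measurable_funTS; apply: measurable_funD; first exact: measurable_psi.
  by apply: measurable_funM => //; exact: measurable_funX.
- apply: measurable_funTS; apply: measurable_fun_if => //.
  exact: measurable_fun_ltr.
Qed.

Lemma psi_fin (xi : R) n (t : R) : 0 <= xi -> xi <= 1 -> Psi xi n t = (psi xi n.+1 t)%:E.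
Proof.
move=> xi0 xi1; rewrite psiE fineK//.
apply: (@Psi_bounded _ xi n t (Num.max 1 `|t|)) => //; by rewrite le_max lexx ?orbT.
Qed.

(** The windows have bounded total length, and integrating over [A] instead of the whole line can
    only decrease the error; hence uniformity in [A]. *)
Lemma integral_psi_omega n : exists C Q0 : R, [/\ 0 <= C, 1 <= Q0 &
  forall Q (A : set R), Q0 <= Q -> is_interval A ->
  `|rbox n.+1 (farea A Q^-1 n.+1) - \int[mu]_(t in A) omega n.+2 Q^-1 t| <= C / Q].
Proof.
have [C [Q0 [C0 Q01 H]]] := psi_omega n.
have K0 : 0 <= Kc R n by exact: sqr_ge0.
exists (C * (16 * (Kc R n + 4) + 16)), Q0; split => //.
  by apply: mulr_ge0 => //; lra.
move=> Q A QQ iA; have mA := is_interval_measurable iA.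
have Qp : 0 < Q by lra.
have xi0 : 0 < Q^-1 by rewrite invr_gt0.
have xi1 : Q^-1 <= 1 by rewrite invf_le1//; lra.
have E : (\int[mu]_(t in A) (psi Q^-1 n.+1 t)%:E = (rbox n.+1 (farea A Q^-1 n.+1))%:E)%E.
  rewrite -rbox_farea ?gt_eqF//; apply: eq_integral => t _.
  by rewrite -psi_fin// ltW.
have mpsi := measurable_psi Q^-1 n.+1.
have mom := @measurable_omega n Q (ltW Qp).
have ipsi : mu.-integrable A (EFin \o psi Q^-1 n.+1).
  apply/integrableP; split; first exact/measurable_EFinP/measurable_funTS.
  under eq_integral do rewrite /= ger0_norm ?psi_ge0//.
  by rewrite E ltry.
have mdiff : measurable_fun setT (fun t : R => psi Q^-1 n.+1 t - omega n.+2 Q^-1 t).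
  exact: measurable_funB.
have dle : (\int[mu]_(t in A) (`|psi Q^-1 n.+1 t - omega n.+2 Q^-1 t|)%:E <= (C * (16 * (Kc R n + 4) + 16) / Q)%:E)%E.
  apply: (@le_trans _ _ (\int[mu]_(t in A) ((C * Q^-1)%:E * (window n Q t)%:E))%E).
    apply: ge0_le_integral => //.
    - by apply: measurable_funTS; apply/measurable_EFinP; exact: measurableT_comp.
    - apply: measurable_funTS; apply: measurable_funeM; apply/measurable_EFinP.
      exact: measurable_window.
    - by move=> t _; rewrite -EFinM lee_fin; exact: H.
  have CQ : 0 <= C * Q^-1 by apply: mulr_ge0 => //; exact: ltW.
  rewrite ge0_integralZl_EFin//; last 2 first.
  - by move=> t _; rewrite lee_fin window_ge0.
  - by apply: measurable_funTS; apply/measurable_EFinP; exact: measurable_window.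
  have -> : C * (16 * (Kc R n + 4) + 16) / Q = C * Q^-1 * (16 * (Kc R n + 4) + 16) by ring.
  rewrite [X in (_ <= X)%E]EFinM; apply: lee_wpmul2l; first by rewrite lee_fin.
  apply: (le_trans _ (integral_window n Q)); apply: ge0_subset_integral => //.
  - by apply/measurable_EFinP; exact: measurable_window.
  - by move=> t _; rewrite lee_fin window_ge0.
have idiff : mu.-integrable A (EFin \o (fun t => psi Q^-1 n.+1 t - omega n.+2 Q^-1 t)).
  apply/integrableP; split; first exact/measurable_EFinP/measurable_funTS.
  by rewrite (le_lt_trans dle)// ltry.
have -> : rbox n.+1 (farea A Q^-1 n.+1) = \int[mu]_(t in A) psi Q^-1 n.+1 t.
  by rewrite /Rintegral E.
(* Writing omega as psi minus the difference reduces its integrability to that of psi, whose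
   integral is the finite [rbox], and to the L^1 bound. *)
have -> : \int[mu]_(t in A) omega n.+2 Q^-1 t =
    \int[mu]_(t in A) psi Q^-1 n.+1 t - \int[mu]_(t in A) (psi Q^-1 n.+1 t - omega n.+2 Q^-1 t).
  rewrite -RintegralB//; apply: eq_Rintegral => t _; ring.
rewrite opprB addrC subrK (le_trans (le_normr_Rintegral _ _))//.
rewrite /Rintegral -lee_fin fineK//.
rewrite ge0_fin_numE; first by rewrite (le_lt_trans dle)// ltry.
by apply: integral_ge0 => t _; rewrite lee_fin.
Qed.

End density_comparison.
(** * Reducible polynomials *)

Section coefficient_bound.
Variable R : realType.
Implicit Types (f g : {poly R}).

(** Division of f - f(x) by X - x lowers the degree. At any other node the quotient is at most 2 B
    because distinct integers differ by at least 1, and the coefficients of f are recovered from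
    those of the quotient. *)
Lemma interpolation_bound (N n : nat) : exists2 M : R, 0 <= M &
  forall f (s : seq nat) (B : R), (size f <= n)%N -> uniq s -> size s = n ->
    all (fun x => x <= N)%N s -> 0 <= B ->
    (forall x, x \in s -> `|f.[x%:R]| <= B) -> forall i, `|f`_i| <= M * B.
Proof.
elim: n => [|n [M M0 IH]].
  exists 0 => // f s B; rewrite leqn0 size_poly_eq0 => /eqP -> _ _ _ _ _ i.
  by rewrite coef0 normr0 mul0r.
exists (1 + 2 * (N%:R + 1) * M); first by rewrite addr_ge0// !mulr_ge0// addr_ge0.
move=> f [//|x s] B sf /= /andP[xs us] [ss] /andP[xN sN] B0 fB i.
have fx : `|f.[x%:R]| <= B by apply: fB; rewrite mem_head.
have [g gE] : exists g, f - (f.[x%:R])%:P = g * ('X - (x%:R)%:P).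
  by apply/factor_theorem; rewrite /root !hornerE subrr.
have fE : f = g * ('X - (x%:R)%:P) + (f.[x%:R])%:P by rewrite -gE subrK.
have sg : (size g <= n)%N.
  have [->|g0] := eqVneq g 0; first by rewrite size_poly0.
  have : (size (g * ('X - (x%:R)%:P))%R <= n.+1)%N.
    rewrite -gE (leq_trans (size_polyD _ _))// geq_max sf size_polyN.
    by rewrite size_polyC; case: (_ != 0).
  by rewrite size_Mmonic ?monicXsubC// size_XsubC addn2.
have gB y : y \in s -> `|g.[y%:R]| <= 2 * B.
  move=> ys; have yx : y != x by apply: contraNneq xs => <-.
  have fy : `|f.[y%:R]| <= B by apply: fB; rewrite inE ys orbT.
  have : `|g.[y%:R] * (y%:R - x%:R)| <= 2 * B.
    have -> : g.[y%:R] * (y%:R - x%:R) = f.[y%:R] - f.[x%:R].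
      by rewrite [in f.[y%:R]]fE !hornerE addrK.
    rewrite (le_trans (ler_normB _ _))//; lra.
  apply: le_trans; rewrite normrM ler_peMr//.
  have -> : y%:R - x%:R = (y%:Z - x%:Z)%:~R :> R by rewrite intrB.
  by rewrite -intr_norm -[1]/(1%:~R) ler_int; lia.
have B20 : 0 <= 2 * B by rewrite mulr_ge0.
have gi := IH g s (2 * B) sg us ss sN B20 gB.
have : `|f`_i| <= `|(g * 'X)`_i| + x%:R * `|g`_i| + B.
  rewrite {1}fE mulrBr coefD coefB coefMC coefC.
  have h1 : `|if i == 0%N then f.[x%:R] else 0| <= B by case: ifP; rewrite ?normr0.
  have := ler_normD ((g * 'X)`_i - g`_i * x%:R) (if i == 0%N then f.[x%:R] else 0).
  have := ler_normB ((g * 'X)`_i) (g`_i * x%:R).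
  have -> : `|g`_i * x%:R| = x%:R * `|g`_i| by rewrite normrM (ger0_norm (ler0n R x)) mulrC.
  lra.
have h2 : `|(g * 'X)`_i| <= M * (2 * B).
  by rewrite coefMX; case: ifP => _; [rewrite normr0 mulr_ge0|exact: gi].
have h3 : x%:R * `|g`_i| <= N%:R * (M * (2 * B)).
  by apply: ler_pM => //; rewrite ler_nat.
move=> /le_trans; apply; have -> : (1 + 2 * (N%:R + 1) * M) * B = M * (2 * B) + N%:R * (M * (2 * B)) + B by ring.
by rewrite lerD2r lerD.
Qed.

(* By interpolation [|f(x)| >= |f_i| / (M + 1)] for all but at most [n - 1] of
   the points [x = 0, ..., 2 n - 1], and likewise for [g]: some [x] serves both. *)
Lemma coef_mul_bound (n : nat) : exists2 K : R, 0 <= K &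
  forall f g (H : R), (size f <= n)%N -> (size g <= n)%N ->
    (forall i, `|(f * g)`_i| <= H) -> forall i j, `|f`_i| * `|g`_j| <= K * H.
Proof.
have [M M0 HM] := interpolation_bound (2 * n) n.
pose E : R := \sum_(i < (n + n)) (2 * n)%:R ^+ i.
have E0 : 0 <= E by apply: sumr_ge0 => i _; rewrite exprn_ge0.
exists ((M + 1) ^+ 2 * E); first by rewrite mulr_ge0// sqr_ge0.
move=> f g H sf sg fgH i j.
have H0 : 0 <= H by rewrite (le_trans _ (fgH 0%N)).
have M1 : 0 < M + 1 by lra.
have KH0 : 0 <= (M + 1) ^+ 2 * E * H.
  by apply: mulr_ge0 => //; apply: mulr_ge0 => //; exact: sqr_ge0.
have [fi0|fi0] := eqVneq `|f`_i| 0; first by rewrite fi0 mul0r.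
have [gj0|gj0] := eqVneq `|g`_j| 0; first by rewrite gj0 mulr0.
pose bad (h : {poly R}) (k : nat) (x : nat) := `|h.[x%:R]| <= `|h`_k| / (M + 1).
have badlt (h : {poly R}) k : (size h <= n)%N -> `|h`_k| != 0 -> (count (bad h k) (iota 0 (2 * n)) < n)%N.
  move=> sh hk; rewrite ltnNge; apply/negP; rewrite -size_filter => nb.
  pose t := take n [seq x <- iota 0 (2 * n) | bad h k x].
  have ut : uniq t by rewrite take_uniq// filter_uniq// iota_uniq.
  have st : size t = n by rewrite size_take_min (minn_idPl nb).
  have tN : all (fun x => x <= 2 * n)%N t.
    apply/allP => x /mem_take; rewrite mem_filter mem_iota => /andP[_ /andP[_]].
    by rewrite add0n => /ltnW.
  have q0 : 0 <= `|h`_k| / (M + 1) by rewrite divr_ge0// ltW.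
  have bd x : x \in t -> `|h.[x%:R]| <= `|h`_k| / (M + 1).
    by move=> /mem_take; rewrite mem_filter => /andP[].
  have := HM h t _ sh ut st tN q0 bd k.
  rewrite mulrA ler_pdivlMr// mulrDr mulr1 [M * _]mulrC gerDl.
  by rewrite leNgt lt_def hk normr_ge0.
have [x xI] : exists2 x, x \in iota 0 (2 * n) & ~~ bad f i x && ~~ bad g j x.
  apply/hasP; rewrite has_count; apply/negPn/negP; rewrite -eqn0Ngt => /eqP c0.
  have := count_predC (fun x => ~~ bad f i x && ~~ bad g j x) (iota 0 (2 * n)).
  rewrite c0 add0n size_iota (eq_count (a2 := predU (bad f i) (bad g j))); last first.
    by move=> y /=; rewrite negb_and !negbK.
  have := count_predUI (bad f i) (bad g j) (iota 0 (2 * n)).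
  have := badlt f i sf fi0; have := badlt g j sg gj0; lia.
rewrite /bad -!ltNge !ltr_pdivrMr// => /andP[fx gx].
have : `|f`_i| * `|g`_j| <= (`|f.[x%:R]| * (M + 1)) * (`|g.[x%:R]| * (M + 1)).
  by apply: ler_pM => //; exact: ltW.
have -> : `|f.[x%:R]| * (M + 1) * (`|g.[x%:R]| * (M + 1)) = (M + 1) ^+ 2 * `|(f * g).[x%:R]|.
  by rewrite hornerM normrM; ring.
move=> /le_trans; apply; rewrite -mulrA ler_wpM2l ?sqr_ge0//.
rewrite (@horner_coef_wide _ (n + n)); last first.
  by rewrite (leq_trans (size_polyMleq _ _))// (leq_trans (leq_pred _))// leq_add.
rewrite (le_trans (ler_norm_sum _ _ _))// /E mulr_suml; apply: ler_sum => k _.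
rewrite normrM mulrC; apply: ler_pM => //.
move: xI; rewrite mem_iota add0n => /andP[_ /ltnW xN].
by rewrite normrX ger0_norm// lerXn2r ?nnegrE// ler_nat.
Qed.

End coefficient_bound.

(** * Encoding and counting factorizations *)

Section reducible.
Implicit Types (B L M m k l : nat) (f g p : {poly int}).

Definition reducible p := exists f g, [/\ f \is monic, g \is monic,
  (1 < size f)%N, (1 < size g)%N & p = f * g].

(* An integer of absolute value at most [B] is encoded, after adding [B], as an
   element of ['I_B.*2.+1]; the first component of [v] is the constant term. *)
Definition zpoly B m (v : 'I_B.*2.+1 * m.-tuple 'I_B.*2.+1) : {poly int} :=
  'X^(m.+1) + \sum_(k < m) ((tnth v.2 k)%:Z - B%:Z) *: 'X^(k.+1) + (v.1%:Z - B%:Z)%:P.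

Lemma coef_zpoly B m v i : (@zpoly B m v)`_i =
  if i == m.+1 then 1 else if i is j.+1 then
    (if insub j is Some k then (tnth v.2 k)%:Z - B%:Z else 0) else v.1%:Z - B%:Z.
Proof.
rewrite /zpoly !coefD coefXn coefC coef_sum.
have [->|im] := eqVneq i m.+1.
  by rewrite /= addr0 big1 ?addr0// => k _; rewrite coefZ coefXn eqSS gtn_eqF ?mulr0.
case: i im => [|j] im /=.
  by rewrite big1 ?add0r// => k _; rewrite coefZ coefXn mulr0.
rewrite add0r addr0; case: insubP => [k _ kj|jm].
  rewrite (bigD1 k)//= coefZ coefXn kj eqxx mulr1 big1 ?addr0// => k' k'k.
  rewrite coefZ coefXn eqSS -kj (_ : (k == k' :> nat) = false) ?mulr0//.
  by apply/negbTE; apply: contraNneq k'k => kk'; apply/eqP/val_inj.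
rewrite big1// => k _; rewrite coefZ coefXn eqSS (_ : (j == k :> nat) = false) ?mulr0//.
by apply/negbTE; apply: contra jm => /eqP ->.
Qed.

Lemma zpoly_coef_le B m v i : (i <= m)%N -> (`|((@zpoly B m v)`_i)%R| <= B)%N.
Proof.
move=> im; rewrite coef_zpoly ltn_eqF ?ltnS//; case: i im => [|j] im.
  by have := ltn_ord v.1; lia.
by case: insubP => [k _ _|]//; have := ltn_ord (tnth v.2 k); lia.
Qed.

Lemma size_zpoly B m v : size (@zpoly B m v) = m.+2.
Proof.
apply/eqP; rewrite eqn_leq; apply/andP; split.
  apply/leq_sizeP => j mj; rewrite coef_zpoly gtn_eqF//.
  case: j mj => [//|j] mj; case: insubP => [k km kj|//].
  by move: km mj; lia.
rewrite ltnNge; apply/negP => /leq_sizeP/(_ m.+1 (leqnn _)).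
by rewrite coef_zpoly eqxx.
Qed.

Lemma monic_zpoly B m v : @zpoly B m v \is monic.
Proof. by rewrite monicE lead_coefE size_zpoly coef_zpoly eqxx. Qed.

Lemma zpoly_surj B m p : p \is monic -> size p = m.+2 ->
  (forall i, (i <= m)%N -> (`|(p`_i)%R| <= B)%N) -> exists v, p = @zpoly B m v.
Proof.
move=> pm sp pB.
exists (inord `|(p`_0 + B%:Z)%R|%N, [tuple inord `|(p`_k.+1 + B%:Z)%R|%N | k < m]).
have inordB i : (i <= m)%N -> (@inord B.*2 `|(p`_i + B%:Z)%R|%N)%:Z - B%:Z = p`_i.
  by move=> im; rewrite inordK; have := pB i im; lia.
apply/polyP => i; rewrite coef_zpoly.
have [->|im] := eqVneq i m.+1; first by move: pm; rewrite monicE lead_coefE sp => /eqP.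
case: i im => [_|j jm]; first by rewrite /= inordB.
case: insubP => [k km kj|mj] /=; first by rewrite tnth_mktuple inordB kj.
by rewrite nth_default// sp; move: jm mj; lia.
Qed.

Lemma zpoly_inj B m : injective (@zpoly B m).
Proof.
move=> [x u] [y v] /polyP uv; congr pair.
  by have := uv 0%N; rewrite !coef_zpoly /= => H; apply/val_inj => /=; lia.
apply: eq_from_tnth => k; have := uv k.+1; rewrite !coef_zpoly eqSS ltn_eqF//.
by case: insubP => [k' _ /val_inj ->|]; [move=> /= H; apply/val_inj => /=; lia|rewrite ltn_ord].
Qed.

Definition mpol L k (c : {ffun 'I_k -> 'I_L.*2.+1}) : {poly int} :=
  'X^k + \poly_(i < k) (if insub i is Some j then (c j)%:Z - L%:Z else 0).

Lemma mpol_surj L k p : p \is monic -> size p = k.+1 ->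
    (forall i, (i < k)%N -> (`|(p`_i)%R| <= L)%N) ->
  exists2 c, p = @mpol L k c & forall j, (c j)%:Z - L%:Z = p`_j.
Proof.
move=> pm sp pL; exists [ffun j : 'I_k => inord `|(p`_j + L%:Z)%R|%N]; last first.
  move=> j; have := pL j (ltn_ord j); rewrite ffunE.
  move: p`_j => z zL; rewrite inordK; lia.
apply/polyP => i; rewrite coefD coefXn coef_poly.
have [->|ik] := eqVneq i k; first by rewrite ltnn addr0; move: pm; rewrite monicE lead_coefE sp => /eqP.
rewrite add0r; case: ltnP => ik'; last by rewrite nth_default// sp; move: ik ik'; lia.
by have := pL i ik'; rewrite insubT ffunE /=; move: p`_i => z zL; rewrite inordK; lia.
Qed.

(** The constant term of a monic factor of degree k + 1, its k middle coefficients, and the l lower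
    coefficients of a monic factor of degree l. The constant term is kept apart because it limits
    the coefficients of the other factor. *)
Definition fpair L k l : finType :=
  ('I_L.*2.+1 * {ffun 'I_k -> 'I_L.*2.+1} * {ffun 'I_l -> 'I_L.*2.+1})%type.

(* The absolute value of the integer encoded by [x], with 0 replaced by 1. *)
Definition dist0 L (x : 'I_L.*2.+1) : nat := maxn 1 `|x%:Z - L%:Z|%N.

Definition fset_pairs L k l : {set fpair L k l} :=
  [set p : fpair L k l | [forall j, (`|(p.2 j)%:Z - L%:Z|%N <= L %/ dist0 p.1.1)%N]].

Definition fprod L k l (p : fpair L k l) : {poly int} :=
  (mpol p.1.2 * 'X + (p.1.1%:Z - L%:Z)%:P) * mpol p.2.

(** The leading coefficients 1 give |f_i| <= L and |g_j| <= L, and f_0 != 0 gives |g_j| <= L /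
    |f_0|; [dist0] merges the two bounds on g. *)
Lemma fprodP L f g : f \is monic -> g \is monic -> (1 < size f)%N ->
    (forall i j, (`|(f`_i)%R| * `|(g`_j)%R| <= L)%N) ->
  exists2 q, q \in fset_pairs L (size f).-2 (size g).-1 & f * g = fprod q.
Proof.
move=> fm gm sf fgL.
have lcg : g`_(size g).-1 = 1 by move: gm; rewrite monicE lead_coefE => /eqP.
have lcf : f`_(size f).-1 = 1 by move: fm; rewrite monicE lead_coefE => /eqP.
have fL i : (`|(f`_i)%R| <= L)%N by have := fgL i (size g).-1; rewrite lcg muln1.
have gL j : (`|(g`_j)%R| <= L)%N by have := fgL (size f).-1 j; rewrite lcf mul1n.
have gs : size g = (size g).-1.+1 by rewrite prednK// size_poly_gt0 monic_neq0.
have [c cE cg] := mpol_surj gm gs (fun i _ => gL i).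
pose f' := \poly_(i < (size f).-1) f`_i.+1.
have f'E : f = f' * 'X + (f`_0)%:P.
  apply/polyP => i; rewrite coefD coefMX coefC; case: i => [|i]; first by rewrite add0r.
  rewrite /= addr0 coef_poly; case: ltnP => // fi.
  by rewrite nth_default//; move: fi; rewrite -ltnS prednK// ltnW.
have sf' : size f' = (size f).-2.+1.
  have -> : size f' = (size f).-1.
    by apply: size_poly_eq; rewrite prednK ?lcf ?oner_neq0// -ltnS prednK// ltnW.
  by case: (size f) sf => [|[]].
have f'm : f' \is monic.
  rewrite monicE lead_coefE sf' coef_poly /=.
  by case: (size f) sf lcf => [|[|s]] //= _ ->; rewrite ltnSn.
have f'L i : (i < (size f).-2)%N -> (`|(f'`_i)%R| <= L)%N.
  by move=> _; rewrite coef_poly; case: ifP.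
have [d dE _] := mpol_surj f'm sf' f'L.
have xE : (@inord L.*2 `|(f`_0 + L%:Z)%R|%N)%:Z - L%:Z = f`_0.
  by have := fL 0%N; move: f`_0 => z zL; rewrite inordK; lia.
exists (inord `|(f`_0 + L%:Z)%R|%N, d, c).
  rewrite inE; apply/forallP => j /=; rewrite cg /dist0 xE leq_divRL; last by rewrite leq_max.
  rewrite mulnC maxnMl geq_max mul1n gL; exact: fgL.
by rewrite /fprod /= xE -cE -dE -f'E.
Qed.


Lemma card_near L (e : nat) :
  (#|[pred y : 'I_L.*2.+1 | (`|y%:Z - L%:Z| <= e)%N]| <= e.*2.+1)%N.
Proof.
rewrite -[leqRHS]card_ord.
pose h (y : 'I_L.*2.+1) : 'I_e.*2.+1 := inord `|(y%:Z - L%:Z + e%:Z)%R|%N.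
rewrite -(@card_in_image _ _ h); first exact: max_card.
move=> x y; rewrite !inE => xe ye /(congr1 (@nat_of_ord _)).
by rewrite !inordK; [move=> xy; apply/val_inj => /=; lia|lia|lia].
Qed.

Lemma card_fset_pairs L k l : #|fset_pairs L k l| =
  (\sum_(x < L.*2.+1) L.*2.+1 ^ k *
    #|[pred y : 'I_L.*2.+1 | (`|y%:Z - L%:Z| <= L %/ dist0 x)%N]| ^ l)%N.
Proof.
transitivity (\sum_(x < L.*2.+1) \sum_(c : {ffun 'I_k -> 'I_L.*2.+1})
    \sum_(d : {ffun 'I_l -> 'I_L.*2.+1})
    ((d \in ffun_on [pred y : 'I_L.*2.+1 | (`|y%:Z - L%:Z| <= L %/ dist0 x)%N]) : nat))%N.
  rewrite pair_bigA pair_bigA -sum1_card big_mkcond; apply: eq_bigr => -[[x c] d] _ /=.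
  rewrite inE /=; case: ifP.
    by move=> /forallP xd; rewrite (introT ffun_onP).
  by move=> /forallP xd; case: ffun_onP => // H; exfalso; apply: xd => j; exact: H.
apply: eq_bigr => x _; rewrite sum_nat_const card_ffun !card_ord; congr muln.
by rewrite -[in RHS](card_ord l) -card_ffun_on -sum1_card [in RHS]big_mkcond; apply: eq_bigr => d _; case: ifP.
Qed.

Section real_bounds.
Variable R : realType.

(** Since e = [L %/ dist0 x] is at least 1, the 2 e + 1 admissible values of a coefficient are at
    most 3 e, hence at most 3 L divided by [dist0 x]. *)
Lemma card_fset_pairs_le L k l : (0 < L)%N -> (#|fset_pairs L k l|)%:R <=
  (3 * L%:R) ^+ (k + l) * \sum_(x < L.*2.+1) ((dist0 x)%:R ^-1) ^+ l :> R.
Proof.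
move=> L0; have L1 : 1 <= L%:R :> R by rewrite ler1n.
rewrite card_fset_pairs natr_sum mulr_sumr; apply: ler_sum => x _.
have d0 : (0 < dist0 x)%N by rewrite leq_max.
have dL : (dist0 x <= L)%N by rewrite /dist0 geq_max L0/=; have := ltn_ord x; lia.
rewrite natrM !natrX exprD -mulrA -exprMn; apply: ler_pM => //.
- apply: lerXn2r; rewrite ?nnegrE ?mulr_ge0//.
  by rewrite -natrM ler_nat; lia.
apply: lerXn2r; rewrite ?nnegrE ?mulr_ge0//.
have e1 : (1 <= L %/ dist0 x)%N by rewrite divn_gt0.
apply: (@le_trans _ _ (3 * (L %/ dist0 x)%:R)).
  by rewrite -natrM ler_nat (leq_trans (card_near _ _))//; move: e1; lia.
rewrite -mulrA ler_wpM2l// ler_pdivlMr ?ltr0n// -natrM ler_nat.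
exact: leq_divM.
Qed.

Lemma sum_symm (F : nat -> R) L : \sum_(x < L.*2.+1) F `|x%:Z - L%:Z|%N =
  F 0%N + 2 * \sum_(j < L) F j.+1.
Proof.
elim: L => [|L IH]; first by rewrite big_ord0 mulr0 addr0 big_ord1.
rewrite doubleS big_ord_recl big_ord_recr [in RHS]big_ord_recr /=.
rewrite (eq_bigr (fun x : 'I_L.*2.+1 => F `|x%:Z - L%:Z|%N)); last first.
  by move=> x _; congr F; rewrite /bump /=; lia.
rewrite IH [X in F X + (_ + _)](_ : _ = L.+1) /=; last by lia.
rewrite [X in _ + (_ + F X)](_ : _ = L.+1); last by rewrite /bump /=; lia.
ring.
Qed.

Lemma sum_inv_sqr L : \sum_(x < L.*2.+1) ((dist0 x)%:R ^-1) ^+ 2 <= 5 :> R.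
Proof.
rewrite (sum_symm (fun d => ((maxn 1 d)%:R ^-1) ^+ 2)) /= invr1 expr1n.
suff H : \sum_(j < L) ((maxn 1 j.+1)%:R^-1) ^+ 2 <= 2 :> R by lra.
case: L => [|L]; first by rewrite big_ord0.
(* Telescoping with 1 / (y + 1)^2 <= 1 / y - 1 / (y + 1). *)
suff H : \sum_(j < L.+1) ((maxn 1 j.+1)%:R^-1) ^+ 2 <= 2 - L.+1%:R^-1 :> R.
  by rewrite (le_trans H)// lerBlDr lerDl.
elim: L => [|L IH]; first by rewrite big_ord1 invr1 expr1n; lra.
rewrite big_ord_recr/= (le_trans (lerD IH (lexx _)))//.
rewrite (maxn_idPr _)//.
have L1 : 1 <= L.+1%:R :> R by rewrite ler1n.
rewrite -[L.+2]addn1 natrD; set y := L.+1%:R in L1 *.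
rewrite -subr_ge0.
have -> : 2 - (y + 1%:R)^-1 - (2 - y^-1 + (y + 1%:R)^-1 ^+ 2) = y^-1 * (y + 1) ^- 2.
  by field; lra.
by rewrite mulr_ge0 ?invr_ge0 ?exprn_ge0//; lra.
Qed.

Lemma sum_inv L : (0 < L)%N -> \sum_(x < L.*2.+1) (dist0 x)%:R ^-1 <= 3 + 2 * ln L%:R :> R.
Proof.
case: L => [//|L] _.
rewrite (sum_symm (fun d => (maxn 1 d)%:R ^-1)) /= invr1.
suff H : \sum_(j < L.+1) (maxn 1 j.+1)%:R^-1 <= 1 + ln L.+1%:R :> R by lra.
elim: L => [|L IH]; first by rewrite big_ord1 ln1 invr1; lra.
rewrite big_ord_recr/= (le_trans (lerD IH (lexx _)))// (maxn_idPr _)//.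
have L2 : 0 < L.+2%:R :> R by rewrite ltr0n.
have L1 : 0 < L.+1%:R :> R by rewrite ltr0n.
have L21 : L.+2%:R^-1 < 1 :> R by rewrite invf_lt1// ltr1n.
(* At -1 / (L + 2) this reads 1 / (L + 2) <= ln (L + 2) - ln (L + 1). *)
have := @le_ln1Dx R (- L.+2%:R^-1).
rewrite ltrN2 L21 => /(_ isT).
have -> : 1 - L.+2%:R^-1 = L.+1%:R / L.+2%:R :> R.
  by rewrite -[L.+2%:R]natr1; field; lra.
rewrite ln_div ?posrE//; move: (ln L.+1%:R) (ln L.+2%:R) (L.+2%:R^-1) => a b c; lra.
Qed.

End real_bounds.
End reducible.
Section reducible_count.
Variable R : realType.
Implicit Types (B L m : nat) (f g p : {poly int}).

(** Ordering the factors by size makes g the one of larger degree m - k, at least 2 unless m = 1.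
    The constant [K] of [coef_mul_bound] applies because all coefficients of the product, leading
    one included, are at most [B]. *)
Lemma reducible_fprod m : exists2 K : nat, (0 < K)%N & forall B v, (0 < B)%N ->
  reducible (@zpoly B m v) -> exists k, [/\ (k < m)%N, (m == 1%N) || (1 < m - k)%N
    & exists2 q, q \in fset_pairs (K * B) k (m - k) & zpoly v = fprod q].
Proof.
have [K K0 HK] := coef_mul_bound R m.+2.
exists (Num.truncn K).+1 => // B v B0 [f [g]].
wlog sfg : f g / (size f <= size g)%N.
  move=> H [fm gm sf sg vE]; have [fg|gf] := leqP (size f) (size g).
    by apply: (H f g).
  by apply: (H g f); rewrite ?(ltnW gf)//; split=> //; rewrite mulrC.
move=> [fm gm sf sg vE].
have sfgE : (size f + size g).-1 = m.+2.
  by rewrite -(size_zpoly v) vE size_monicM// monic_neq0.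
have fgL i j : (`|(f`_i)%R| * `|(g`_j)%R| <= (Num.truncn K).+1 * B)%N.
  have coefB k : `|(map_poly (intr : int -> R) f * map_poly intr g)`_k| <= B%:R.
    rewrite -rmorphM -vE coef_map /= -intr_norm -[B%:R]/(B%:Z%:~R) ler_int.
    rewrite -abszE lez_nat; have [km|] := leqP k m; first exact: zpoly_coef_le.
    rewrite leq_eqVlt => /predU1P[<-|mk]; first by rewrite coef_zpoly eqxx.
    by rewrite nth_default ?size_zpoly.
  have sf' : (size f <= m.+2)%N by move: sfgE sf sg; lia.
  have sg' : (size g <= m.+2)%N by move: sfgE sf sg; lia.
  have := HK _ _ _ (leq_trans (size_poly _ _) sf') (leq_trans (size_poly _ _) sg') coefB i j.
  rewrite !coef_map /= -!intr_norm -!natr_absz -natrM -(@ler_nat R) => /le_trans; apply.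
  by rewrite natrM ler_wpM2r// ltW// truncnS_gt.
have [q qL fgE] := fprodP fm gm sf fgL.
have km : ((size f).-2 < m)%N by move: sfgE sf sg; lia.
have lE : (size g).-1 = (m - (size f).-2)%N by move: sfgE sf sg; lia.
exists (size f).-2; split => //.
  by rewrite -lE; move: sfgE sf sg sfg; lia.
by rewrite -lE; exists q => //; rewrite vE.
Qed.

Definition reducibles B m := [set v | `[<reducible (@zpoly B m v)>]]%SET.

Lemma card_reducibles_le K B m :
  (forall v, reducible (@zpoly B m v) -> exists k, [/\ (k < m)%N, (m == 1%N) || (1 < m - k)%N
    & exists2 q, q \in fset_pairs (K * B) k (m - k) & zpoly v = fprod q]) ->
  (#|reducibles B m| <= \sum_(k < m | (m == 1%N) || (1 < m - k))
     #|fset_pairs (K * B) k (m - k)|)%N.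
Proof.
move=> H.
pose D k := [set v | [exists q in fset_pairs (K * B) k (m - k), @zpoly B m v == fprod q]]%SET.
apply: (@leq_trans (\sum_(k < m | (m == 1%N) || (1 < m - k)) #|D k|)%N); last first.
  apply: leq_sum => k _.
  have [->|[v0 _]] := set_0Vmem (D k); first by rewrite cards0.
  (* As [zpoly] is injective, each [q] accounts for at most one [v], which [dec] recovers; at other
     [q] the value [v0] is arbitrary. *)
  pose dec (q : fpair (K * B) k (m - k)) := odflt v0 [pick v | @zpoly B m v == fprod q].
  apply: leq_trans (leq_imset_card dec _); apply: subset_leq_card.
  apply/fintype.subsetP => v; rewrite inE => /existsP[q /andP[qS /eqP vq]].
  apply/imsetP; exists q => //; rewrite /dec; case: pickP => [w /eqP wq|/(_ v)].
    by apply: zpoly_inj; rewrite vq wq.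
  by rewrite vq eqxx.
rewrite -sum1_card big_mkcond /=.
under [leqRHS]eq_bigr => k _ do rewrite -sum1_card big_mkcond /=.
rewrite exchange_big /=; apply: leq_sum => v _; case: ifP => //.
rewrite inE => /asboolP /H[k [km mk [q qS vq]]].
rewrite (bigD1 (Ordinal km))//= ifT// inE.
by apply/existsP; exists q; rewrite qS vq eqxx.
Qed.

Lemma card_reducibles m : (0 < m)%N -> exists2 C : R, 0 <= C & forall B, (0 < B)%N ->
  #|reducibles B m|%:R <= C * (B%:R ^+ m * (if m == 1%N then 1 + ln B%:R else 1)).
Proof.
move=> m0; have [K K0 HK] := reducible_fprod m.
have K1 : 1 <= K%:R :> R by rewrite ler1n.
have lnK : 0 <= ln K%:R :> R by rewrite ln_ge0.
(* Large enough for both cases: 5 is the bound of [sum_inv_sqr], and 3 + 2 ln (K B) <= c (1 + ln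
   B). *)
pose c : R := 5 + 2 * ln K%:R.
exists (m%:R * ((3 * K%:R) ^+ m * c)).
  by rewrite !mulr_ge0 ?exprn_ge0 ?mulr_ge0//; rewrite /c; lra.
move=> B B0; have := card_reducibles_le (fun v => @HK B v B0).
rewrite -(@ler_nat R) => /le_trans; apply.
have B1 : 1 <= B%:R :> R by rewrite ler1n.
have lnB : 0 <= ln B%:R :> R by rewrite ln_ge0.
set w : R := if _ then _ else _.
have w1 : 1 <= w by rewrite /w; case: ifP => _ //; lra.
pose b := (3 * (K * B)%:R) ^+ m * (c * w).
have -> : m%:R * ((3 * K%:R) ^+ m * c) * (B%:R ^+ m * w) = m%:R * b.
  rewrite /b natrM [3 * (_ * _)]mulrA [(_ * B%:R) ^+ m]exprMn.
  by move: ((3 * K%:R) ^+ m) (B%:R ^+ m) => x y; ring.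
have b0 : 0 <= b by rewrite !mulr_ge0 ?exprn_ge0 ?mulr_ge0//; rewrite /c; lra.
rewrite natr_sum.
have -> : m%:R * b = \sum_(k < m) b by rewrite sumr_const card_ord mulr_natl.
rewrite big_mkcond/=; apply: ler_sum => k _; case: ifP => // mk.
have KB0 : (0 < K * B)%N by rewrite muln_gt0 K0.
rewrite (le_trans (card_fset_pairs_le _ _ _ KB0))// subnKC; last exact/ltnW.
rewrite ler_wpM2l ?exprn_ge0//.
have d1 (x : 'I_(K * B).*2.+1) : (0 <= (dist0 x)%:R^-1 :> R) && ((dist0 x)%:R^-1 <= 1 :> R).
  by rewrite invr_ge0 ler0n/= invf_le1 ?ler1n ?ltr0n leq_max.
case/orP: mk => mk.
  have -> : (m - k)%N = 1%N by have := ltn_ord k; move/eqP: mk; lia.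
  under eq_bigr do rewrite expr1.
  rewrite (le_trans (sum_inv R KB0))// natrM lnM ?posrE ?ltr0n//.
  rewrite /w mk /c; nra.
apply: (@le_trans _ _ 5).
  apply: le_trans (sum_inv_sqr R (K * B)); apply: ler_sum => x _.
  by have /andP[? ?] := d1 x; rewrite ler_wiXn2l.
rewrite /c; nra.
Qed.

End reducible_count.
(** * Minimal polynomials *)

Section minimal_polynomials.
Variable R : realType.
Implicit Types (p q : {poly int}) (a : R).
Local Notation toR := (map_poly (intr : int -> R)).

(** The leading terms cancel in p - q; if it were nonzero, its primitive part would vanish at [a] in
    smaller degree. *)
Lemma minpoly_uniq p q a : p \is monic -> q \is monic ->
  is_minpoly p a -> is_minpoly q a -> p = q.
Proof.
move=> pm qm [[p0 pc pa] pmin] [[q0 qc qa] qmin].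
have spq : size p = size q by apply/eqP; rewrite eqn_leq pmin//= ?qmin.
apply/eqP; rewrite -subr_eq0; apply/negPn/negP => pq0.
have sr : (size (p - q)%R < size p)%N.
  have [n sp] : exists n, size p = n.+1.
    by exists (size p).-1; rewrite prednK// size_poly_gt0.
  rewrite sp ltnS; apply/leq_sizeP => j; rewrite leq_eqVlt => /predU1P[<-|nj].
    move: pm qm; rewrite !monicE !lead_coefE -spq sp /= => /eqP pn /eqP qn.
    by rewrite coefB pn qn subrr.
  by rewrite coefB !nth_default ?subrr// -?spq sp.
have rc : zcontents (p - q) != 0 by rewrite zcontents_eq0.
suff : (size p <= size (zprimitive (p - q)))%N by rewrite size_zprimitive leqNgt sr.
apply: pmin; split.
- by rewrite zprimitive_eq0.
- by rewrite zcontents_primitive pq0.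
have : root (toR (p - q)) a by rewrite rmorphB rootE !hornerE (eqP pa) (eqP qa) subrr.
rewrite {1}(zpolyEprim (p - q)) map_polyZ rootZ//.
by rewrite intr_eq0.
Qed.

(** Non-minimality gives a smaller q vanishing at [a]. The gcd of p and q over the rationals still
    has root [a], so it is a nonconstant proper divisor of p, and Gauss's lemma makes it
    integral. *)
Lemma reducible_nonminpoly p a : p \is monic -> root (toR p) a ->
  ~ is_minpoly p a -> reducible p.
Proof.
move=> pm pa nmin; have p0 := monic_neq0 pm.
have pv : primitive_vanishing p a by split=> //; exact: zcontents_monic.
have [q [q0 qc qa] qp] : exists2 q, primitive_vanishing q a & (size q < size p)%N.
  apply: contrapT => nq; apply: nmin; split=> // q qv.
  by rewrite leqNgt; apply/negP => qp; apply: nq; exists q.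
pose toQ := map_poly (intr : int -> rat).
have toQ0 r : r != 0 -> toQ r != 0.
  by move=> r0; rewrite map_poly_eq0_id0// intr_eq0 lead_coef_eq0.
have stoQ r : size (toQ r) = size r.
  have [->|r0] := eqVneq r 0; first by rewrite /toQ rmorph0 !size_poly0.
  by rewrite size_map_poly_id0// intr_eq0 lead_coef_eq0.
have ratrQ r : map_poly ratr (toQ r) = toR r.
  by apply/polyP => i; rewrite !coef_map /= ratr_int.
pose d := gcdp (toQ p) (toQ q).
have da : root (map_poly (ratr : rat -> R) d) a.
  by rewrite /d gcdp_map !ratrQ root_gcd pa qa.
have d0 : d != 0 by rewrite gcdp_eq0 negb_and toQ0.
have sd : (1 < size d)%N.
  rewrite -(size_map_poly (ratr : {rmorphism rat -> R})).
  by apply: root_size_gt1 da; rewrite map_poly_eq0.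
have sdp : (size d < size p)%N.
  by apply: leq_ltn_trans qp; rewrite -(stoQ q) dvdp_leq ?toQ0// dvdp_gcdr.
have [p1 [c c0 dE] [r pE]] := dvdpP_rat_int (dvdp_gcdl (toQ p) (toQ q)).
have sp1 : size p1 = size d.
  by rewrite -/d in dE; rewrite dE size_scale// stoQ.
have lc1 : lead_coef p1 * lead_coef r = 1.
  by rewrite -lead_coefM -pE; exact/eqP.
have r0 : r != 0 by apply: contraNneq p0 => r0; rewrite pE r0 mulr0.
have p10 : p1 != 0 by apply: contraNneq p0 => p10; rewrite pE p10 mul0r.
(* Both leading coefficients are the same unit 1 or -1; multiplying each factor by it makes them
   monic and keeps the product. *)
have [u uu [pu ru]] : exists2 u : int, u * u = 1 & lead_coef p1 = u /\ lead_coef r = u.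
  have := intUnitRing.unitzPl lc1; rewrite qualifE /= => /orP[] /eqP l.
  - by exists 1 => //; split=> //; move: lc1; rewrite l; move: (lead_coef r); clear; lia.
  - by exists (-1) => //; split=> //; move: lc1; rewrite l; move: (lead_coef r); clear; lia.
have u0 : u != 0 by apply: contra_eq_neq uu => ->; rewrite mul0r.
exists (u *: p1), (u *: r); split.
- by rewrite monicE lead_coefZ pu uu.
- by rewrite monicE lead_coefZ ru uu.
- by rewrite size_scale// sp1.
- rewrite size_scale//; move: sdp; rewrite -sp1 pE size_mul//; move: p10; rewrite -size_poly_gt0.
  by move: (size p1) (size r); clear; lia.
by rewrite -!mul_polyC mulrACA -polyCM uu mul1r pE.
Qed.

End minimal_polynomials.

(** * From root counts to algebraic integers *)

Section counting.
Variable R : realType.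
Implicit Types (p q : {poly R}) (A : set R) (Q t : R).
Local Notation toR := (map_poly (intr : int -> R)).
Local Notation mu := (@lebesgue_measure R).

Lemma eq_root_count A p q : p != 0 -> q != 0 -> root p =1 root q ->
  root_count A p = root_count A q.
Proof.
move=> p0 q0 pq; apply/permP/uniq_perm; rewrite ?uniq_rootsR// => t.
by rewrite !mem_rootsR.
Qed.

Lemma lattice_sum_tuple Q m (f : seq R -> R) : lattice_sum Q m f =
  \sum_(u : m.-tuple 'I_(grid_size Q)) f [seq grid Q i | i <- [seq nat_of_ord i | i <- u]].
Proof.
elim: m f => [|m IH] f.
  rewrite (bigD1 [tuple])//= big1 ?addr0// => u.
  by rewrite [u]tuple0 => /eqP.
transitivity (\sum_(i < grid_size Q) lattice_sum Q m (fun s => f (grid Q i :: s))) => //.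
under eq_bigr => x _ do rewrite IH.
rewrite pair_bigA /=.
rewrite [RHS](reindex (fun q : 'I_(grid_size Q) * m.-tuple 'I_(grid_size Q) =>
  [tuple of q.1 :: q.2])).
  by [].
exists (fun u => (thead u, [tuple of behead u])) => [[x u] _|u _].
  by congr pair; exact: val_inj.
by rewrite [RHS]tuple_eta.
Qed.

Lemma map_zpoly Q m (v : 'I_(grid_size Q) * m.-tuple 'I_(grid_size Q)) : 1 <= Q ->
  gpoly Q^-1 m [seq grid Q i | i <- [seq nat_of_ord i | i <- v.2]] + grid Q v.1 *: 'X^0
  = Q^-1 *: toR (@zpoly (Num.truncn Q) m v).
Proof.
move=> Q1; have Q0 : Q != 0 by rewrite gt_eqF// (lt_le_trans _ Q1).
have gridE i : grid Q i = Q^-1 * (i%:Z - (Num.truncn Q)%:Z)%:~R.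
  by rewrite /grid rmorphB /= mulrC.
rewrite /zpoly 2!rmorphD /= map_polyXn map_polyC !scalerDr; congr (_ + _ + _).
  rewrite rmorph_sum scaler_sumr; apply: eq_bigr => k _.
  rewrite (nth_map 0%N) ?size_map ?size_tuple//.
  rewrite (nth_map (tnth v.2 k)) ?size_tuple// -tnth_nth gridE.
  by rewrite /= map_polyZ map_polyXn scalerA.
by rewrite gridE expr0 -scalerA alg_polyC.
Qed.

Lemma root_sum_zpoly A Q m : 1 <= Q -> lattice_sum Q m (root_sum A Q m) =
  (\sum_(v : 'I_(Num.truncn Q).*2.+1 * m.-tuple 'I_(Num.truncn Q).*2.+1)
    root_count A (toR (@zpoly (Num.truncn Q) m v)))%:R.
Proof.
move=> Q1; have Q0 : Q^-1 != 0 by rewrite invr_eq0 gt_eqF// (lt_le_trans _ Q1).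
rewrite lattice_sum_tuple natr_sum /root_sum /grid_sum exchange_big pair_bigA /=.
apply: eq_bigr => v _; rewrite (map_zpoly v Q1).
have v0 : toR (@zpoly (Num.truncn Q) m v) != 0.
  by rewrite map_poly_eq0_id0 ?monic_neq0 ?monic_zpoly// intr_eq0 lead_coef_eq0 monic_neq0 ?monic_zpoly.
congr (_%:R); apply: eq_root_count => //; first by rewrite scaler_eq0 negb_or Q0.
by move=> t; rewrite rootZ.
Qed.

(** A monic minimal polynomial is unique, so different [v] contribute disjoint sets of algebraic
    integers. *)
Lemma Omega_sum m Q (I : interval R) : 1 <= Q -> Omega m.+1 Q I =
  (\sum_(v : 'I_(Num.truncn Q).*2.+1 * m.-tuple 'I_(Num.truncn Q).*2.+1)
    count (fun t => `[<[set` I] t /\ is_minpoly (@zpoly (Num.truncn Q) m v) t>])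
      (rootsR (toR (zpoly v))))%N.
Proof.
move=> Q1; have Q0 : 0 <= Q by rewrite (le_trans _ Q1).
set B := Num.truncn Q.
have B0 : (0 < B)%N by rewrite truncn_gt0.
pose good (v : 'I_B.*2.+1 * m.-tuple 'I_B.*2.+1) :=
  [seq t <- rootsR (toR (zpoly v)) | `[<[set` I] t /\ is_minpoly (zpoly v) t>]].
pose s := [seq t | v <- enum {: 'I_B.*2.+1 * m.-tuple 'I_B.*2.+1}, t <- good v].
have v0 v : toR (@zpoly B m v) != 0.
  by rewrite map_poly_eq0_id0 ?monic_neq0 ?monic_zpoly// intr_eq0 lead_coef_eq0 monic_neq0 ?monic_zpoly.
have sE : size s = (\sum_v size (good v))%N.
  by rewrite size_allpairs_dep sumnE big_map big_enum.
have us : uniq s.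
  apply: allpairs_uniq_dep => [|v _|]; first exact: enum_uniq.
    by rewrite filter_uniq// uniq_rootsR.
  move=> _ _ /allpairsPdep[v [t [_ tv ->]]] /allpairsPdep[w [u [_ uw ->]]] /= tu.
  subst u; move: tv uw; rewrite !mem_filter => /andP[/asboolP[_ vt] _] /andP[/asboolP[_ wt] _].
  by have /zpoly_inj -> := minpoly_uniq (monic_zpoly v) (monic_zpoly w) vt wt.
transitivity (size s); last by rewrite sE; apply: eq_bigr => v _; rewrite size_filter.
apply: perm_size; apply: uniq_perm => //.
have fin : finite_set ([set` I] `&` algebraic_integers m.+1 Q).
  exact/finite_setIr/finite_algebraic_integers.
move=> t; rewrite in_fset_set//; apply/idP/idP.
  rewrite inE => -[It [p pt [pm sp hp]]].
  have [|v vE] := @zpoly_surj B m p pm sp.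
    move=> i _; rewrite (leq_trans (height_coef _ _))//.
    by rewrite truncn_ge_nat.
  apply/allpairsPdep; exists v, t; split=> //; first by rewrite mem_enum.
  rewrite mem_filter mem_rootsR// -vE; apply/andP; split; first exact/asboolP.
  by case: pt => -[].
move=> /allpairsPdep[v [u [_ + ->]]]; rewrite mem_filter => /andP[/asboolP[It vt] _].
rewrite inE; split=> //; exists (zpoly v) => //; split; [exact: monic_zpoly|exact: size_zpoly|].
rewrite -truncn_ge_nat// /height; apply/bigmax_leqP => i _.
have := ltn_ord i; rewrite [X in (_ < X)%N]size_zpoly ltnS leq_eqVlt => /predU1P[->|im].
  by rewrite coef_zpoly eqxx.
exact: zpoly_coef_le.
Qed.

(** An irreducible monic polynomial is minimal for each of its roots and contributes no error; a
    reducible one contributes at most its degree. *)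
Lemma Omega_root_sum m Q (I : interval R) : 1 <= Q ->
  `|lattice_sum Q m (root_sum [set` I] Q m) - (Omega m.+1 Q I)%:R| <=
  m.+1%:R * #|reducibles (Num.truncn Q) m|%:R.
Proof.
move=> Q1; rewrite root_sum_zpoly// Omega_sum// !natr_sum -sumrB.
rewrite -sum1_card natr_sum mulr_sumr [leRHS]big_mkcond /= (le_trans (ler_norm_sum _ _ _))//.
apply: ler_sum => v _; set p := zpoly v.
have p0 : toR p != 0.
  by rewrite map_poly_eq0_id0 ?monic_neq0 ?monic_zpoly// intr_eq0 lead_coef_eq0 monic_neq0 ?monic_zpoly.
rewrite inE; case: asboolP => [red|irr]; last first.
  rewrite (_ : root_count _ _ = count (fun t => `[<[set` I] t /\ is_minpoly p t>])
      (rootsR (toR p))) ?subrr ?normr0//.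
  apply: eq_in_count => t; rewrite mem_rootsR// => pt; apply: asbool_equiv_eq.
  split=> [It|[]//]; split=> //; apply: contrapT => np; apply: irr.
  exact: (reducible_nonminpoly (monic_zpoly v) pt np).
rewrite mulr1 ger0_norm; last first.
  by rewrite subr_ge0 ler_nat; apply: sub_count => t /asboolP[It _]; exact/asboolP.
rewrite (@le_trans _ _ (root_count [set` I] (toR p))%:R) ?lerBlDr ?lerDl//.
rewrite ler_nat (leq_trans (root_count_le _ _))//.
by rewrite -ltnS prednK ?size_poly_gt0// (leq_trans (size_poly _ _))// size_zpoly.
Qed.

End counting.

Theorem theorem2 (R : realType) (n : nat) (hn : (2 <= n)%N) :
  exists C : R, \forall Q \near +oo, forall I : interval R,
    `|(Omega n Q I)%:R / (2 * Q) ^+ n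
      - 2 ^- n * \int[lebesgue_measure]_(t in [set` I]) omega n Q^-1 t|
    <= C * (if n == 2%N then ln Q / Q else Q^-1).
Proof.
case: n hn => [//|[//|n]] _.
have [C1 [Q1 [C10 Q11 HC1]]] := integral_psi_omega R n.
have [C2 C20 HC2] := @card_reducibles R n.+1 isT.
pose C3 : R := (8 * n.+1%:R + 1) * disc_bound R n.+1 * 3 ^+ n.+1.
have C30 : 0 <= C3 by rewrite /C3 /disc_bound; do !apply: mulr_ge0 => //; rewrite ?exprn_ge0 ?addr_ge0 ?mulr_ge0.
(* The factor 2 absorbs 1 + ln B <= 2 ln Q when the degree is 2. *)
pose C4 := n.+2%:R * C2 * 2.
have C40 : 0 <= C4 by rewrite !mulr_ge0.
exists (2 ^- n.+2 * (C4 + C3 + C1)).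
near=> Q => I.
have QQ1 : Q1 <= Q by near: Q; apply: nbhs_pinfty_ge; rewrite num_real.
(* From ln Q >= 1 it follows that 1/Q is at most the error term [W] also in degree 2. *)
have Qe : expR 1 <= Q by near: Q; apply: nbhs_pinfty_ge; rewrite num_real.
have Q_ge1 : 1 <= Q by exact: le_trans QQ1.
have Q0 : 0 < Q by exact: lt_le_trans Q_ge1.
have lnQ : 1 <= ln Q by rewrite -(@expRK R 1) ler_ln ?posrE ?expR_gt0.
have Qn0 : 0 < Q ^+ n.+2 by rewrite exprn_gt0.
set J := \int[_]_(t in _) _; set W := if _ then _ else _.
have WQ : Q^-1 <= W.
  by rewrite /W; case: ifP => _ //; rewrite -[leLHS]mul1r ler_pM2r ?invr_gt0.
have H1 := HC1 _ _ QQ1 (@interval_is_interval R I).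
have H2 := root_sum_rbox n.+1 Q_ge1 (@interval_is_interval R I).
have H3 := Omega_root_sum n.+1 I Q_ge1.
set N := lattice_sum _ _ _ in H2 H3; set r := rbox _ _ in H1 H2.
set Om := (Omega _ _ _)%:R in H3 *.
have B0 : (0 < Num.truncn Q)%N by rewrite truncn_gt0.
have BQ : (Num.truncn Q)%:R <= Q by rewrite truncn_le// ltW.
have H4 : n.+2%:R * #|reducibles (Num.truncn Q) n.+1|%:R <= Q ^+ n.+2 * (C4 * W) :> R.
  rewrite /C4 -mulrA (le_trans (ler_wpM2l _ (HC2 _ B0)))//.
  rewrite [leRHS](_ : _ = n.+2%:R * (C2 * (Q ^+ n.+1 * (2 * (Q * W))))); last by rewrite exprSr; ring.
  rewrite !ler_wpM2l// ler_pM ?exprn_ge0//.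
  - by case: ifP => _ //; rewrite addr_ge0// ln_ge0// ler1n.
  - by rewrite lerXn2r ?nnegrE// ltW.
  rewrite /W [n.+2 == _]eqSS; case: ifP => _; last by rewrite divff ?gt_eqF//; lra.
  have : ln (Num.truncn Q)%:R <= ln Q by rewrite ler_ln ?posrE ?ltr0n.
  by rewrite [Q * _]mulrC divfK ?gt_eqF//; lra.
have H5 : `|Om - Q ^+ n.+2 * J| <= Q ^+ n.+2 * ((C4 + C3 + C1) * W).
  (* The three errors: reducible polynomials, lattice sum against integral, psi against omega. *)
  have -> : Om - Q ^+ n.+2 * J = - (N - Om) + (N - Q ^+ n.+2 * r) + Q ^+ n.+2 * (r - J) by ring.
  rewrite (le_trans (ler_normD _ _))// (le_trans (lerD (ler_normD _ _) (lexx _)))//.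
  rewrite normrN [leRHS](_ : _ = Q ^+ n.+2 * (C4 * W) + Q ^+ n.+2 * (C3 * W) +
    Q ^+ n.+2 * (C1 * W)); last by ring.
  apply: lerD; first apply: lerD.
  - exact: le_trans H3 H4.
  - apply: (le_trans H2); rewrite exprMn [leLHS](_ : _ = C3 * Q ^+ n.+1); last by rewrite /C3; ring.
    rewrite mulrCA ler_wpM2l// [Q ^+ n.+2]exprSr -[leLHS]mulr1 -mulrA ler_wpM2l ?exprn_ge0 ?(ltW Q0)//.
    by rewrite -(divff (lt0r_neq0 Q0)) ler_wpM2l// ltW.
  rewrite normrM (ger0_norm (ltW Qn0)) ler_wpM2l ?(ltW Qn0)//.
  by rewrite (le_trans H1)// ler_wpM2l.
have -> : Om / (2 * Q) ^+ n.+2 - 2 ^- n.+2 * J = 2 ^- n.+2 * ((Om - Q ^+ n.+2 * J) / Q ^+ n.+2).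
  by rewrite mulrBl [Q ^+ _ * J]mulrC mulfK ?gt_eqF// exprMn invfM mulrBr; ring.
rewrite normrM ger0_norm ?invr_ge0 ?exprn_ge0// -[leRHS]mulrA ler_wpM2l ?invr_ge0 ?exprn_ge0//.
by rewrite normrM normfV (ger0_norm (ltW Qn0)) ler_pdivrMr// [leRHS]mulrC.
Unshelve. all: by end_near.
Qed.
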